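(* Let $n\ge 1$ and let $\chi_n(\widetilde{\mathbf V}_3)=\sum_{\lambda\vdash n} m_\lambda(\widetilde{\mathbf V}_3)\chi_\lambda$ be the decomposition of the character of the $\Phi S_n$-module $P_n(\widetilde{\mathbf V}_3)$ into an integer combination of irreducible characters of the symmetric group $S_n$, where $\chi_\lambda$ corresponds to the partition $\lambda$ of $n$. Then for every partition $\lambda\vdash n$ the multiplicity is $$ m_\lambda(\widetilde{\mathbf V}_3)=\begin{cases} 1, & \text{if } \lambda=(n),\ \lambda=(p,p)\text{ or }\lambda=(p,p,p)\text{ with } p\ge 1,\\ & \text{or } \lambda=(p+q+r+1,\,p+q+1,\,p+1,\,1)\text{ with } p,q,r\ge 0;\\ 2, & \text{if } \lambda=(p+q,p),\ \lambda=(p+q,p,p)\text{ or }\lambda=(p+q,p+q,p)\text{ with } p,q\ge 1;\\ 3, & \text{if } \lambda=(p+q+r,\,p+q,\,p)\text{ with } p,q,r\ge 1;\\ 0, & \text{in all other cases}, \end{cases} $$ where $p,q,r$ are integers.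
   Context: $\Phi$ is a field of characteristic zero. A Leibniz algebra over $\Phi$ is a $\Phi$-vector space with a bilinear multiplication satisfying $(xy)z=(xz)y+x(yz)$ for all $x,y,z$. The algebra $\widetilde H$: let $T=\Phi[t]$ be the polynomial ring in one variable $t$, and let $H$ be the three-dimensional Heisenberg Lie algebra with basis $\{a,b,c\}$ and multiplication $ba=-ab=c$, all other products of basis elements being zero. Make $T$ a right $H$-module by $fa=f'$ (the derivative of $f$ with respect to $t$), $fb=tf$, $fc=f$ for $f\in T$. Let $\widetilde H=H\oplus T$ (direct sum of vector spaces) with multiplication $(x+f)(y+g)=xy+fy$ for $x,y\in H$, $f,g\in T$, where $xy$ is the product in $H$ and $fy$ is the module action. Then $\widetilde H$ is a Leibniz algebra. The variety $\widetilde{\mathbf V}_3$ is the variety of Leibniz algebras generated by $\widetilde H$, i.e. the class of all algebras over $\Phi$ satisfying every (nonassociative) polynomial identity satisfied by $\widetilde H$. Let $F(X,\widetilde{\mathbf V}_3)$ be its relatively free algebra on the countable set $X=\{x_1,x_2,\dots\}$ of free generators, and let $P_n(\widetilde{\mathbf V}_3)\subset F(X,\widetilde{\mathbf V}_3)$ be the space of multilinear elements in $x_1,\dots,x_n$ (the span of all products, with any bracketing, in which each of $x_1,\dots,x_n$ occurs exactly once). The symmetric group $S_n$ acts on $P_n(\widetilde{\mathbf V}_3)$ on the left by permuting variables: $q\in S_n$ sends the left-normed product $x_{i_1}x_{i_2}\cdots x_{i_n}$ to $x_{q(i_1)}x_{q(i_2)}\cdots x_{q(i_n)}$ (left-normed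 products span $P_n(\widetilde{\mathbf V}_3)$). The character of this $\Phi S_n$-module is denoted $\chi_n(\widetilde{\mathbf V}_3)$. A partition $\lambda\vdash n$ is a sequence $(\lambda_1,\dots,\lambda_k)$ of positive integers with $\lambda_1\ge\cdots\ge\lambda_k$ and sum $n$; $\chi_\lambda$ is the character of the irreducible representation of $S_n$ corresponding to $\lambda$ (with $\chi_{(n)}$ the trivial character). *)

(* Defs.v *)
From HB Require Import structures.
From mathcomp Require Import all_boot all_order all_algebra.
From mathcomp Require Import all_fingroup generic_quotient ring_quotient.
From mathcomp Require Import mxrepresentation finmap monalg.
From mathcomp Require Import boolp ring.

Set Implicit Arguments.
Unset Strict Implicit.
Unset Printing Implicit Defensive.

Import GRing.Theory.
Local Open Scope ring_scope.
Local Open Scope quotient_scope.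

HB.mixin Record Lmodule_isNonAssocAlgebra (R : fieldType) A
    of GRing.Lmodule R A := {
  namul : A -> A -> A;
  namul_linearl : forall y : A, linear (namul^~ y);
  namul_linearr : forall x : A, linear (namul x)
}.

#[short(type="naAlgType")]
HB.structure Definition NonAssocAlgebra (R : fieldType) :=
  {A of GRing.Lmodule R A & Lmodule_isNonAssocAlgebra R A}.

Declare Scope na_scope.
Local Open Scope na_scope.
Notation "x ** y" := (namul x y)
  (at level 40, left associativity, format "x  **  y") : na_scope.

Section NATheory.
Context {R : fieldType} {A : naAlgType R}.
Implicit Types x y z : A.

Definition namulr y x := x ** y.

HB.instance Definition _ y :=
  GRing.isLinear.Build R A A *:%R (namulr y) (namul_linearl y).
HB.instance Definition _ x :=
  GRing.isLinear.Build R A A *:%R (namul x) (namul_linearr x).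

Lemma namulDl x y z : (x + y) ** z = x ** z + y ** z.
Proof. exact: (linearD (namulr z)). Qed.
Lemma namulDr z x y : z ** (x + y) = z ** x + z ** y.
Proof. exact: linearD. Qed.
Lemma namul0l z : 0 ** z = 0.
Proof. exact: (linear0 (namulr z)). Qed.
Lemma namulBl x y z : (x - y) ** z = x ** z - y ** z.
Proof. exact: (linearB (namulr z)). Qed.
Lemma namulBr z x y : z ** (x - y) = z ** x - z ** y.
Proof. exact: linearB. Qed.
Lemma namulZl c x z : (c *: x) ** z = c *: (x ** z).
Proof. exact: (linearZ_LR (namulr z)). Qed.
Lemma namulZr c z x : z ** (c *: x) = c *: (z ** x).
Proof. exact: linearZ_LR. Qed.
Lemma namul_suml I (r : seq I) (F : I -> A) z :
  (\sum_(i <- r) F i) ** z = \sum_(i <- r) F i ** z.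
Proof. exact: (linear_sum (namulr z)). Qed.
Lemma namul_sumr I (r : seq I) (F : I -> A) z :
  z ** (\sum_(i <- r) F i) = \sum_(i <- r) z ** F i.
Proof. exact: linear_sum. Qed.

End NATheory.

Definition leibniz (R : fieldType) (A : naAlgType R) : Prop :=
  forall x y z : A, (x ** y) ** z = (x ** z) ** y + x ** (y ** z).

(* Nonassociative monomials, i.e. bracketed words; variables are numbered     *)
(* from 0.                                                                    *)
Inductive namonom := NAVar of nat | NAMul of namonom & namonom.

Fixpoint namonom_encode (w : namonom) : GenTree.tree nat :=
  match w with
  | NAVar i => GenTree.Leaf i
  | NAMul u v => GenTree.Node 0 [:: namonom_encode u; namonom_encode v]
  end.

Fixpoint namonom_decode (t : GenTree.tree nat) : option namonom :=
  match t with
  | GenTree.Leaf i => Some (NAVar i)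
  | GenTree.Node _ [:: u; v] =>
      if (namonom_decode u, namonom_decode v) is (Some u', Some v')
      then Some (NAMul u' v') else None
  | _ => None
  end.

Lemma namonom_encodeK : pcancel namonom_encode namonom_decode.
Proof. by elim=> //= u -> v ->. Qed.

HB.instance Definition _ := Countable.copy namonom (pcan_type namonom_encodeK).

Fixpoint navars (w : namonom) : seq nat :=
  match w with
  | NAVar i => [:: i]
  | NAMul u v => navars u ++ navars v
  end.

Fixpoint eval_monom (R : fieldType) (A : naAlgType R) (v : nat -> A)
    (w : namonom) : A :=
  match w with
  | NAVar i => v i
  | NAMul w1 w2 => eval_monom v w1 ** eval_monom v w2
  end.

Definition napoly (R : fieldType) := {malg R[namonom]}.
HB.instance Definition _ (R : fieldType) := GRing.Lmodule.on (napoly R).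

Definition eval_poly (R : fieldType) (A : naAlgType R) (v : nat -> A)
    (f : napoly R) : A :=
  \sum_(w <- msupp f) f@_w *: eval_monom v w.

Section EvalLinear.
Context {R : fieldType} {V : lmodType R} (h : namonom -> V).

Definition malg_extend (f : napoly R) : V := \sum_(w <- msupp f) f@_w *: h w.

Lemma malg_extendEw (f : napoly R) (d : {fset namonom}) :
  (msupp f `<=` d)%fset -> malg_extend f = \sum_(w <- d) f@_w *: h w.
Proof.
move=> sfd; rewrite /malg_extend; apply: big_fset_incl => // w _ wNf.
by rewrite mcoeff_outdom // scale0r.
Qed.

Lemma malg_extend_is_linear : linear malg_extend.
Proof.
move=> c f g; pose d := (msupp f `|` msupp g `|` msupp (c *: f + g))%fset.
have sfd : (msupp f `<=` d)%fset by rewrite /d -fsetUA fsubsetUl.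
have sgd : (msupp g `<=` d)%fset by rewrite /d fsetUAC fsubsetUr.
have sd : (msupp (c *: f + g) `<=` d)%fset by rewrite fsubsetUr.
rewrite (malg_extendEw sfd) (malg_extendEw sgd) (malg_extendEw sd).
rewrite scaler_sumr -big_split /=; apply: eq_bigr => w _.
by rewrite mcoeffD mcoeffZ scalerDl scalerA.
Qed.

HB.instance Definition _ :=
  GRing.isLinear.Build R (napoly R) V *:%R malg_extend malg_extend_is_linear.

Lemma malg_extendU w : malg_extend (<< w >> : napoly R) = h w.
Proof.
rewrite (@malg_extendEw _ [fset w]%fset) ?msuppU_le //.
by rewrite big_seq_fset1 mcoeffUU scale1r.
Qed.

End EvalLinear.

Lemma malg_extend_eq (R : fieldType) (V : lmodType R)
    (h : {linear napoly R -> V}) f :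
  h f = malg_extend (fun w => h << w >>) f.
Proof.
rewrite [in LHS](monalgE f) linear_sum; apply: eq_bigr => w _.
rewrite -linearZ_LR; congr (h _); apply/malgP=> k.
by rewrite mcoeffZ !mcoeffU mulr_natr.
Qed.

HB.instance Definition _ (R : fieldType) (A : naAlgType R) (v : nat -> A) :=
  GRing.isLinear.Build R (napoly R) A *:%R (eval_poly v)
    (malg_extend_is_linear (eval_monom v)).

Lemma eval_polyU (R : fieldType) (A : naAlgType R) (v : nat -> A) w :
  eval_poly v << w >> = eval_monom v w.
Proof. exact: malg_extendU. Qed.

Section FreeAlgebra.
Variable R : fieldType.
Implicit Types f g : napoly R.

Definition napoly_mul f g : napoly R :=
  \sum_(u <- msupp f) \sum_(v <- msupp g) (f@_u * g@_v) *: << NAMul u v >>.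

Lemma napoly_mulEl f g : napoly_mul f g =
  malg_extend (fun u => malg_extend (fun v => << NAMul u v >>) g) f.
Proof.
apply: eq_bigr => u _; rewrite scaler_sumr.
by apply: eq_bigr => v _; rewrite scalerA.
Qed.

Lemma napoly_mulEr f g : napoly_mul f g =
  malg_extend (fun v => malg_extend (fun u => << NAMul u v >>) f) g.
Proof.
rewrite /napoly_mul exchange_big; apply: eq_bigr => v _; rewrite scaler_sumr.
by apply: eq_bigr => u _; rewrite scalerA mulrC.
Qed.

Lemma napoly_mul_linearl g : linear (napoly_mul^~ g).
Proof. by move=> c f f' /=; rewrite !napoly_mulEl linearP. Qed.

Lemma napoly_mul_linearr f : linear (napoly_mul f).
Proof. by move=> c g g' /=; rewrite !napoly_mulEr linearP. Qed.

HB.instance Definition _ := Lmodule_isNonAssocAlgebra.Build R (napoly R)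
  napoly_mul_linearl napoly_mul_linearr.

Lemma eval_polyM (A : naAlgType R) (v : nat -> A) f g :
  eval_poly v (f ** g) = eval_poly v f ** eval_poly v g.
Proof.
rewrite linear_sum namul_suml; apply: eq_bigr => u _.
rewrite linear_sum namul_sumr; apply: eq_bigr => w _.
by rewrite linearZ_LR /= eval_polyU /= namulZl namulZr scalerA.
Qed.

Lemma eval_poly_comp (A : naAlgType R) (s : nat -> napoly R) (v : nat -> A) f :
  eval_poly v (eval_poly s f) = eval_poly (fun i => eval_poly v (s i)) f.
Proof.
rewrite [eval_poly s f]/eval_poly linear_sum; apply: eq_bigr => w _.
rewrite linearZ_LR; congr (_ *: _).
by elim: w => //= w1 <- w2 <-; rewrite eval_polyM.
Qed.

End FreeAlgebra.

Definition identity (R : fieldType) (A : naAlgType R) (f : napoly R) : Prop :=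
  forall v : nat -> A, eval_poly v f = 0.

Definition variety_gen (R : fieldType) (A B : naAlgType R) : Prop :=
  forall f : napoly R, identity A f -> identity B f.

Section RelativelyFree.
Context {R : fieldType} (V : naAlgType R -> Prop).

Definition idents : {pred napoly R} :=
  fun f => `[< forall A : naAlgType R, V A -> identity A f >].

Lemma identsP f :
  reflect (forall A : naAlgType R, V A -> identity A f) (f \in idents).
Proof. exact: asboolP. Qed.

Lemma idents_zmod_closed : zmod_closed idents.
Proof.
split=> [|f g /identsP If /identsP Ig]; apply/identsP => A VA v.
  by rewrite linear0.
by rewrite linearB /= If // Ig // subrr.
Qed.
HB.instance Definition _ :=
  GRing.isZmodClosed.Build (napoly R) idents idents_zmod_closed.

Lemma identsZ c f : f \in idents -> c *: f \in idents.
Proof.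
by move=> /identsP If; apply/identsP => A VA v; rewrite linearZ_LR /= If ?scaler0.
Qed.

Lemma identsMl f g : f \in idents -> f ** g \in idents.
Proof.
move=> /identsP If; apply/identsP => A VA v.
by rewrite eval_polyM If // namul0l.
Qed.

Lemma identsMr f g : g \in idents -> f ** g \in idents.
Proof.
by move=> /identsP Ig; apply/identsP => A VA v; rewrite eval_polyM Ig // linear0.
Qed.

Lemma idents_subst (s : nat -> napoly R) f :
  f \in idents -> eval_poly s f \in idents.
Proof.
by move=> /identsP If; apply/identsP => A VA v; rewrite eval_poly_comp If.
Qed.

Definition relfree := Quotient.quot idents.
HB.instance Definition _ := GRing.Zmodule.on relfree.
HB.instance Definition _ := EqQuotient.on relfree.

Definition relfree_pi (f : napoly R) : relfree := \pi_relfree f.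

Lemma relfree_piK u : relfree_pi (repr u) = u.
Proof. exact: reprK. Qed.

Lemma relfree_piP f g : (relfree_pi f = relfree_pi g) <-> (f - g \in idents).
Proof. by rewrite Quotient.idealrBE; split=> /eqP. Qed.

Lemma relfree_pi_is_zmod : zmod_morphism relfree_pi.
Proof. exact: (@pi_is_zmod_morphism _ _ _ (Quotient.quot idents)). Qed.
HB.instance Definition _ := GRing.isZmodMorphism.Build
  (napoly R) relfree relfree_pi relfree_pi_is_zmod.

Definition relfree_scale (c : R) (u : relfree) : relfree :=
  relfree_pi (c *: repr u).
Definition relfree_mul (u v : relfree) : relfree :=
  relfree_pi (repr u ** repr v).

Lemma relfree_piZ c f : relfree_pi (c *: f) = relfree_scale c (relfree_pi f).
Proof.
apply/relfree_piP; rewrite -scalerBr; apply: identsZ.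
by apply/relfree_piP; rewrite relfree_piK.
Qed.

Lemma relfree_piM f g :
  relfree_pi (f ** g) = relfree_mul (relfree_pi f) (relfree_pi g).
Proof.
apply/relfree_piP; set f' := repr _; set g' := repr _.
rewrite -[f ** g](subrK (f' ** g)) -namulBl -addrA -namulBr rpredD //.
  by apply: identsMl; apply/relfree_piP; rewrite relfree_piK.
by apply: identsMr; apply/relfree_piP; rewrite relfree_piK.
Qed.

Lemma relfree_scaleA c d u :
  relfree_scale c (relfree_scale d u) = relfree_scale (c * d) u.
Proof. by rewrite -[u]relfree_piK -!relfree_piZ scalerA. Qed.
Lemma relfree_scale1 : left_id 1 relfree_scale.
Proof. by move=> u; rewrite -[u]relfree_piK -!relfree_piZ scale1r. Qed.
Lemma relfree_scaleDr : right_distributive relfree_scale +%R.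
Proof.
move=> c u v; rewrite -[u]relfree_piK -[v]relfree_piK.
by rewrite -raddfD -!relfree_piZ scalerDr raddfD.
Qed.
Lemma relfree_scaleDl u : {morph relfree_scale^~ u : c d / c + d}.
Proof.
by move=> c d; rewrite -[u]relfree_piK -!relfree_piZ scalerDl raddfD.
Qed.
HB.instance Definition _ := GRing.Zmodule_isLmodule.Build R relfree
  relfree_scaleA relfree_scale1 relfree_scaleDr relfree_scaleDl.

Lemma relfree_mul_linearl v : linear (relfree_mul^~ v).
Proof.
move=> c u u'; rewrite -[u]relfree_piK -[u']relfree_piK -[v]relfree_piK.
rewrite -[c *: _]relfree_piZ -raddfD -!relfree_piM.
by rewrite namulDl namulZl raddfD /= relfree_piZ.
Qed.
Lemma relfree_mul_linearr v : linear (relfree_mul v).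
Proof.
move=> c u u'; rewrite -[u]relfree_piK -[u']relfree_piK -[v]relfree_piK.
rewrite -[c *: _]relfree_piZ -raddfD -!relfree_piM.
by rewrite namulDr namulZr raddfD /= relfree_piZ.
Qed.
HB.instance Definition _ := Lmodule_isNonAssocAlgebra.Build R relfree
  relfree_mul_linearl relfree_mul_linearr.

Definition relfree_gen (i : nat) : relfree := relfree_pi << NAVar i >>.

Lemma eval_relfree_pi (s : nat -> napoly R) f :
  eval_poly (fun i => relfree_pi (s i)) f = relfree_pi (eval_poly s f).
Proof.
rewrite raddf_sum; apply: eq_bigr => w _; rewrite /= relfree_piZ; congr (_ *: _).
by elim: w => //= w1 -> w2 ->; rewrite relfree_piM.
Qed.

Lemma relfree_identity f : f \in idents -> identity relfree f.
Proof.
move=> If v; have -> : v = (fun i => relfree_pi (repr (v i))).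
  by apply/funext=> i; rewrite relfree_piK.
rewrite eval_relfree_pi -(raddf0 relfree_pi); apply/relfree_piP.
by rewrite subr0 idents_subst.
Qed.

(* The homomorphism extending x_i |-> v i; it depends on the choice of the    *)
(* representative of u unless A satisfies the identities of V.                *)
Definition relfree_lift (A : naAlgType R) (v : nat -> A) (u : relfree) : A :=
  eval_poly v (repr u).

Lemma relfree_liftE (A : naAlgType R) (v : nat -> A) f :
  {in idents, forall g, identity A g} ->
  relfree_lift v (relfree_pi f) = eval_poly v f.
Proof.
move=> AV; apply/eqP; rewrite -subr_eq0 -linearB /= AV //.
by apply/relfree_piP; rewrite relfree_piK.
Qed.

End RelativelyFree.

Lemma relfree_variety (R : fieldType) (A : naAlgType R) :
  variety_gen A (relfree (variety_gen A)).
Proof.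
move=> f fA; apply: relfree_identity; apply/identsP => B AB; exact: AB.
Qed.

Definition multilinear_monom (n : nat) (w : namonom) : bool :=
  perm_eq (navars w) (iota 0 n).

Definition multilinear_part (R : fieldType) (V : naAlgType R -> Prop) (n : nat)
    (u : relfree V) : Prop :=
  exists2 s : seq (R * namonom),
    all (fun p => multilinear_monom n p.2) s &
    u = \sum_(p <- s) p.1 *: eval_monom (relfree_gen V) p.2.

Definition perm_var (n : nat) (q : 'S_n) (i : nat) : nat :=
  if insub i is Some j then nat_of_ord (q j) else i.

Definition perm_vars (R : fieldType) (V : naAlgType R -> Prop) (n : nat)
    (q : 'S_n) : relfree V -> relfree V :=
  relfree_lift (fun i => relfree_gen V (perm_var q i)).

Arguments multilinear_part {R} V n u.
Arguments perm_vars {R} V {n} q u.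

Lemma perm_vars_monom (R : fieldType) (V : naAlgType R -> Prop) (n : nat)
    (q : 'S_n) (w : namonom) :
  perm_vars V q (eval_monom (relfree_gen V) w) =
  eval_monom (fun i => relfree_gen V (perm_var q i)) w.
Proof.
rewrite -[in RHS]eval_polyU -(relfree_liftE (V := V)); last first.
  by move=> g; apply: relfree_identity.
congr (perm_vars V q _); elim: w => //= w1 -> w2 ->.
rewrite -[LHS]relfree_piM; congr relfree_pi.
by rewrite /namul /= napoly_mulEl !malg_extendU.
Qed.

(* chi is the character of the S_n-module P (a finite-dimensional subspace of *)
(* M stable under act). Matrices of representations act on row vectors, and   *)
(* (s * t) x = t (s x) in 'S_n, so that rG below is a representation exactly  *)
(* when act is a left action for the usual composition of permutations.       *)
Definition module_character (R : fieldType) (M : lmodType R) (P : M -> Prop)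
    (n : nat) (act : 'S_n -> M -> M) (chi : 'S_n -> R) : Prop :=
  exists d (e : 'I_d -> M) (rG : mx_representation R [set: 'S_n] d),
    [/\ forall u : M, P u <-> exists c : 'rV[R]_d, u = \sum_i c 0 i *: e i,
        forall c : 'rV[R]_d, \sum_i c 0 i *: e i = 0 -> c = 0,
        forall q i, act q (e i) = \sum_j rG q i j *: e j &
        forall q, chi q = \tr (rG q)].

Definition is_partition (n : nat) (l : seq nat) : bool :=
  [&& sorted geq l, 0%N \notin l & sumn l == n].

Record intpart (n : nat) := IntPart {
  parts :> seq nat;
  partsP : is_partition n parts
}.

HB.instance Definition _ n := [isSub for @parts n].
HB.instance Definition _ n := [Countable of intpart n by <:].

Section IntPartFinite.
Variable n : nat.

Lemma size_partition (l : seq nat) : 0%N \notin l -> (size l <= sumn l)%N.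
Proof.
elim: l => //= a l IHl; rewrite inE negb_or eq_sym -lt0n => /andP[a_gt0 /IHl].
by move=> le_l; rewrite -add1n leq_add.
Qed.

Lemma parts_size (l : intpart n) : (size [seq inord i : 'I_n.+1 | i <- l] <= n)%N.
Proof.
case: l => l /= /and3P[_ l0 /eqP <-]; rewrite size_map; exact: size_partition.
Qed.

Definition intpart_bseq (l : intpart n) : n.-bseq 'I_n.+1 :=
  Bseq (parts_size l).
Definition bseq_intpart (b : n.-bseq 'I_n.+1) : option (intpart n) :=
  insub [seq val i | i <- b].

Lemma intpart_bseqK : pcancel intpart_bseq bseq_intpart.
Proof.
move=> l; rewrite /bseq_intpart /= -map_comp map_id_in ?valK // => i il /=.
rewrite inordK // ltnS; case: l il => l /= /and3P[_ _ /eqP <-].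
elim: l => //= a l IHl; rewrite inE => /orP[/eqP->|/IHl le_i].
  exact: leq_addr.
exact: leq_trans le_i (leq_addl _ _).
Qed.

HB.instance Definition _ : isFinite (intpart n) := PCanIsFinite intpart_bseqK.
End IntPartFinite.

(* Row and column stabilizers of the tableau of shape l filled with           *)
(* 0, ..., n.-1 row by row: i is in row reshape_index l i and in column       *)
(* reshape_offset l i.                                                        *)
Definition row_stab (n : nat) (l : seq nat) : {set 'S_n} :=
  [set s : 'S_n | [forall i, reshape_index l (s i) == reshape_index l i]].

Definition col_stab (n : nat) (l : seq nat) : {set 'S_n} :=
  [set t : 'S_n | [forall i, reshape_offset l (t i) == reshape_offset l i]].

(* The Young symmetrizer \sum sgn(t) s t, as a vector of the regular          *)
(* representation; t * s is the composition of s after t.                     *)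
Definition young_symmetrizer (R : fieldType) (n : nat) (l : seq nat) :
    'rV[R]_#|[set: 'S_n]| :=
  \sum_(s in row_stab n l) \sum_(t in col_stab n l)
     (-1) ^+ t *: gring_row (regular_repr R [set: 'S_n] (t * s)%g).

(* The irreducible representation attached to l is the minimal left ideal     *)
(* generated by the Young symmetrizer; right multiplication in 'S_n is left   *)
(* multiplication for the usual composition.                                  *)
Definition irr_repr (R : fieldType) (n : nat) (l : seq nat) :=
  submod_repr (cyclic_mx_module (regular_repr R [set: 'S_n])
                                (young_symmetrizer R n l)).

Definition irr_char (R : fieldType) (n : nat) (l : seq nat) (q : 'S_n) : R :=
  \tr (irr_repr R n l q).

Section Htilde.
Variable R : fieldType.

(* The row vector (x_0, x_1, x_2) stands for x_0 a + x_1 b + x_2 c, with      *)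
(* b a = - a b = c; a, b, c act on f by f', t f and f.                        *)
Definition heis := 'rV[R]_3.

Definition heis_mul (x y : heis) : heis :=
  (x 0 1 * y 0 0 - x 0 0 * y 0 1) *: delta_mx 0 2.

Definition heis_act (f : {poly R}) (x : heis) : {poly R} :=
  x 0 0 *: f^`() + x 0 1 *: ('X * f) + x 0 2 *: f.

Definition Htilde := (heis * {poly R})%type.
HB.instance Definition _ := GRing.Lmodule.copy Htilde (heis * {poly R})%type.

Definition Htilde_mul (u v : Htilde) : Htilde :=
  (heis_mul u.1 v.1, heis_act u.2 v.1).

Lemma Htilde_mul_linearl v : linear (Htilde_mul^~ v).
Proof.
move=> c [x f] [y g]; congr pair => /=.
  by rewrite /heis_mul /= !mxE scalerA -scalerDl; congr (_ *: _); ring.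
rewrite /heis_act /= derivD derivZ -!mul_polyC; ring.
Qed.

Lemma Htilde_mul_linearr u : linear (Htilde_mul u).
Proof.
move=> c [x f] [y g]; congr pair => /=.
  by rewrite /heis_mul /= !mxE scalerA -scalerDl; congr (_ *: _); ring.
rewrite /heis_act /= !mxE -!mul_polyC !polyCD !polyCM; ring.
Qed.

HB.instance Definition _ := Lmodule_isNonAssocAlgebra.Build R Htilde
  Htilde_mul_linearl Htilde_mul_linearr.

Lemma Htilde_leibniz : leibniz Htilde.
Proof.
move=> [x f] [y g] [z h]; congr pair => /=.
  rewrite /heis_mul !mxE /= -scalerDl; congr (_ *: _); ring.
rewrite /heis_act /= !mxE /= !(derivD, derivZ, derivM, derivX) -!mul_polyC.
rewrite !mulr1 !mulr0 polyCB !polyCM; ring.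
Qed.

End Htilde.

Definition V3tilde (R : fieldType) : naAlgType R -> Prop :=
  variety_gen (Htilde R).
Arguments V3tilde R A : clear implicits.

(* Main.v *)
(* On T the product f_i h_j ... h_k of elements of Htilde is f_i acted upon by *)
(* a product in the Weyl algebra, so P_n is induced from S_(n-1) to S_n from   *)
(* the module W of multilinear products of affine functions under the Moyal    *)
(* product, and W is the sum of all irreducible modules with at most three     *)
(* rows. Hence the multiplicity of l in P_n is the number of boxes that can be *)
(* removed from l leaving at most three rows, which is the stated table.       *)
(*   For the lower bound, a product over the columns of l of standard          *)
(* polynomials (commutators, determinants) in which the variable acted upon    *)
(* sits in the column of a removable box yields a highest weight vector, and   *)
(* different boxes yield independent ones. For the upper bound, derivations of *)
(* Htilde show that a multilinear element is determined by the constant terms  *)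
(* of its values at words in a, b, c with one letter 1 in T which, without     *)
(* that letter, are Motzkin words; there are n M_(n-1) of them. The two bounds *)
(* agree because the n-box diagrams l, counted with multiplicity and number    *)
(* of standard tableaux, add up to n times the number of standard tableaux     *)
(* with n - 1 boxes and at most three rows, which is the Motzkin number.       *)
Require Import Defs.
From HB Require Import structures.
From mathcomp Require Import all_boot all_order all_algebra all_fingroup boolp.
From mathcomp Require Import mxrepresentation monalg zify ring.
Set Implicit Arguments.
Unset Strict Implicit.
Unset Printing Implicit Defensive.
Import GRing.Theory.

(** * Young diagrams *)

(** The map [theta] sends a multilinear u to the constant terms of the T-components of its values at
    all words of length n in the letters b, a, c of H and 1 of T. It commutes with S_n
    ([theta_perm]) and is injective on P_n ([theta_inj]), so the character of P_n is the trace on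
    the image of [theta]. That image is found by squeezing its dimension.

    Upper bound: every derivation of Htilde gives linear relations between the values of u
    ([evr_deriv]). By induction on the number of letters a and b, the derivation with b |-> 2a makes
    the constant terms a functional killed by an sl_2 operator, and such a functional is determined
    by ballot words ([lower_ballot_eq0]). Hence u is determined by n M_(n-1) constant terms, M being
    the Motzkin numbers ([motzkin_detect], [dim_upper]).

    Lower bound: for a diagram l and a box whose removal leaves at most three rows, the column
    product [hw] defines a homomorphism [psi] from the regular module, whose image of the Young
    ideal of l is a copy of that ideal. The sum of these copies is direct ([psi_free],
    [image_direct]): Young symmetrizers of different diagrams annihilate each other ([opY_neq]), and
    for a single l evaluations separate the boxes triangularly ([hwy_free]). The Young ideal has at
    least the dimension given by standard tableaux ([rank_ideal_ge]), and the commutation rule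
    [up4_down3] with the Motzkin count of tableaux with at most three rows ([iter_up3_interlace])
    makes the total at least n M_(n-1) ([dim_lower]).

    The bounds meet, so the copies fill the image ([theta_image]) and the number of removable boxes
    is a multiplicity function ([tr_image]); [multiplicity_corner] identifies it with the table, and
    [irr_char_indep] shows that there is no other. *)

Section Diagram.
Variables (n : nat) (l : intpart n).

Definition rowd (i : 'I_n) := reshape_index l i.
Definition cold (i : 'I_n) := reshape_offset l i.

Lemma sumn_parts : sumn l = n.
Proof. by case: l => s /= /and3P[_ _ /eqP]. Qed.

Lemma sorted_parts : sorted geq l.
Proof. by case: l => s /= /and3P[]. Qed.

Lemma parts_gt0 : 0%N \notin parts l.
Proof. by case: l => s /= /and3P[]. Qed.

Lemma nth_parts_le i j : (i <= j)%N -> (nth 0 l j <= nth 0 l i)%N.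
Proof.
move=> ij; case: (ltnP j (size l)) => [jl|/(nth_default 0)-> //].
have geq_trans : transitive geq by move=> y x z /= yx zy; exact: leq_trans zy yx.
have geq_refl : reflexive geq by move=> x /=.
exact: (sorted_leq_nth geq_trans geq_refl 0 sorted_parts) (leq_ltn_trans ij jl) jl ij.
Qed.

Lemma cold_lt i : (cold i < nth 0 l (rowd i))%N.
Proof. by apply: reshape_offsetP; rewrite sumn_parts. Qed.

Lemma diag_inj i j : rowd i = rowd j -> cold i = cold j -> i = j.
Proof.
move=> rij cij; apply: val_inj => /=.
by rewrite -(reshape_indexK l i) -(reshape_indexK l j) -/(rowd i) -/(cold i) rij cij.
Qed.

Lemma box_lt r c : (c < nth 0 l r)%N -> (flatten_index l r c < n)%N.
Proof. by move=> /flatten_indexP; rewrite sumn_parts. Qed.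

Definition box r c (cr : (c < nth 0 l r)%N) : 'I_n := Ordinal (box_lt cr).

Lemma row_box r c cr : rowd (@box r c cr) = r.
Proof. exact: flatten_indexKl. Qed.
Lemma col_box r c cr : cold (@box r c cr) = c.
Proof. exact: flatten_indexKr. Qed.

Lemma diag_up i r : (r <= rowd i)%N -> {j | rowd j = r & cold j = cold i}.
Proof.
move=> ri; have cr : (cold i < nth 0 l r)%N.
  exact: leq_trans (cold_lt i) (nth_parts_le ri).
by exists (box cr); rewrite (row_box, col_box).
Qed.

Lemma cold_ltn i : (cold i < n)%N.
Proof. by apply: leq_ltn_trans (ltn_ord i); exact: leq_subr. Qed.

Lemma card_row r : #|[set i | rowd i == r]| = nth 0 l r.
Proof.
rewrite -[RHS]card_ord; have f_inj : injective (fun c : 'I_(nth 0 l r) => box (ltn_ord c)).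
  by move=> c c' /(congr1 cold); rewrite !col_box => /val_inj.
rewrite -(card_imset _ f_inj); apply: eq_card => i; rewrite !inE.
apply/eqP/imsetP => [ir|[c _ ->]]; last by rewrite row_box.
have cr : (cold i < nth 0 l r)%N by rewrite -ir cold_lt.
by exists (Ordinal cr) => //; apply: diag_inj; rewrite (row_box, col_box).
Qed.

Lemma card_rows_lt k : #|[set i | rowd i < k]| = \sum_(r < k) nth 0 l r.
Proof.
elim: k => [|k IHk]; first by rewrite big_ord0; apply: eq_card0 => i; rewrite inE.
rewrite big_ord_recr /= -IHk -card_row -cardsUI.
set I0 := (X in (_ = _ + #|pred_of_set X|)%N).
have -> : I0 = set0 by apply/setP=> i; rewrite !inE; case: ltngtP.
by rewrite cards0 addn0; apply: eq_card => i; rewrite !inE ltnS leq_eqVlt orbC.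
Qed.


Lemma row_stabP (s : 'S_n) : reflect (forall i, rowd (s i) = rowd i) (s \in row_stab n l).
Proof. by rewrite inE; apply: forallPP => i; exact: eqP. Qed.
Lemma col_stabP (s : 'S_n) : reflect (forall i, cold (s i) = cold i) (s \in col_stab n l).
Proof. by rewrite inE; apply: forallPP => i; exact: eqP. Qed.

End Diagram.

(** * Dominance order and factorization of permutations *)

Section Dominance.
Variables (n : nat) (l m : intpart n) (h : 'S_n).
Hypothesis h_inj : forall i j, rowd l i = rowd l j ->
  cold m (h i) = cold m (h j) -> i = j.

Let L k c := [set i | (rowd l i < k) && (cold m (h i) == c)].
Let M k c := [set x | (rowd m x < k) && (cold m x == c)].

(** By [h_inj] column c receives at most one cell from each row of l. If column c of m reaches row
    k, each cell can be moved to the cell of column c in its own row; otherwise the whole column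
    lies above row k and h itself is the injection. *)
Lemma dom_col k c : #|L k c| <= #|M k c|.
Proof.
case: (pselect (exists2 x, cold m x = c & k <= rowd m x)) => [[x xc kx]|noM].
  pose g i := if (rowd l i <= rowd m x) =P true is ReflectT p
              then s2val (diag_up p) else x.
  have gP i : rowd l i < k -> rowd m (g i) = rowd l i /\ cold m (g i) = c.
    move=> ik; rewrite /g; case: eqP => [p|[]].
      by case: (diag_up p) => j /= -> ->.
    exact: leq_trans (ltnW ik) kx.
  have g_inj : {in L k c &, injective g}.
    move=> i j; rewrite !inE => /andP[/gP[ri _] /eqP ci] /andP[/gP[rj _] /eqP cj] gij.
    by apply: h_inj; rewrite ?ci ?cj // -ri -rj gij.
  rewrite -(card_in_imset g_inj); apply/subset_leq_card/subsetP=> _ /imsetP[i + ->].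
  by rewrite !inE => /andP[ik _]; have [-> ->] := gP i ik; rewrite ik eqxx.
rewrite -(card_imset _ (@perm_inj _ h)); apply/subset_leq_card/subsetP=> _ /imsetP[i + ->].
rewrite !inE => /andP[_ ci]; rewrite ci andbT ltnNge; apply/negP=> ki.
by apply: noM; exists (h i) => //; apply/eqP.
Qed.

Lemma sum_dom_col k : \sum_(c < n) #|L k c| = #|[set i | rowd l i < k]|.
Proof.
rewrite -sum1_card [RHS](partition_big (fun i => Ordinal (cold_ltn m (h i))) predT) //=.
apply: eq_bigr => c _; rewrite sum1_card; apply: eq_card => i.
by rewrite !inE unfold_in /= inE.
Qed.

Lemma sum_dom_colm k : \sum_(c < n) #|M k c| = #|[set i | rowd m i < k]|.
Proof.
rewrite -sum1_card [RHS](partition_big (fun i => Ordinal (cold_ltn m i)) predT) //=.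
apply: eq_bigr => c _; rewrite sum1_card; apply: eq_card => i.
by rewrite !inE unfold_in /= inE.
Qed.

Lemma dom_rows k : #|[set i | rowd l i < k]| <= #|[set i | rowd m i < k]|.
Proof.
by rewrite -sum_dom_col -sum_dom_colm; apply: leq_sum => c _; exact: dom_col.
Qed.

End Dominance.

Definition dominated n (l m : intpart n) :=
  forall k, #|[set i | rowd l i < k]| <= #|[set i | rowd m i < k]|.

(** Equal partial sums give equal rows up to trailing zeros, and the absence of zero parts gives
    equal lengths. *)
Lemma dominated_anti n (l m : intpart n) : dominated l m -> dominated m l -> l = m.
Proof.
move=> lm ml; apply: val_inj => /=.
have e k : \sum_(r < k) nth 0 l r = \sum_(r < k) nth 0 m r.
  by rewrite -!card_rows_lt; apply/eqP; rewrite eqn_leq lm ml.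
have en k : nth 0 l k = nth 0 m k.
  by have := e k.+1; rewrite !big_ord_recr /= e => /addnI.
have lt_size (p q : intpart n) : (forall k, nth 0 p k = nth 0 q k) -> size p <= size q.
  move=> pq; rewrite leqNgt; apply/negP=> qp.
  by move/negP: (parts_gt0 p); case; rewrite -(nth_default 0 (leqnn (size q))) -pq mem_nth.
by apply: (@eq_from_nth _ 0) => [|i _]; rewrite ?en //; apply/eqP;
  rewrite eqn_leq !lt_size.
Qed.

Section Factor.
Variables (n : nat) (l : intpart n) (h : 'S_n).
Hypothesis h_inj : forall i j, cold l i = cold l j ->
  rowd l (h i) = rowd l (h j) -> i = j.

(** For h^-1 the inequalities of [dom_col] add up to an equality over the columns, so each is an
    equality. Subtracting the ones for r and r + 1 rows, with r the row of h x, yields a cell in row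
    r and in the column of x. Moving x there is the column permutation t; what remains of h
    preserves rows. *)
Lemma col_row_factor : exists2 t, t \in col_stab n l & exists2 s, s \in row_stab n l & h = (t *
  s)%g.
Proof.
pose h' := (h^-1)%g.
have h'_inj i j : rowd l i = rowd l j -> cold l (h' i) = cold l (h' j) -> i = j.
  move=> rij cij; apply: (@perm_inj _ h'); apply: h_inj => //.
  by rewrite /h' !permKV.
have eqM k c : (c < n) -> #|[set i | (rowd l i < k) && (cold l (h' i) == c)]| =
    #|[set x | (rowd l x < k) && (cold l x == c)]|.
  move=> cn.
  have := leqif_sum (P := predT) (fun c' (_ : true) => leqif_eq (dom_col h'_inj k (nat_of_ord (c'
    : 'I_n)))).
  rewrite sum_dom_col sum_dom_colm => -[_]; rewrite eqxx => /esym/forallP/(_ (Ordinal cn)).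
  by move=> /eqP.
have ex x : {y | rowd l y = rowd l (h x) & cold l y = cold l x}.
  pose r := rowd l (h x).
  have /set0Pn/sigW[y] : [set y | (rowd l y == r) && (cold l y == cold l x)] != set0; last first.
    by rewrite inE => /andP[/eqP ? /eqP ?]; exists y.
  rewrite -card_gt0.
  have split (A : pred 'I_n) : #|[set y | (rowd l y < r.+1) && A y]| =
       (#|[set y | (rowd l y < r) && A y]| + #|[set y | (rowd l y == r) && A y]|)%N.
    rewrite -cardsUI; set I0 := (X in (_ = _ + #|pred_of_set X|)%N).
    have -> : I0 = set0 by apply/setP=> i; rewrite !inE; case: ltngtP; rewrite ?andbF.
    rewrite cards0 addn0; apply: eq_card => i.
    by rewrite !inE ltnS leq_eqVlt orbC andb_orl.
  have := eqM r.+1 _ (cold_ltn l x); rewrite !split eqM ?cold_ltn // => /addnI <-.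
  rewrite card_gt0; apply/set0Pn; exists (h x).
  by rewrite inE eqxx /= /h' permK.
pose t x := s2val (ex x).
have tr x : rowd l (t x) = rowd l (h x) by rewrite /t; case: (ex x).
have tc x : cold l (t x) = cold l x by rewrite /t; case: (ex x).
have t_inj : injective t.
  move=> x y txy; apply: h_inj; first by rewrite -tc txy tc.
  by rewrite -tr txy tr.
pose T := perm t_inj.
exists T; first by apply/col_stabP=> i; rewrite permE.
exists (T^-1 * h)%g; last by rewrite mulKVg.
apply/row_stabP=> i; rewrite permM; set j := (T^-1)%g i.
have Tj : T j = i by rewrite /j permKV.
by rewrite -Tj [in RHS]permE tr.
Qed.

End Factor.

(** * Young symmetrizers *)

Local Open Scope ring_scope.
(* With c = 0, a matrix of square zero has trace zero.                         *)
Lemma mxtrace_quasi_idem (F : fieldType) n (Z : 'M[F]_n) c :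
  Z *m Z = c *: Z -> \tr Z = c * (\rank Z)%:R.
Proof.
move=> ZZ; pose P := col_base Z; pose Q := row_base Z.
have PQ : P *m Q = Z by exact: mulmx_base.
have QP : Q *m P = c%:M.
  apply: (row_full_inj (A := P)); last first.
    apply: (row_free_inj (row_base_free Z)).
    by rewrite -/Q mulmxA PQ -mulmxA PQ ZZ mul_mx_scalar -scalemxAl PQ.
  exact: col_base_full.
by rewrite -PQ mxtrace_mulC QP mxtrace_scalar mulr_natr PQ.
Qed.

Section StabGroup.
Variables (n : nat) (l : intpart n).

Lemma row_stabM (s x : 'S_n) : s \in row_stab n l -> (s * x \in row_stab n l)%g = (x \in row_stab
  n l).
Proof.
move=> /row_stabP sR; apply/row_stabP/row_stabP => xR i; last by rewrite permM xR sR.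
by have := xR ((s^-1)%g i); rewrite permM permKV => ->; rewrite -[in RHS](permKV s i) sR.
Qed.
Lemma row_stabMr (s x : 'S_n) : s \in row_stab n l -> (x * s \in row_stab n l)%g = (x \in
  row_stab n l).
Proof.
move=> /row_stabP sR; apply/row_stabP/row_stabP => xR i; last by rewrite permM sR xR.
by rewrite -[RHS]xR permM sR.
Qed.
Lemma col_stabM (s x : 'S_n) : s \in col_stab n l -> (s * x \in col_stab n l)%g = (x \in col_stab
  n l).
Proof.
move=> /col_stabP sR; apply/col_stabP/col_stabP => xR i; last by rewrite permM xR sR.
by have := xR ((s^-1)%g i); rewrite permM permKV => ->; rewrite -[in RHS](permKV s i) sR.
Qed.
Lemma col_stabMr (s x : 'S_n) : s \in col_stab n l -> (x * s \in col_stab n l)%g = (x \in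
  col_stab n l).
Proof.
move=> /col_stabP sR; apply/col_stabP/col_stabP => xR i; last by rewrite permM sR xR.
by rewrite -[RHS]xR permM sR.
Qed.
Lemma row_stab1 : (1%g : 'S_n) \in row_stab n l.
Proof. by apply/row_stabP=> i; rewrite perm1. Qed.
Lemma col_stab1 : (1%g : 'S_n) \in col_stab n l.
Proof. by apply/col_stabP=> i; rewrite perm1. Qed.
Lemma row_stabV (s : 'S_n) : (s^-1 \in row_stab n l)%g = (s \in row_stab n l).
Proof.
apply/idP/idP => sR.
  by rewrite -(row_stabM _ sR) mulVg row_stab1.
by rewrite -(row_stabM _ sR) mulgV row_stab1.
Qed.
Lemma col_stabV (s : 'S_n) : (s^-1 \in col_stab n l)%g = (s \in col_stab n l).
Proof.
apply/idP/idP => sR.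
  by rewrite -(col_stabM _ sR) mulVg col_stab1.
by rewrite -(col_stabM _ sR) mulgV col_stab1.
Qed.
Lemma row_stab_tperm i j : rowd l i = rowd l j -> tperm i j \in row_stab n l.
Proof. by move=> ij; apply/row_stabP=> k; case: tpermP => [->|->|]. Qed.
Lemma col_stab_tperm i j : cold l i = cold l j -> tperm i j \in col_stab n l.
Proof. by move=> ij; apply/col_stabP=> k; case: tpermP => [->|->|]. Qed.
Lemma row_col_stab1 (s : 'S_n) : s \in row_stab n l -> s \in col_stab n l -> s = 1%g.
Proof.
move=> /row_stabP sR /col_stabP sC; apply/permP=> i; rewrite perm1.
exact: (diag_inj (sR i) (sC i)).
Qed.
End StabGroup.

Section YoungOp.
Variables (F : fieldType) (n d : nat) (rG : mx_representation F [set: 'S_n] d).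
Implicit Types (l m : intpart n) (s t g h : 'S_n).

(* The column operator comes first because the product t * s of permutations   *)
(* is the composition of s after t.                                            *)
Definition opA l : 'M[F]_d := \sum_(s in row_stab n l) rG s.
Definition opB l : 'M[F]_d := \sum_(t in col_stab n l) (-1) ^+ t *: rG t.
Definition opY l := opB l *m opA l.

Lemma rGM g h : rG (g * h)%g = rG g *m rG h.
Proof. by rewrite repr_mxM ?inE. Qed.

Lemma opA_mull l s : s \in row_stab n l -> rG s *m opA l = opA l.
Proof.
move=> sR; rewrite mulmx_sumr [RHS](reindex_inj (mulgI s)) /=.
by apply: eq_big => [x|x _]; rewrite ?row_stabM ?rGM.
Qed.
Lemma opA_mulr l s : s \in row_stab n l -> opA l *m rG s = opA l.
Proof.
move=> sR; rewrite mulmx_suml [RHS](reindex_inj (mulIg s)) /=.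
by apply: eq_big => [x|x _]; rewrite ?row_stabMr ?rGM.
Qed.
Lemma opB_mull l t : t \in col_stab n l -> rG t *m opB l = (-1) ^+ t *: opB l.
Proof.
move=> tC; rewrite mulmx_sumr [RHS]/= [in RHS]/opB [in RHS](reindex_inj (mulgI t)) /= scaler_sumr.
apply: eq_big => [x|x _]; rewrite ?col_stabM // rGM -scalemxAr scalerA odd_permM.
by rewrite signr_addb mulrA -signr_addb addbb mul1r.
Qed.
Lemma opB_mulr l t : t \in col_stab n l -> opB l *m rG t = (-1) ^+ t *: opB l.
Proof.
move=> tC; rewrite mulmx_suml [in RHS]/opB [in RHS](reindex_inj (mulIg t)) /= scaler_sumr.
apply: eq_big => [x|x _]; rewrite ?col_stabMr // rGM -scalemxAl scalerA odd_permM.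
by rewrite addbC signr_addb mulrA -signr_addb addbb mul1r.
Qed.

Lemma opYE l : opY l = \sum_(s in row_stab n l) \sum_(t in col_stab n l) (-1) ^+ t *: rG (t * s)%g.
Proof.
rewrite /opY mulmx_sumr; apply: eq_bigr => s _; rewrite mulmx_suml.
by apply: eq_bigr => t _; rewrite rGM scalemxAl.
Qed.

Lemma opABE l m g : opA l *m rG g *m opB m =
  \sum_(s in row_stab n l) \sum_(t in col_stab n m) (-1) ^+ t *: rG (s * g * t)%g.
Proof.
rewrite !mulmx_suml; apply: eq_bigr => s _; rewrite mulmx_sumr.
by apply: eq_bigr => t _; rewrite -scalemxAr -!rGM.
Qed.

(** Grouping the product as B_l (A_l g B_m) A_m exposes both the inner products A g B and the outer
    products B h A. *)
Lemma opYgYE l m g : opY l *m rG g *m opY m =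
  \sum_(s in row_stab n l) \sum_(t in col_stab n m)
    (-1) ^+ t *: (opB l *m rG (s * g * t)%g *m opA m).
Proof.
have -> : opY l *m rG g *m opY m = opB l *m (opA l *m rG g *m opB m) *m opA m.
  by rewrite /opY !mulmxA.
move: (opB l) (opA m) => P Q; rewrite opABE mulmx_sumr mulmx_suml.
apply: eq_bigr => s _; rewrite mulmx_sumr mulmx_suml.
by apply: eq_bigr => t _; rewrite -scalemxAr -scalemxAl.
Qed.

Hypothesis char0 : [pchar F] =i pred0.

Lemma opp_eq0 (M : 'M[F]_d) : M = - M -> M = 0.
Proof.
move=> /eqP; rewrite -addr_eq0 -mulr2n -scaler_nat scaler_eq0.
by rewrite (proj1 (pcharf0P F) char0) /= => /eqP.
Qed.

(** The transposition of i and j is absorbed by A; carried through g it becomes the transposition of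
    g i and g j, which B absorbs with sign -1. The product equals its opposite. *)
Lemma opAB_eq0 l m g i j : i <> j -> rowd l i = rowd l j ->
  cold m (g i) = cold m (g j) -> opA l *m rG g *m opB m = 0.
Proof.
move=> ij rij cij; apply: opp_eq0.
rewrite -[in LHS](opA_mulr (row_stab_tperm rij)) -[opA l *m _ *m _]mulmxA -rGM.
have -> : (tperm i j * g = g * tperm (g i) (g j))%g by rewrite -tpermJ conjgE mulgA mulgA mulgV
  mul1g.
rewrite rGM -!mulmxA opB_mull ?col_stab_tperm // odd_tperm.
have -> : g i != g j by apply/eqP=> /perm_inj.
by rewrite scaleN1r !mulmxN.
Qed.

Lemma opBA_eq0 l m g i j : i <> j -> cold l i = cold l j ->
  rowd m (g i) = rowd m (g j) -> opB l *m rG g *m opA m = 0.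
Proof.
move=> ij cij rij; apply: opp_eq0.
rewrite -[in LHS](opA_mull (row_stab_tperm rij)) [_ *m (rG _ *m _)]mulmxA -[_ *m _ *m rG (tperm _
  _)]mulmxA -rGM.
have <- : (tperm i j * g = g * tperm (g i) (g j))%g by rewrite -tpermJ conjgE mulgA mulgA mulgV
  mul1g.
rewrite rGM [_ *m (rG _ *m _)]mulmxA (opB_mulr (col_stab_tperm cij)) odd_tperm.
have -> : i != j by apply/eqP.
by rewrite scaleN1r !mulNmx.
Qed.

Lemma opAB_dom l m g : ~ dominated l m -> opA l *m rG g *m opB m = 0.
Proof.
move=> ndom; apply: contrapT => nz; apply: ndom; apply: (@dom_rows _ _ _ g) => i j rij cij.
by apply: contrapT => ij; apply: nz; exact: opAB_eq0 ij rij cij.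
Qed.

Lemma opBA_dom l m g : ~ dominated m l -> opB l *m rG g *m opA m = 0.
Proof.
move=> ndom; apply: contrapT => nz; apply: ndom.
apply: (@dom_rows _ _ _ (g^-1)%g) => i j rij cij; apply: contrapT => ij.
apply: nz; apply: (@opBA_eq0 l m g ((g^-1)%g i) ((g^-1)%g j)) => //.
  by move=> /perm_inj.
by rewrite !permKV.
Qed.

(** By antisymmetry of dominance, either l is not dominated by m and the inner product vanishes, or
    m is not dominated by l and all outer products vanish. *)
Lemma opY_neq l m g : l <> m -> opY l *m rG g *m opY m = 0.
Proof.
move=> lm.
have -> : opY l *m rG g *m opY m = opB l *m (opA l *m rG g *m opB m) *m opA m.
  by rewrite /opY !mulmxA.
case: (pselect (dominated l m)) => [dlm|/opAB_dom ->]; last by rewrite mulmx0 mul0mx.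
have ndml : ~ dominated m l by move=> dml; apply: lm; exact: dominated_anti.
rewrite !mulmxA -[_ *m opB m *m _]mulmxA opYgYE big1 // => s _; rewrite big1 // => t _.
by rewrite opBA_dom // scaler0.
Qed.

End YoungOp.

Section Quasi.
Variables (F : fieldType) (n : nat) (char0 : [pchar F] =i pred0) (l : intpart n).
Local Notation rep d := (mx_representation F [set: 'S_n] d).

(** Either [col_row_factor] applies and both factors of h are absorbed, or two cells of a column
    land in one row and the product is 0. The scalar is chosen before the representation, so it can
    be studied in the regular one and used in any other. *)
Lemma opBA_scalar h : exists c : F, forall d (rG : rep d), opB rG l *m rG h *m opA rG l = c *:
  opY rG l.
Proof.
case: (pselect (forall i j, cold l i = cold l j -> rowd l (h i) = rowd l (h j) -> i = j)) => [inj|].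
  have [t tC [s sR ->]] := col_row_factor inj.
  exists ((-1) ^+ t) => d rG; rewrite rGM mulmxA opB_mulr // -scalemxAl -scalemxAl -mulmxA.
  by rewrite opA_mull.
move=> /existsNP[i /existsNP[j /not_implyP[cij /not_implyP[rij ij]]]].
by exists 0 => d rG; rewrite scale0r; apply: opBA_eq0 ij cij rij.
Qed.

Lemma opYgY g : exists c : F, forall d (rG : rep d), opY rG l *m rG g *m opY rG l = c *: opY rG l.
Proof.
have [c cP] := choice opBA_scalar.
exists (\sum_(s in row_stab n l) \sum_(t in col_stab n l) (-1) ^+ t * c (s * g * t)%g) => d rG.
rewrite opYgYE scaler_suml; apply: eq_bigr => s _; rewrite scaler_suml.
by apply: eq_bigr => t _; rewrite cP scalerA.
Qed.

Local Notation aG := (regular_repr F [set: 'S_n]).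
Local Notation N := #|[set: 'S_n]|.

Lemma tr_regular (g : 'S_n) : \tr (aG g) = if g == 1%g then (n`!)%:R else 0.
Proof.
have cN : N = n`! by rewrite cardsT card_Sn.
case: eqP => [->|g1]; first by rewrite repr_mx1 mxtrace1 -cN.
rewrite /mxtrace big1 // => i _; rewrite !mxE /=.
case: eqP => // /(congr1 enum_val); rewrite gring_indexK ?inE // => /eqP.
by rewrite -{1}[enum_val i]mulg1 (inj_eq (mulgI _)) => /eqP /esym.
Qed.

(** Only the identity has nonzero trace, and t s = 1 forces s = t = 1, since a permutation
    preserving rows and columns is trivial. *)
Lemma tr_opY_regular : \tr (opY aG l) = (n`!)%:R.
Proof.
rewrite opYE linear_sum (bigD1 1%g) ?row_stab1 //= [X in _ + X]big1 => [|s /andP[sR s1]].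
  rewrite addr0 linear_sum (bigD1 1%g) ?col_stab1 //= big1 => [|t /andP[tC t1]].
    by rewrite addr0 odd_perm1 expr0 scale1r mulg1 tr_regular eqxx.
  by rewrite linearZ /= mulg1 tr_regular (negPf t1) mulr0.
rewrite linear_sum big1 // => t tC; rewrite linearZ /= tr_regular.
case: eqP => [ts|]; last by rewrite mulr0.
case/eqP: s1; apply: (row_col_stab1 sR).
by rewrite -(col_stabM _ tC) ts col_stab1.
Qed.

Lemma fact_neq0 : (n`!)%:R != 0 :> F.
Proof. by rewrite (proj1 (pcharf0P F) char0) -lt0n fact_gt0. Qed.

(** If c were 0, Y would have trace 0 in the regular representation, where its trace is n!. *)
Lemma opY_quasi_idem : exists2 c : F, c != 0 & forall d (rG : rep d), opY rG l *m opY rG l = c *: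
  opY rG l.
Proof.
have [c cP] := opYgY 1; exists c; last by move=> d rG; rewrite -cP repr_mx1 mulmx1.
apply/eqP=> c0; have := cP _ aG; rewrite repr_mx1 mulmx1 c0 => /mxtrace_quasi_idem.
by rewrite tr_opY_regular mul0r => /eqP; rewrite (negPf fact_neq0).
Qed.

Lemma young_symE : young_symmetrizer F n l = gring_row (opY aG l).
Proof.
rewrite opYE linear_sum; apply: eq_bigr => s _; rewrite linear_sum.
by apply: eq_bigr => t _; rewrite linearZ.
Qed.

Definition young_ideal := cyclic_mx aG (young_symmetrizer F n l).

Lemma young_idealP (v : 'rV[F]_N) :
  reflect (exists2 X, (X \in group_ring F [set: 'S_n])%MS & v = gring_row (opY aG l *m X)) (v <=
    young_ideal)%MS.
Proof.
apply: (iffP cyclic_mxP) => -[X RX ->]; exists X => //; first by rewrite gring_row_mul young_symE.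
by rewrite gring_row_mul young_symE.
Qed.

(** The trace of X g^-1 is n! times the coefficient of g in X. *)
Lemma trace_form_nondeg (X : 'M[F]_N) : (X \in group_ring F [set: 'S_n])%MS ->
  (forall g, \tr (X *m aG g) = 0) -> X = 0.
Proof.
case/envelop_mxP=> a -> tr0; rewrite big1 // => g _.
have := tr0 (g^-1)%g; rewrite mulmx_suml linear_sum (bigD1 g) ?inE //= big1 => [|h /andP[_ hg]].
  rewrite addr0 -scalemxAl linearZ /= -rGM mulgV tr_regular eqxx => /eqP.
  by rewrite mulf_eq0 (negPf fact_neq0) orbF => /eqP ->; rewrite scale0r.
rewrite -scalemxAl linearZ /= -rGM tr_regular; case: eqP => [/eqP|]; last by rewrite mulr0.
by rewrite -eq_mulgV1 (negPf hg).
Qed.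

(* If v were annihilated, the right ideal of v would have square zero, against *)
(* the nondegeneracy of the trace form.                                        *)
Lemma young_ideal_nondeg (v : 'rV[F]_N) : (v <= young_ideal)%MS ->
  (forall g, v *m aG g *m opY aG l = 0) -> v = 0.
Proof.
case/young_idealP=> X RX ->; set V := opY aG l *m X => v0.
have RY : (opY aG l \in group_ring F [set: 'S_n])%MS.
  rewrite opYE linear_sum summx_sub // => s _.
  by rewrite linear_sum summx_sub // => t _; rewrite linearZ scalemx_sub // envelop_mx_id ?inE.
have RV : (V \in group_ring F [set: 'S_n])%MS by rewrite envelop_mxM.
suff -> : V = 0 by rewrite linear0.
apply: trace_form_nondeg => // g.
have Vg0 : V *m aG g *m opY aG l = 0.
  have RVg : (V *m aG g *m opY aG l \in group_ring F [set: 'S_n])%MS.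
    by apply: envelop_mxM => //; apply: envelop_mxM => //; rewrite envelop_mx_id ?inE.
  by rewrite -(gring_rowK RVg) 2!gring_row_mul v0 linear0.
have: (V *m aG g) *m (V *m aG g) = 0 *: (V *m aG g).
  have VgM M : V *m aG g *m (opY aG l *m M) = 0 by rewrite mulmxA Vg0 mul0mx.
  by rewrite scale0r mulmxA (VgM _ X) mul0mx.
by move/mxtrace_quasi_idem; rewrite mul0r.
Qed.

End Quasi.

(** * Linear independence of the irreducible characters *)

Section IrrChar.
Variables (F : fieldType) (n : nat) (char0 : [pchar F] =i pred0).
Implicit Types l m : intpart n.
Local Notation aG := (regular_repr F [set: 'S_n]).
Local Notation N := #|[set: 'S_n]|.
Local Notation ideal := (young_ideal F).

Lemma opY_mul_neq l m (X : 'M[F]_N) : l <> m -> (X \in group_ring F [set: 'S_n])%MS ->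
  opY aG l *m X *m opY aG m = 0.
Proof.
move=> lm /envelop_mxP[a ->]; rewrite mulmx_sumr mulmx_suml big1 // => g _.
by rewrite -scalemxAr -scalemxAl opY_neq // scaler0.
Qed.

Lemma opY_mul_eq l (X : 'M[F]_N) : (X \in group_ring F [set: 'S_n])%MS ->
  exists c, opY aG l *m X *m opY aG l = c *: opY aG l.
Proof.
move=> /envelop_mxP[a ->]; have [c cP] := choice (opYgY char0 l).
exists (\sum_(g in [set: 'S_n]) a g * c g); rewrite mulmx_sumr mulmx_suml scaler_suml.
by apply: eq_bigr => g _; rewrite -scalemxAr -scalemxAl cP scalerA.
Qed.

Lemma ideal_mul_neq l m (v : 'rV[F]_N) : l <> m -> (v <= ideal l)%MS -> v *m opY aG m = 0.
Proof.
by move=> lm /young_idealP[X RX ->]; rewrite -gring_row_mul opY_mul_neq ?linear0.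
Qed.

Lemma ideal_mul_eq l (v : 'rV[F]_N) : (v <= ideal l)%MS ->
  exists c, v *m opY aG l = c *: young_symmetrizer F n l.
Proof.
case/young_idealP=> X /(opY_mul_eq l)[c cP] ->; exists c.
by rewrite -gring_row_mul cP linearZ young_symE.
Qed.

Lemma val_submod_opY l m k (w : 'M_(k, \rank (ideal l))) :
  val_submod (w *m opY (Defs.irr_repr F n l) m) = val_submod w *m opY aG m.
Proof.
rewrite !opYE !mulmx_sumr linear_sum; apply: eq_bigr => s _.
rewrite !mulmx_sumr linear_sum; apply: eq_bigr => t _.
by rewrite -!scalemxAr linearZ /= val_submodJ ?inE.
Qed.

Lemma tr_opY_neq l m : l <> m -> \tr (opY (Defs.irr_repr F n l) m) = 0.
Proof.
move=> lm; suff -> : opY (Defs.irr_repr F n l) m = 0 by rewrite linear0.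
apply: (@val_submod_inj _ _ (ideal l)); apply/row_matrixP=> i.
rewrite linear0 row0 -[opY _ _]mul1mx val_submod_opY row_mul (ideal_mul_neq lm) //.
by rewrite (submx_trans (row_sub _ _)) ?val_submodP.
Qed.

Lemma young_sym_neq0 l : young_symmetrizer F n l != 0.
Proof.
apply/eqP=> y0; have := tr_opY_regular F l.
suff -> : opY aG l = 0 by rewrite linear0 => /esym/eqP; rewrite (negPf (fact_neq0 n char0)).
have RY : (opY aG l \in group_ring F [set: 'S_n])%MS.
  rewrite opYE linear_sum summx_sub // => s _.
  by rewrite linear_sum summx_sub // => t _; rewrite linearZ scalemx_sub // envelop_mx_id ?inE.
by rewrite -(gring_rowK RY) -young_symE y0 linear0.
Qed.

(** Y_l multiplies the generator of its ideal by some c != 0, so it acts on the ideal with nonzero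
    rank; its trace is c times this rank. *)
Lemma tr_opY_eq l : \tr (opY (Defs.irr_repr F n l) l) != 0.
Proof.
have [c c0 cP] := opY_quasi_idem char0 l.
have := mxtrace_quasi_idem (cP _ (Defs.irr_repr F n l)) => ->.
rewrite mulf_neq0 // (proj1 (pcharf0P F) char0) mxrank_eq0; apply/eqP=> Y0.
have yU : (young_symmetrizer F n l <= ideal l)%MS by exact: cyclic_mx_id.
have := val_submod_opY l (in_submod (ideal l) (young_symmetrizer F n l)).
rewrite Y0 mulmx0 linear0 in_submodK // young_symE -gring_row_mul cP linearZ /= -young_symE.
by move=> /esym/eqP; rewrite scaler_eq0 (negPf c0) (negPf (young_sym_neq0 l)).
Qed.

(** Extended linearly to the Young symmetrizer of m, the relation becomes one between the traces of
    Y_m, which vanish unless l = m. *)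
Lemma irr_char_indep (k : intpart n -> F) :
  (forall q : 'S_n, \sum_l k l * irr_char F l q = 0) -> forall l, k l = 0.
Proof.
move=> k0 m; have trE l : \sum_(s in row_stab n m) \sum_(t in col_stab n m)
     (-1) ^+ t * irr_char F l (t * s)%g = \tr (opY (Defs.irr_repr F n l) m).
  rewrite opYE linear_sum; apply: eq_bigr => s _; rewrite linear_sum.
  by apply: eq_bigr => t _; rewrite linearZ.
have : \sum_l k l * \tr (opY (Defs.irr_repr F n l) m) = 0.
  under eq_bigr do rewrite -trE mulr_sumr.
  rewrite exchange_big big1 //= => s _; under eq_bigr do rewrite mulr_sumr.
  rewrite exchange_big big1 //= => t _; under eq_bigr do rewrite mulrCA.
  by rewrite -mulr_sumr k0 mulr0.
rewrite (bigD1 m) //= big1 => [|l /eqP lm]; last by rewrite tr_opY_neq ?mulr0.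
by rewrite addr0 => /eqP; rewrite mulf_eq0 (negPf (tr_opY_eq m)) orbF => /eqP.
Qed.

End IrrChar.

Local Close Scope ring_scope.

(** * Standard tableaux and the dimension of the irreducible modules *)

(* A word lists the rows of the entries of a standard tableau, and [wcol] the  *)
(* columns.                                                                    *)
Definition lattice_word (w : seq nat) :=
  forall x r, count_mem r.+1 (take x w) <= count_mem r (take x w).

Definition wcol (w : seq nat) x := count_mem (nth 0 w x) (take x w).

Lemma wcol_lt w x : x < size w -> wcol w x < count_mem (nth 0 w x) w.
Proof.
move=> xw; rewrite -[X in _ < count _ X](cat_take_drop x) count_cat (drop_nth 0 xw) /=.
by rewrite eqxx -[X in X < _]addn0 ltn_add2l.
Qed.

Lemma wcol_inj w x y : x < size w -> y < size w -> nth 0 w x = nth 0 w y ->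
  x < y -> wcol w x < wcol w y.
Proof.
move=> xw yw xy lt_xy; have xt : x < size (take y w) by rewrite size_take yw.
have := wcol_lt xt; rewrite /wcol nth_take // take_takel ?(ltnW lt_xy) //.
by rewrite -xy.
Qed.

Lemma lattice_mono w x r r' : lattice_word w -> r <= r' ->
  count_mem r' (take x w) <= count_mem r (take x w).
Proof.
move=> lw; elim: r' => [|r' IH]; first by rewrite leqn0 => /eqP ->.
rewrite leq_eqVlt => /orP[/eqP -> //|/IH]; exact: leq_trans (lw _ _).
Qed.

(** By induction the words agree up to the last letter. Two different last letters in the same
    column would have occurred equally often before, and appending the larger one breaks the lattice
    condition. *)
Lemma lattice_wcol_inj w w' : lattice_word w -> lattice_word w' ->
  size w = size w' -> {in gtn (size w), wcol w =1 wcol w'} -> w = w'.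
Proof.
elim/last_ind: w w' => [|p r IHp] w'; first by move=> _ _ /esym/size0nil ->.
case/lastP: w' => [|p' r']; first by rewrite size_rcons.
move=> lw lw'; rewrite !size_rcons => -[sz] eqc.
have lat_rcons q a : lattice_word (rcons q a) -> lattice_word q.
  move=> lq x b; case: (leqP x (size q)) => [xq|qx].
    by have := lq x b; rewrite -cats1 takel_cat.
  rewrite take_oversize ?(ltnW qx) //; have := lq (size q) b.
  by rewrite -cats1 takel_cat // take_size.
have pp' : p = p'.
  apply: IHp => // [||x]; [exact: lat_rcons lw|exact: lat_rcons lw'|].
  rewrite unfold_in /= => xp; have := eqc x; rewrite unfold_in /= ltnS ltnW // => /(_ isT).
  by rewrite /wcol -!cats1 !nth_cat -sz xp !takel_cat // -?sz ltnW.
rewrite -pp' in lw' eqc *; congr rcons.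
have := eqc (size p); rewrite unfold_in /= ltnSn => /(_ isT).
rewrite /wcol !nth_rcons ltnn eqxx -!cats1 !takel_cat // !take_size => cc.
have key q a b : lattice_word (rcons q b) -> a < b -> count_mem a q = count_mem b q -> False.
  move=> lq ab cab; have ab' : a <= b.-1 by rewrite -ltnS prednK ?(leq_ltn_trans _ ab).
  have := lattice_mono (size q).+1 lq ab'; have := lq (size q).+1 b.-1.
  rewrite prednK ?(leq_ltn_trans _ ab) // take_oversize ?size_rcons // -cats1 !count_cat /= eqxx.
  rewrite gtn_eqF ?ltn_predL ?(leq_ltn_trans _ ab) // gtn_eqF // cab; set X := count _ q.
  set Y := count _ q; rewrite !addn0 addn1 => le1 le2; have := leq_trans le1 le2.
  by rewrite ltnn.
case: (ltngtP r r') => // rr'; exfalso; [exact: key lw' rr' cc|exact: key lw rr' (esym cc)].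
Qed.

(** The last position carries the most significant digit, so tableaux are compared at the largest
    entry whose column differs. *)
Definition code B n (a : nat -> nat) := \sum_(x < n) a x * B ^ x.

Lemma code_bound B n a : (forall x, x < n -> a x < B) -> code B n a < B ^ n.
Proof.
rewrite /code; elim: n => [|n IHn] aB; first by rewrite big_ord0.
rewrite big_ord_recr /= expnS; have {IHn} := IHn (fun x xn => aB x (ltnW xn)).
by have := aB n (ltnSn n); set S := \sum_(_ < _) _; set P := B ^ n; nia.
Qed.

Lemma code_lt B n a b x0 : (forall x, x < n -> a x < B) ->
  x0 < n -> a x0 < b x0 -> (forall x, x0 < x -> x < n -> a x = b x) ->
  code B n a < code B n b.
Proof.
move=> aB; elim: n aB => // n IHn aB; rewrite ltnS leq_eqVlt => /orP[/eqP-> ab _|xn ab eqab].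
  rewrite /code !big_ord_recr /=; have := code_bound (fun x xn => aB x (ltnW xn)).
  by rewrite /code; set S := \sum_(_ < _) _; set S' := \sum_(_ < _) _; set P := B ^ n; nia.
rewrite /code !big_ord_recr /= eqab // ltn_add2r; apply: IHn => // [x xn'|x x0x xn'].
  exact: aB (ltnW xn').
exact: eqab x0x (ltnW xn').
Qed.

Definition word_of_shape n (l : intpart n) (w : seq nat) :=
  size w = n /\ lattice_word w /\ forall r, count_mem r w = nth 0 l r.

Section Words.
Variables (n : nat) (l : intpart n).

Lemma word_tableau w : word_of_shape l w -> exists p : 'S_n,
  forall x : 'I_n, rowd l (p x) = nth 0 w x /\ cold l (p x) = wcol w x.
Proof.
move=> [sz [_ ct]]; have c_lt (x : 'I_n) : wcol w x < nth 0 l (nth 0 w x).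
  by rewrite -ct wcol_lt ?sz.
have p_inj : injective (fun x : 'I_n => box (c_lt x)).
  move=> x y xy; have := congr1 (rowd l) xy; have := congr1 (cold l) xy.
  rewrite !col_box !row_box => cxy rxy; apply: val_inj => /=.
  case: (ltngtP x y) => // lt_xy; have := @wcol_inj w _ _ _ _ _ lt_xy; rewrite !sz !ltn_ord.
    by move=> /(_ isT isT rxy); rewrite cxy ltnn.
  by move=> /(_ isT isT (esym rxy)); rewrite cxy ltnn.
by exists (perm p_inj) => x; rewrite permE row_box col_box.
Qed.

(* A row permutation moves the largest displaced entry of a standard tableau   *)
(* to the left, so the vectors y p^-1 are triangular for the order [code].     *)
Lemma tableau_code w w' (p p' t s : 'S_n) :
  word_of_shape l w -> word_of_shape l w' ->
  (forall x : 'I_n, rowd l (p x) = nth 0 w x /\ cold l (p x) = wcol w x) ->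
  (forall x : 'I_n, rowd l (p' x) = nth 0 w' x /\ cold l (p' x) = wcol w' x) ->
  t \in col_stab n l -> s \in row_stab n l -> (t * s * p^-1 = p'^-1)%g ->
  w = w' \/ code n.+1 n (wcol w') < code n.+1 n (wcol w).
Proof.
move=> sw sw' pP p'P tC sR eqp.
have {}eqp : p' = (p * s^-1 * t^-1)%g by rewrite -[p']invgK -eqp !invMg invgK mulgA.
have cE (x : 'I_n) : wcol w' x = cold l ((s^-1)%g (p x)).
  rewrite -(p'P x).2 eqp !permM; have := tC; rewrite -col_stabV => /col_stabP -> //.
have rE i : rowd l ((s^-1)%g i) = rowd l i.
  by have := sR; rewrite -row_stabV => /row_stabP ->.
case: (pselect (exists x : 'I_n, wcol w' x != wcol w x)) => [[x1 x1P]|same]; last first.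
  left; case: sw sw' => [sz [lw _]] [sz' [lw' _]]; apply: lattice_wcol_inj => //.
    by rewrite sz sz'.
  move=> x; rewrite unfold_in /= sz => xn; apply/esym/eqP; apply: contrapT => /negP ne.
  by apply: same; exists (Ordinal xn).
right; case: (arg_maxnP (P := fun x : 'I_n => wcol w' x != wcol w x) (fun x => x : nat) x1P) =>
  x0 x0P max.
apply: (@code_lt _ _ _ _ x0); rewrite ?ltn_ord //.
- by move=> x xn; rewrite ltnS; apply: leq_trans (count_size _ _) _; rewrite size_take_min;
    have [-> _] := sw'; exact: geq_minr.
- have eq_gt (x : 'I_n) : x0 < x -> wcol w' x = wcol w x.
    by move=> x0x; apply/eqP; apply: contraTT x0x => /max; rewrite -leqNgt.
  pose x2 := (p^-1)%g ((s^-1)%g (p x0)).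
  have px2 : p x2 = (s^-1)%g (p x0) by rewrite permKV.
  have rx2 : nth 0 w x2 = nth 0 w x0 by rewrite -(pP x2).1 -(pP x0).1 px2 rE.
  have cx2 : wcol w' x0 = wcol w x2 by rewrite cE -(pP x2).2 px2.
  rewrite cx2; have [sz _] := sw.
  case: (ltngtP x2 x0) => [lt|gt|/val_inj eq]; first by apply: wcol_inj; rewrite ?sz ?ltn_ord.
    have := eq_gt _ gt; rewrite cE -(pP x2).2 => cc.
    have := diag_inj (rE _) cc; rewrite {2}px2 => /perm_inj/perm_inj e.
    by move: gt; rewrite e ltnn.
  by move: x0P; rewrite cx2 eq eqxx.
- move=> x x0x xn; apply/eqP; apply: contraTT x0x => ne.
  by rewrite -leqNgt; exact: (max (Ordinal xn)).
Qed.

Variables (F : fieldType).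
Local Notation aG := (regular_repr F [set: 'S_n]).
Local Notation N := #|[set: 'S_n]|.
Local Open Scope ring_scope.

Lemma gring_rowE (g h : 'S_n) :
  gring_row (aG g) 0 (gring_index [set: 'S_n] h) = (g == h)%:R.
Proof.
rewrite /gring_row rowK gring_indexK ?inE // mul1g mxE eqxx /=.
by rewrite (can_in_eq (@gring_indexK _ _)) ?inE // eq_sym.
Qed.

Lemma young_symJE (p p' : 'S_n) :
  (young_symmetrizer F n l *m aG (p^-1)%g) 0 (gring_index [set: 'S_n] (p'^-1)%g) =
  \sum_(s in row_stab n l) \sum_(t in col_stab n l)
    (-1) ^+ t * (t * s * p^-1 == p'^-1)%g%:R.
Proof.
rewrite /young_symmetrizer mulmx_suml summxE; apply: eq_bigr => s _.
rewrite mulmx_suml summxE; apply: eq_bigr => t _.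
by rewrite -scalemxAl mxE -gring_row_mul -rGM gring_rowE.
Qed.

(** The translates of the Young symmetrizer by the inverses of the standard tableaux are linearly
    independent, being triangular by [tableau_code]. *)
Lemma rank_ideal_ge (ws : seq (seq nat)) : uniq ws ->
  {in ws, forall w, word_of_shape l w} -> (size ws <= \rank (young_ideal F l))%N.
Proof.
move=> uw wsP; pose k := size ws; pose w (i : 'I_k) := nth [::] ws i.
have wP i : word_of_shape l (w i) by apply: wsP; exact: mem_nth.
have [p pP] := choice (fun i => word_tableau (wP i)).
pose M := \matrix_(i < k) (young_symmetrizer F n l *m aG ((p i)^-1)%g).
have MU : (M <= young_ideal F l)%MS.
  apply/row_subP=> i; rewrite rowK; apply: mxmodule_trans; rewrite ?inE //.
    exact: cyclic_mx_module.
  exact: cyclic_mx_id.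
apply: leq_trans (mxrankS MU); suff /eqP -> : row_free M by [].
rewrite -kermx_eq0; apply/rowV0P => u /sub_kermxP uM; case: (eqVneq u 0) => // u0.
have /existsP[i0 u_i0] : [exists i, u 0 i != 0].
  rewrite -negb_forall; apply/negP=> /forallP u_0; case/eqP: u0.
  by apply/rowP=> i; rewrite mxE; apply/eqP.
(* Among the rows in the relation take the one of largest code: at the coordinate of (p i)^-1 it has
   entry 1 and every other row of the relation has entry 0. *)
case: (arg_maxnP (P := fun i => u 0 i != 0) (fun i => code n.+1 n (wcol (w i))) u_i0) => i ui max.
have /rowP/(_ (gring_index [set: 'S_n] ((p i)^-1)%g)) := uM.
rewrite mulmx_sum_row summxE [RHS]mxE (bigD1 i) //= big1 => [|j ji].
  rewrite addr0 rowK mxE young_symJE (bigD1 1%g) ?row_stab1 //= [X in _ + X]big1 => [|s /andP[sR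
    s1]].
    rewrite addr0 (bigD1 1%g) ?col_stab1 //= big1 => [|t /andP[tC t1]].
      by rewrite addr0 mulg1 mul1g eqxx odd_perm1 !mulr1; move/eqP: ui.
    case: eqP; rewrite ?mulr0 // mulg1 => /eqP; rewrite -{2}[(_^-1)%g]mul1g.
    by rewrite (inj_eq (mulIg _)) (negPf t1).
  rewrite big1 // => t tC; case: eqP; rewrite ?mulr0 // => /eqP.
  rewrite -{2}[((p i)^-1)%g]mul1g (inj_eq (mulIg _)) => /eqP ts1; case/eqP: s1.
  by apply: (row_col_stab1 sR); rewrite -(col_stabM _ tC) ts1 col_stab1.
rewrite rowK mxE young_symJE; case: (eqVneq (u 0 j) 0) => [->|uj]; first by rewrite mul0r.
rewrite big1 ?mulr0 // => s sR; rewrite big1 // => t tC; case: eqP; rewrite ?mulr0 // => eqp.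
case: (tableau_code (wP j) (wP i) (pP j) (pP i) tC sR eqp) => [wij|lt].
  by case/eqP: ji; apply/val_inj/eqP; rewrite -(nth_uniq [::] _ _ uw) ?ltn_ord //; apply/eqP.
by have := max j uj; rewrite /= leqNgt lt.
Qed.

End Words.

(** * Counting tableaux *)

(* [up4] sums a function on diagrams over all ways to add a box and [down3]    *)
(* over all ways to remove one; the commutation relation [up4_down3] is the    *)
(* one of Young's lattice, hence the factor n in [iter_up4_down3].             *)
Definition up3 (f : nat -> nat -> nat -> nat) a b c :=
  f a.+1 b c + (b < a) * f a b.+1 c + (c < b) * f a b c.+1.
Lemma up3E f a b c :
  up3 f a b c = f a.+1 b c + (b < a) * f a b.+1 c + (c < b) * f a b c.+1.
Proof. by []. Qed.

Definition up4 (f : nat -> nat -> nat -> nat -> nat) a b c d :=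
  f a.+1 b c d + (b < a) * f a b.+1 c d + (c < b) * f a b c.+1 d + (d < c) * f a b c d.+1.
Definition down3 (f : nat -> nat -> nat -> nat) a b c d :=
  if d == 0 then (b < a) * f a.-1 b c + (c < b) * f a b.-1 c + (0 < c) * f a b c.-1
  else (d == 1) * f a b c.
Definition ext3 (f : nat -> nat -> nat -> nat) a b c d := (d == 0) * f a b c.

(** The two orders differ only in adding a box and removing it again. For d = 0 there is one more
    place to add a box, the fourth row included, than boxes to remove, whence the term [ext3]. *)
Lemma up4_down3 f a b c d : d <= c <= b -> b <= a ->
  up4 (down3 f) a b c d = down3 (up3 f) a b c d + ext3 f a b c d.
Proof.
move=> /andP[dc cb] ba; rewrite /up4 /down3 /ext3 /up3.
case: d dc => [|[|d]] dc /=; last by lia.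
  rewrite ltnS ba !ltnS cb /=.
  have [xa|xa] : b < a \/ b = a by lia.
    have ea : a.-1.+1 = a by lia.
    have [xb|xb] : c < b \/ c = b by lia.
      have eb : b.-1.+1 = b by lia.
      have [xc|xc] : 0 < c \/ c = 0 by lia.
        have ec : c.-1.+1 = c by lia.
        have -> : c.-1 < b by lia.
        have -> : b.-1 < a by lia.
        have -> : (b < a.-1) = (b.+1 < a) by lia.
        have -> : (c < b.-1) = (c.+1 < b) by lia.
        rewrite ea eb ec xa xb xc; lia.
      rewrite xc /=.
      have -> : b.-1 < a by lia.
      have -> : (b < a.-1) = (b.+1 < a) by lia.
      have -> : (0 < b.-1) = (1 < b) by lia.
      rewrite ea eb xa -xc xb; lia.
    have [xc|xc] : 0 < c \/ c = 0 by lia.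
      have ec : c.-1.+1 = c by lia.
      have -> : c.-1 < b by lia.
      have -> : (b < a.-1) = (b.+1 < a) by lia.
      rewrite ea ec xa xc -xb ltnn; lia.
    rewrite ea xa -xb xc ltnn /=; have -> : (0 < a.-1) = (1 < a) by lia.
    lia.
  have [xb|xb] : c < b \/ c = b by lia.
    have eb : b.-1.+1 = b by lia.
    have [xc|xc] : 0 < c \/ c = 0 by lia.
      have ec : c.-1.+1 = c by lia.
      have -> : c.-1 < b by lia.
      have -> : b.-1 < a by lia.
      have -> : (c < b.-1) = (c.+1 < b) by lia.
      rewrite eb ec xb xc -xa ltnn; lia.
    rewrite xc /=.
    have -> : b.-1 < a by lia.
    have -> : (0 < b.-1) = (1 < b) by lia.
    rewrite eb -xa ltnn; lia.
  have [xc|xc] : 0 < c \/ c = 0 by lia.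
    have ec : c.-1.+1 = c by lia.
    have -> : c.-1 < b by lia.
    rewrite ec -xa -xb ltnn xc; lia.
  rewrite -xa -xb xc /=; lia.
lia.
Qed.

Lemma up4_ext3 f a b c d : up4 (ext3 f) a b c d = ext3 (up3 f) a b c d.
Proof. by rewrite /up4 /ext3 /up3; case: d => [|d] /=; lia. Qed.

Lemma eq_up4 f g : (forall a b c d, d <= c <= b -> b <= a -> f a b c d = g a b c d) ->
  forall a b c d, d <= c <= b -> b <= a -> up4 f a b c d = up4 g a b c d.
Proof.
move=> fg a b c d /andP[dc cb] ba; rewrite /up4; congr (_ + _ + _ + _).
- by apply: fg; lia.
- by case: ltnP => // ba'; rewrite fg //; lia.
- by case: ltnP => // cb'; rewrite fg //; lia.
- by case: ltnP => // dc'; rewrite fg //; lia.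
Qed.


Lemma up4D f g a b c d :
  up4 (fun a b c d => f a b c d + g a b c d) a b c d = up4 f a b c d + up4 g a b c d.
Proof. by rewrite /up4; lia. Qed.
Lemma up4M k f a b c d :
  up4 (fun a b c d => k * f a b c d) a b c d = k * up4 f a b c d.
Proof. by rewrite /up4; lia. Qed.

Lemma iter_up4_down3 n f a b c d : d <= c <= b -> b <= a ->
  iter n up4 (down3 f) a b c d =
  down3 (iter n up3 f) a b c d + n * ext3 (iter n.-1 up3 f) a b c d.
Proof.
elim: n a b c d => [|n IHn] a b c d h h'; first by rewrite mul0n addn0.
rewrite iterS (eq_up4 IHn) // up4D up4M up4_down3 // up4_ext3 mulSn addnA.
by case: n {IHn}.
Qed.

(* The multiplicity of the irreducible SL_2-module of dimension j + 1 in the   *)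
(* restriction of the GL_3-module of highest weight (a, b, c); the recursion   *)
(* [up3_interlace] reflects tensoring with the sum of the natural and the      *)
(* trivial module, whose powers are counted by Motzkin paths.                  *)
Definition interlace j a b c :=
  let p := a - b in let q := b - c in
  if j <= p then minn j q + 1 else if j <= q then p + 1 else p + q + 1 - j.

Lemma up3_interlace j a b c : c <= b <= a ->
  up3 (interlace j) a b c =
  (if j is j'.+1 then interlace j' a b c else 0) + interlace j a b c + interlace j.+1 a b c.
Proof.
move=> /andP[cb ba]; have [p ->] : exists p, a = b + p by exists (a - b); lia.
have [q ->] : exists q, b = c + q by exists (b - c); lia.
rewrite /up3 /interlace /minn.
have e1 : (c + q + p).+1 - (c + q) = p.+1 by lia.
have e2 : c + q - c = q by lia.
have e3 : c + q + p - (c + q) = p by lia.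
have e4 : c + q + p - (c + q).+1 = p.-1 by lia.
have e5 : (c + q).+1 - c = q.+1 by lia.
have e6 : c + q - c.+1 = q.-1 by lia.
have e7 : (c + q < c + q + p) = (0 < p) by lia.
have e8 : (c < c + q) = (0 < q) by lia.
rewrite e1 e2 e3 e4 e5 e6 e7 e8; move=> {e1 e2 e3 e4 e5 e6 e7 e8 cb ba a b}.
case: j => [|j]; case: p => [|p]; case: q => [|q] //=; rewrite ?(mul0n, mul1n, add0n, addn0);
  repeat (case: ltnP => ? //; try by lia); by lia.
Qed.

Fixpoint motzkin n j :=
  if n is n'.+1 then
    (if j is j'.+1 then motzkin n' j' else 0) + motzkin n' j + motzkin n' j.+1
  else (j == 0 : nat).

Lemma eq_up3 f g : (forall a b c, c <= b <= a -> f a b c = g a b c) ->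
  forall a b c, c <= b <= a -> up3 f a b c = up3 g a b c.
Proof.
move=> fg a b c /andP[cb ba]; rewrite /up3; congr (_ + _ + _).
- by apply: fg; lia.
- by case: ltnP => // ba'; rewrite fg //; lia.
- by case: ltnP => // cb'; rewrite fg //; lia.
Qed.

Lemma eq_iter_up3 n f g : (forall a b c, c <= b <= a -> f a b c = g a b c) ->
  forall a b c, c <= b <= a -> iter n up3 f a b c = iter n up3 g a b c.
Proof. by move=> fg; elim: n => // n IHn a b c h; rewrite !iterS (eq_up3 IHn). Qed.

Lemma iter_up3D n f g a b c :
  iter n up3 (fun a b c => f a b c + g a b c) a b c = iter n up3 f a b c + iter n up3 g a b c.
Proof.
elim: n a b c => // n IHn a b c; rewrite !iterS !up3E !IHn !mulnDr; lia.
Qed.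

Lemma iter_up3_0 n a b c : iter n up3 (fun _ _ _ => 0) a b c = 0.
Proof. by elim: n a b c => // n IHn a b c; rewrite iterS up3E !IHn !muln0. Qed.

Lemma iter_up3_interlace n j : iter n up3 (interlace j) 0 0 0 = motzkin n j.
Proof.
elim: n j => [|n IHn] j; first by case: j.
rewrite iterSr (eq_iter_up3 _ (@up3_interlace j)) // !iter_up3D /= !IHn.
by case: j => [|j]; rewrite ?iter_up3_0 ?IHn.
Qed.

(** At the empty diagram the [down3] term vanishes, and the constant 1 is [interlace 0]. *)
Lemma iter_up4_motzkin n :
  iter n up4 (down3 (fun _ _ _ => 1)) 0 0 0 0 = n * motzkin n.-1 0.
Proof.
rewrite iter_up4_down3 //= /ext3 mul1n -iter_up3_interlace; congr (_ * _).
by apply: eq_iter_up3 => // a b c; rewrite /interlace leq0n min0n.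
Qed.

(** Lattice words in four letters continuing the shape (a, b, c, d); from the empty shape they
    encode the standard tableaux with at most four rows. *)
Fixpoint walks n a b c d : seq (seq nat) :=
  if n is n'.+1 then
    [seq 0 :: w | w <- walks n' a.+1 b c d] ++
    (if b < a then [seq 1 :: w | w <- walks n' a b.+1 c d] else [::]) ++
    (if c < b then [seq 2 :: w | w <- walks n' a b c.+1 d] else [::]) ++
    (if d < c then [seq 3 :: w | w <- walks n' a b c d.+1] else [::])
  else [:: [::]].

Lemma sum_walks f n a b c d :
  \sum_(w <- walks n a b c d) f (a + count_mem 0 w) (b + count_mem 1 w)
     (c + count_mem 2 w) (d + count_mem 3 w) = iter n up4 f a b c d.
Proof.
elim: n a b c d => [|n IHn] a b c d; first by rewrite /= big_seq1 /= !addn0.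
have ifs (B : bool) (s : seq (seq nat)) (G : seq nat -> nat) :
    \sum_(w <- if B then s else [::]) G w = B * \sum_(w <- s) G w.
  by case: B; rewrite ?mul1n ?big_nil ?mul0n.
rewrite [iter _ _ _]/= /= !big_cat /= !ifs !big_map /up4 -!addnA -!IHn.
by congr (_ + (_ * _ + (_ * _ + _ * _))); apply: eq_bigr => w _ /=;
  rewrite ?add0n ?addSnnS.
Qed.

Lemma uniq_walks n a b c d : uniq (walks n a b c d).
Proof.
elim: n a b c d => //= n IHn a b c d.
have cons_inj (x : nat) : injective (cons x) by move=> u v [].
have ifu (B : bool) x (s : seq (seq nat)) : uniq s -> uniq (if B then [seq x :: w | w <- s] else
  [::]).
  by case: B => //; rewrite map_inj_uniq.
have dis x (s s' : seq (seq nat)) : (forall w, w \in s' -> head 0 w != x) ->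
    ~~ has (mem [seq x :: w | w <- s]) s'.
  move=> h; apply/hasPn => w /h; apply: contra => /mapP[u _ ->] /=; exact: eqxx.
have ifm (B : bool) x (s : seq (seq nat)) w :
  w \in (if B then [seq x :: w | w <- s] else [::]) -> head 0 w = x.
  by case: B => // /mapP[u _ ->].
have idis (B : bool) x (s s' : seq (seq nat)) : (forall w, w \in s' -> head 0 w != x) ->
    ~~ has (mem (if B then [seq x :: w | w <- s] else [::])) s'.
  move=> h; apply/hasPn => w /h; apply: contra => /ifm /= ->; exact: eqxx.
rewrite !cat_uniq map_inj_uniq // !ifu // !IHn /= !andbT; apply/and3P; split.
- by apply: dis => w; rewrite !mem_cat => /or3P[] /ifm ->.
- by apply: idis => w; rewrite !mem_cat => /orP[] /ifm ->.
- by apply: idis => w /ifm ->.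
Qed.

Lemma walksP n a b c d w : w \in walks n a b c d -> d <= c <= b -> b <= a ->
  [/\ size w = n, all (gtn 4) w & forall x,
     [/\ d + count_mem 3 (take x w) <= c + count_mem 2 (take x w),
         c + count_mem 2 (take x w) <= b + count_mem 1 (take x w) &
         b + count_mem 1 (take x w) <= a + count_mem 0 (take x w)]].
Proof.
elim: n a b c d w => [|n IHn] a b c d w /=.
  by rewrite inE => /eqP -> /andP[? ?] ?; split=> // x; rewrite /= !addn0.
rewrite !mem_cat => wP /andP[dc cb] ba.
case/or4P: wP => [/mapP[u uw ->]|||].
- have [sz al cP] := IHn _ _ _ _ _ uw ltac:(lia) ltac:(lia).
  split=> /=; rewrite ?sz ?al // => -[|x] /=; first by rewrite !addn0; split; lia.
  by have := cP x; rewrite !add0n !addSnnS.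
- case: ifP => // lt /mapP[u uw ->]; have [sz al cP] := IHn _ _ _ _ _ uw ltac:(lia) ltac:(lia).
  split=> /=; rewrite ?sz ?al // => -[|x] /=; first by rewrite !addn0; split; lia.
  by have := cP x; rewrite !add0n !addSnnS.
- case: ifP => // lt /mapP[u uw ->]; have [sz al cP] := IHn _ _ _ _ _ uw ltac:(lia) ltac:(lia).
  split=> /=; rewrite ?sz ?al // => -[|x] /=; first by rewrite !addn0; split; lia.
  by have := cP x; rewrite !add0n !addSnnS.
- case: ifP => // lt /mapP[u uw ->]; have [sz al cP] := IHn _ _ _ _ _ uw ltac:(lia) ltac:(lia).
  split=> /=; rewrite ?sz ?al // => -[|x] /=; first by rewrite !addn0; split; lia.
  by have := cP x; rewrite !add0n !addSnnS.
Qed.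

Lemma count4 w : all (gtn 4) w ->
  count_mem 0 w + count_mem 1 w + count_mem 2 w + count_mem 3 w = size w.
Proof.
elim: w => //= x w IHw /andP[x4 /IHw <-].
by case: x x4 => [|[|[|[|x]]]] //= _; lia.
Qed.

Lemma count_ge4 r w : all (gtn 4) w -> 4 <= r -> count_mem r w = 0.
Proof.
move=> w4 r4; apply/eqP; rewrite eqn0Ngt -has_count; apply/hasPn => x /(allP w4) /=.
by move=> x4; apply: contraTneq x4 => ->; rewrite -leqNgt.
Qed.

Lemma nth_filter_nonincr (a b c d : nat) r : d <= c -> c <= b -> b <= a ->
  nth 0 [seq x <- [:: a; b; c; d] | x != 0] r = nth 0 [:: a; b; c; d] r.
Proof.
case: a b c d => [|a] [|b] [|c] [|d] //= _ _ _; by case: r => [|[|[|[|[|r]]]]].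
Qed.

Lemma sumn_filter4 (a b c d : nat) :
  sumn [seq x <- [:: a; b; c; d] | x != 0] = a + b + c + d.
Proof. by case: a b c d => [|a] [|b] [|c] [|d] /=; lia. Qed.

Lemma walk_shape n w : w \in walks n 0 0 0 0 -> exists l : intpart n, word_of_shape l w.
Proof.
case/walksP=> // sz w4 latw.
have lw : lattice_word w.
  move=> x r; have w4' : all (gtn 4) (take x w).
    by apply/allP => y /mem_take /(allP w4).
  have := latw x; rewrite !add0n => -[l3 l2 l1].
  by case: r => [|[|[|r]]] //; rewrite (@count_ge4 r.+4).
have := count4 w4; have := latw n; rewrite take_oversize ?sz // !add0n.
set c0 := count_mem 0 w; set c1 := count_mem 1 w; set c2 := count_mem 2 w; set c3 := count_mem 3 w.
move=> -[l3 l2 l1] sumc; pose s := [seq x <- [:: c0; c1; c2; c3] | x != 0].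
have sP : is_partition n s.
  apply/and3P; split.
  - apply: sorted_filter => /=; first by move=> y x z /= yx zy; exact: leq_trans zy yx.
    by rewrite l1 l2 l3.
  - by rewrite mem_filter.
  - by rewrite sumn_filter4 sumc.
exists (IntPart sP); split=> //; split=> // r /=.
rewrite nth_filter_nonincr //.
by case: r => [|[|[|[|r]]]] //=; rewrite nth_nil (count_ge4 w4).
Qed.

(* The last box of row [h] can be removed from the diagram of [l], leaving a    *)
(* diagram with at most three rows; the corners of [l] index the copies of the *)
(* irreducible module of [l] in P_n.                                           *)
Definition corner (l : seq nat) (h : nat) :=
  [&& nth 0 l h.+1 < nth 0 l h, nth 0 l 3 == (h == 3) & nth 0 l 4 == 0].

Lemma sum_corner (l : seq nat) : nth 0 l 4 = 0 ->
  \sum_(h < 4) corner l h =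
  down3 (fun _ _ _ => 1) (nth 0 l 0) (nth 0 l 1) (nth 0 l 2) (nth 0 l 3).
Proof.
move=> l4; rewrite !big_ord_recr big_ord0 /= /corner /down3 l4.
case: (nth 0 l 3) => [|[|k]] /=; last by rewrite !andbF.
  by rewrite !andbT !muln1; lia.
by rewrite !andbF.
Qed.

(** The left side counts pairs of a standard tableau and a corner of its shape; for a fixed shape
    and corner there are at most [\rank] many by [rank_ideal_ge]. *)
Lemma dim_lower (F : fieldType) n :
  n * motzkin n.-1 0 <=
  \sum_(p : intpart n * 'I_4 | corner p.1 p.2) \rank (young_ideal F p.1).
Proof.
rewrite -iter_up4_motzkin -sum_walks.
have le1 (p : intpart n * 'I_4) :
    \sum_(w <- walks n 0 0 0 0) (`[< word_of_shape p.1 w >] : nat) <= \rank (young_ideal F p.1).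
  rewrite -big_mkcond /= sum1_count -size_filter.
  by apply: rank_ideal_ge; rewrite ?filter_uniq ?uniq_walks // => w;
    rewrite mem_filter => /andP[/asboolP].
apply: leq_trans (leq_sum _ (fun p _ => le1 p)); rewrite exchange_big /= big_seq [leqRHS]big_seq.
apply: leq_sum => w ww; have [l lw] := walk_shape ww; have [_ w4 _] := walksP ww isT isT.
rewrite (eq_bigl (fun p : intpart n * 'I_4 => predT p.1 && corner p.1 p.2)) //.
rewrite -(pair_big_dep predT (fun (l : intpart n) (h : 'I_4) => corner l h) (fun l h => `[<
  word_of_shape l w >] : nat)) /=.
rewrite (bigD1 l) //=; apply: leq_trans (leq_addr _ _).
have [_ [_ ct]] := lw; rewrite !add0n !ct -sum_corner; last first.
  by rewrite -ct (count_ge4 w4).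
rewrite [leqRHS]big_mkcond /=; apply: leq_sum => h _; case: corner => //.
by rewrite (asboolT lw).
Qed.

(** * Motzkin words *)

(* Words are read from right to left: the head of a word is its last letter.   *)
(* The letters 0, 1, 2, 3 stand for b, a, c in H and for 1 in T.               *)
Fixpoint ballot (w : seq nat) :=
  if w is x :: w' then ballot w' && (count_mem 1 w <= count_mem 0 w) else true.

(** Here k is the number of letters 3 and j the excess of letters 0 over letters 1. *)
Fixpoint motzkin_words k n j : seq (seq nat) :=
  if n is n'.+1 then
    (if j is j'.+1 then [seq 0 :: w | w <- motzkin_words k n' j'] else [::]) ++
    [seq 1 :: w | w <- motzkin_words k n' j.+1] ++
    [seq 2 :: w | w <- motzkin_words k n' j] ++
    (if k is k'.+1 then [seq 3 :: w | w <- motzkin_words k' n' j] else [::])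
  else if (j == 0) && (k == 0) then [:: [::]] else [::].

Lemma count_mem_cons (a x : nat) w : count_mem a (x :: w) = (x == a) + count_mem a w.
Proof. by []. Qed.

Lemma ballot_count w : ballot w -> count_mem 1 w <= count_mem 0 w.
Proof. by case: w => //= x w /andP[]. Qed.

Lemma mem_motzkin_words k n j w : size w = n -> all (gtn 4) w ->
  count_mem 3 w = k -> count_mem 0 w = count_mem 1 w + j -> ballot w ->
  w \in motzkin_words k n j.
Proof.
elim: w n k j => [|x w IHw] [|n] k j //; first by rewrite /= => _ _ <- /esym; rewrite add0n => ->.
move=> [sz] /andP[x4 w4]; rewrite /ballot -/ballot !count_mem_cons => ck cj /andP[bw cb].
have mm (s : seq (seq nat)) : w \in s -> x :: w \in [seq x :: u | u <- s] by move=> ?; apply/map_f.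
have bc := ballot_count bw.
rewrite [motzkin_words _ _ _]/= !mem_cat; case: x x4 ck cj cb mm => [|[|[|[|x]]]] // _.
- rewrite !(add0n, add1n) => ck cj cb mm; case: j cj => [|j] cj; first by lia.
  by rewrite (mm _ (IHw n k j sz w4 _ _ bw)) //; lia.
- rewrite !(add0n, add1n) => ck cj cb mm; rewrite (mm _ (IHw n k j.+1 sz w4 _ _ bw)) ?orbT //; lia.
- rewrite !(add0n, add1n) => ck cj cb mm; rewrite (mm _ (IHw n k j sz w4 _ _ bw)) ?orbT //; lia.
- rewrite !(add0n, add1n) => ck cj cb mm; case: k ck => [|k] ck; first by lia.
  rewrite (mm _ (IHw n k j sz w4 _ _ bw)) ?orbT //; lia.
Qed.

Lemma size_motzkin_words0 n j : size (motzkin_words 0 n j) = motzkin n j.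
Proof.
elim: n j => [|n IHn] j /=; first by rewrite andbT; case: eqP.
by case: j => [|j]; rewrite !size_cat ?size_map !IHn /=; lia.
Qed.

Lemma size_motzkin_words1 n j : size (motzkin_words 1 n j) = n * motzkin n.-1 j.
Proof.
elim: n j => [|n IHn] j /=; first by rewrite andbF.
case: j => [|j]; rewrite !size_cat ?size_map !IHn size_motzkin_words0;
  by case: n {IHn} => [|n] /=; lia.
Qed.

(** * The lowering operator on functionals of words *)

Section Lowering.
Variables (F : fieldType) (char0 : [pchar F]%R =i pred0).
Implicit Types (I : seq nat -> F) (w : seq nat).
Local Open Scope ring_scope.

(* A function on words is viewed as a functional on a tensor power of the      *)
(* natural SL_2-module; [lower] is the transpose of the lowering operator.     *)
Definition lower I w : F :=
  \sum_(i < size w | nth 2%N w i == 0%N) I (set_nth 2 w i 1)%N.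

Lemma lower_cons I x w :
  lower I (x :: w) = (if x == 0%N then I (1%N :: w) else 0) + lower (fun w => I (x :: w)) w.
Proof. by rewrite /lower big_mkcond big_ord_recl /= -big_mkcond. Qed.

Lemma eq_lower n I J : (forall w, size w = n -> I w = J w) ->
  forall w, size w = n -> lower I w = lower J w.
Proof.
move=> IJ w sz; apply: eq_bigr => i _; apply: IJ.
by rewrite size_set_nth -[RHS]sz; apply/maxn_idPr; exact: ltn_ord.
Qed.

Lemma eq_iter_lower k n I J : (forall w, size w = n -> I w = J w) ->
  forall w, size w = n -> iter k lower I w = iter k lower J w.
Proof. by move=> IJ; elim: k => // k IHk w sz; rewrite !iterS; exact: eq_lower sz. Qed.

Lemma iter_lower0 k w : iter k lower (fun=> 0) w = 0.
Proof.
elim: k w => // k IHk w; rewrite iterS.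
by rewrite (@eq_lower (size w) _ (fun=> 0)) // /lower big1.
Qed.

Lemma lowerD I J w : lower (fun w => I w + J w) w = lower I w + lower J w.
Proof. exact: big_split. Qed.
Lemma lowerM c I w : lower (fun w => c * I w) w = c * lower I w.
Proof. by rewrite /lower mulr_sumr. Qed.

(** The head 0 is turned into 1 at most once, in any one of the k applications. *)
Lemma iter_lower_cons0 k I w :
  iter k lower I (0%N :: w) = iter k lower (fun w => I (0%N :: w)) w +
    k%:R * iter k.-1 lower (fun w => I (1%N :: w)) w.
Proof.
have cons1 m J u : iter m lower J (1%N :: u) = iter m lower (fun w => J (1%N :: w)) u.
  elim: m u => // m IHm u; rewrite !iterS lower_cons /= add0r.
  by rewrite (@eq_lower (size u) _ (iter m lower (fun w => J (1%N :: w)))).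
elim: k w => [|k IHk] w; first by rewrite mul0r addr0.
rewrite !iterS lower_cons /= (@eq_lower (size w) _ _ (fun u _ => IHk u)) // lowerD lowerM cons1.
case: k {IHk} => [|k] /=; first by rewrite mul0r mul1r addr0 addrC.
by rewrite addrC -addrA; congr (_ + _); rewrite -[k.+2]addn1 natrD mulrDl mul1r.
Qed.

Lemma iter_lower_cons k I x w : x != 0%N ->
  iter k lower I (x :: w) = iter k lower (fun w => I (x :: w)) w.
Proof.
move=> x0; elim: k w => // k IHk w; rewrite !iterS lower_cons (negPf x0) add0r.
by rewrite (@eq_lower (size w) _ (iter k lower (fun w => I (x :: w)))).
Qed.

Lemma natr_neq0 k : k.+1%:R != 0 :> F.
Proof. by rewrite (proj1 (pcharf0P F) char0). Qed.

(** The sl_2 fact that an operator raising weights by 2 is injective for up to j steps from weight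
    -j, proved by induction on the length of words. *)
Lemma iter_lower_eq0 n k j I : (k <= j)%N ->
  (forall w, size w = n -> iter k lower I w = 0) ->
  (forall w, size w = n -> I w != 0 -> count_mem 1%N w = (count_mem 0%N w + j)%N) ->
  forall w, size w = n -> I w = 0.
Proof.
elim: n k j I => [|n IHn] [|k] j I kj I0 wt w sz //; try exact: I0.
  case: w sz => // _; case: (eqVneq (I [::]) 0) => // /(wt [::] erefl) /=.
  by rewrite add0n => e0; move: kj; rewrite -e0.
(* The hypothesis ties [iter k.+1 lower] of I after head 0 to [iter k lower] of I after head 1. One
   more application of [lower] kills the latter, so the induction hypothesis applies with k and j
   both increased. *)
have I0_0 u : size u = n -> I (0%N :: u) = 0.
  apply: (IHn k.+2 j.+1 (fun w => I (0%N :: w))) => // [v szv|v szv /wt];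
    last by rewrite /= szv => /(_ erefl); lia.
  have e x : size x = n -> iter k.+1 lower (fun w => I (0%N :: w)) x =
      - (k.+1%:R * iter k lower (fun w => I (1%N :: w)) x).
    by move=> szx; apply/eqP; rewrite -addr_eq0 -(iter_lower_cons0 k.+1) I0 //= szx.
  rewrite iterS (eq_lower e) // (_ : (fun _ => _) = (fun w => (- k.+1%:R) * iter k lower (fun w
    => I (1%N :: w)) w)); last first.
    by apply: funext => y; rewrite mulNr.
  by rewrite lowerM -iterS -(@iter_lower_cons k.+1) // I0 ?mulr0 //= szv.
have I1_0 u : size u = n -> I (1%N :: u) = 0.
  apply: (IHn k j.-1 (fun w => I (1%N :: w))) => // [|v szv|v szv /wt]; first by lia.
    have := iter_lower_cons0 k.+1 I v; rewrite I0 /= ?szv // -iterS.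
    rewrite (@eq_iter_lower k.+1 n _ (fun=> 0)) // iter_lower0 add0r => /esym/eqP.
    by rewrite mulf_eq0 (negPf (natr_neq0 _)) => /eqP.
  by rewrite /= szv => /(_ erefl); lia.
case: w sz => // x w [sz]; case: (eqVneq x 0%N) => [->|x0]; first exact: I0_0.
case: (eqVneq x 1%N) => [->|x1]; first exact: I1_0.
apply: (IHn k.+1 j (fun w => I (x :: w))) => // [v szv|v szv /wt].
  by rewrite -iter_lower_cons // I0 //= szv.
by rewrite /= szv (negPf x0) (negPf x1) => /(_ erefl).
Qed.

(** Dual form of the fact that ballot words index the highest weight vectors of a tensor power. The
    restriction to head 1 is killed by [lower] and has weight j + 1, so it vanishes by induction;
    the restriction to head 0 is then killed too, in weight j - 1. *)
Lemma lower_ballot_eq0 n j I :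
  (forall w, size w = n -> lower I w = 0) ->
  (forall w, size w = n -> I w != 0 -> count_mem 0%N w = (count_mem 1%N w + j)%N) ->
  (forall w, size w = n -> ballot w -> I w = 0) ->
  forall w, size w = n -> I w = 0.
Proof.
elim: n j I => [|n IHn] j I lI wt bI w sz; first by case: w sz => // _; exact: bI.
have I1 u : size u = n -> I (1%N :: u) = 0.
  apply: (IHn j.+1 (fun w => I (1%N :: w))) => // [v szv|v szv /wt|v szv bv].
  - by have := lI (1%N :: v); rewrite lower_cons /= add0r szv => ->.
  - by rewrite /= szv => /(_ erefl); lia.
  - case: (eqVneq (I (1%N :: v)) 0) => // nz; apply: bI; rewrite /= ?szv // bv /=.
    by have := wt _ _ nz; rewrite /= szv => /(_ erefl); lia.
have lI0 v : size v = n -> lower (fun w => I (0%N :: w)) v = 0.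
  by move=> szv; have := lI (0%N :: v); rewrite lower_cons /= I1 // add0r szv => ->.
case: w sz => // x w [sz]; case: (eqVneq x 0%N) => [->|x0].
  (* For j = 0 the weight after a head 0 is -1, where [lower] is already injective. *)
  case: j wt => [|j] wt.
    apply: (@iter_lower_eq0 n 1 1 (fun w => I (0%N :: w))) => // v szv /wt.
    by rewrite /= szv => /(_ erefl); lia.
  apply: (IHn j (fun w => I (0%N :: w))) => // v szv; first by move=> /wt;
    rewrite /= szv => /(_ erefl); lia.
  move=> bv; case: (eqVneq (I (0%N :: v)) 0) => // nz; apply: bI; rewrite /= ?szv // bv /=.
  by have := wt _ _ nz; rewrite /= szv => /(_ erefl); lia.
case: (eqVneq x 1%N) => [->|x1]; first exact: I1.
apply: (IHn j (fun w => I (x :: w))) => // [v szv|v szv /wt|v szv bv].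
- by have := lI (x :: v); rewrite lower_cons (negPf x0) add0r /= szv => ->.
- by rewrite /= szv (negPf x0) (negPf x1) => /(_ erefl).
- case: (eqVneq (I (x :: v)) 0) => // nz; apply: bI; rewrite /= ?szv // bv /=.
  by have := wt _ _ nz; rewrite /= szv (negPf x0) (negPf x1) => /(_ erefl); lia.
Qed.

End Lowering.

(** * Detecting multilinear elements on words in a, b, c and 1 *)

Local Open Scope ring_scope.
Local Open Scope na_scope.

Section Evaluation.
Variables (F : fieldType).
Local Notation V := (V3tilde F).
Local Notation L := (Htilde F).
Implicit Types (v : nat -> L) (u : relfree V).

Lemma idents_Htilde f : f \in idents V -> identity L f.
Proof. by move=> /identsP; apply => g. Qed.

Definition evr v u : L := relfree_lift v u.

Lemma evr_pi v f : evr v (relfree_pi V f) = eval_poly v f.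
Proof. by apply: relfree_liftE => g; exact: idents_Htilde. Qed.

Lemma evrP v c u u' : evr v (c *: u + u') = c *: evr v u + evr v u'.
Proof.
rewrite -[u]relfree_piK -[u']relfree_piK -[c *: _]relfree_piZ -raddfD /= !evr_pi.
by rewrite linearP.
Qed.

HB.instance Definition _ v := GRing.isLinear.Build F (relfree V) L *:%R (evr v) (evrP v).

Lemma evrM v u u' : evr v (u ** u') = evr v u ** evr v u'.
Proof.
rewrite -[u]relfree_piK -[u']relfree_piK -[_ ** _]relfree_piM !evr_pi.
exact: eval_polyM.
Qed.

Lemma evr_gen v i : evr v (relfree_gen V i) = v i.
Proof. by rewrite evr_pi eval_polyU. Qed.

Lemma evr_monom v w : evr v (eval_monom (relfree_gen V) w) = eval_monom v w.
Proof. by elim: w => [i|w1 IH1 w2 IH2] /=; rewrite ?evr_gen // evrM IH1 IH2. Qed.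

(** An identity of Htilde holds in the whole variety, so evaluations in Htilde separate the
    relatively free algebra. *)
Lemma evr_eq0 u : (forall v, evr v u = 0) -> u = 0.
Proof.
move=> u0; rewrite -[u]relfree_piK -(raddf0 (relfree_pi V)); apply/relfree_piP.
rewrite subr0; apply/identsP => A; apply=> v.
by rewrite -evr_pi relfree_piK.
Qed.

Lemma evr_perm n (q : 'S_n) v u : evr v (perm_vars V q u) = evr (v \o perm_var q) u.
Proof.
rewrite /perm_vars /relfree_lift (eval_relfree_pi V (fun i => << NAVar (perm_var q i) >>)).
rewrite evr_pi eval_poly_comp /evr /relfree_lift; congr (eval_poly _ _).
by apply: funext => i; rewrite eval_polyU.
Qed.

Definition upd v i (x : L) : nat -> L := fun k => if k == i then x else v k.

Lemma eq_eval_monom v v' w : {in navars w, v =1 v'} -> eval_monom v w = eval_monom v' w.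
Proof.
elim: w => [i|w1 IH1 w2 IH2] /= vv; first by apply: vv; rewrite inE.
by rewrite IH1 ?IH2 // => i iw; apply: vv; rewrite mem_cat iw ?orbT.
Qed.

Lemma eval_upd_notin v i x w : i \notin navars w -> eval_monom (upd v i x) w = eval_monom v w.
Proof.
by move=> iw; apply: eq_eval_monom => k kw; rewrite /upd; case: eqP kw iw => // -> ->.
Qed.

Definition derivation (D : L -> L) :=
  (forall c x y, D (c *: x + y) = c *: D x + D y) /\ (forall x y, D (x ** y) = D x ** y + x ** D y).

Lemma eval_deriv D v w : derivation D -> uniq (navars w) ->
  D (eval_monom v w) = \sum_(i <- navars w) eval_monom (upd v i (D (v i))) w.
Proof.
move=> [_ DM]; elim: w => [i|w1 IH1 w2 IH2] /=.
  by move=> _; rewrite big_seq1 /upd eqxx.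
rewrite cat_uniq => /and3P[u1 /hasPn dis u2]; rewrite DM big_cat IH1 // IH2 //=.
congr (_ + _).
  rewrite namul_suml big_seq [RHS]big_seq; apply: eq_bigr => i i1.
  by rewrite (@eval_upd_notin _ _ _ w2) //; apply: contraL i1 => /dis.
rewrite namul_sumr big_seq [RHS]big_seq; apply: eq_bigr => i i2.
by rewrite (@eval_upd_notin _ _ _ w1) //; apply: dis.
Qed.

Lemma eval_upd_linear v i c x y w : uniq (navars w) -> i \in navars w ->
  eval_monom (upd v i (c *: x + y)) w =
  c *: eval_monom (upd v i x) w + eval_monom (upd v i y) w.
Proof.
elim: w => [k|w1 IH1 w2 IH2] /=; first by rewrite inE => _ /eqP ->; rewrite /upd eqxx.
rewrite cat_uniq mem_cat => /and3P[u1 /hasPn dis u2] /orP[i1|i2].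
  have i2 : i \notin navars w2 by apply: contraL i1 => /dis.
  by rewrite IH1 // !(eval_upd_notin _ _ i2) namulDl namulZl.
by rewrite IH2 // !(eval_upd_notin _ _ (dis _ i2)) namulDr namulZr.
Qed.

Section Multilinear.
Variables (n : nat) (u : relfree V) (Pu : multilinear_part V n u).

Lemma multilinearE : exists2 s : seq (F * namonom), all (fun p => multilinear_monom n p.2) s &
  forall v, evr v u = \sum_(p <- s) p.1 *: eval_monom v p.2.
Proof.
case: Pu => s sP ->; exists s => // v; rewrite linear_sum; apply: eq_bigr => p _.
by rewrite linearZ /= evr_monom.
Qed.

Lemma evr_ext v v' : (forall i, (i < n)%N -> v i = v' i) -> evr v u = evr v' u.
Proof.
case: multilinearE => s /allP sP uE vv; rewrite !uE big_seq [RHS]big_seq.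
apply: eq_bigr => p /sP mp; congr (_ *: _); apply: eq_eval_monom => i.
by rewrite (perm_mem mp) mem_iota => /vv.
Qed.

Lemma evr_deriv D v : derivation D ->
  D (evr v u) = \sum_(i < n) evr (upd v i (D (v i))) u.
Proof.
move=> dD; case: multilinearE => s /allP sP uE.
have DD : linear D by case: dD.
have D0 : D 0 = 0 by have := DD (-1) 0 0; rewrite scaler0 addr0 => ->; rewrite scaleN1r addNr.
have -> : D (evr v u) = \sum_(p <- s) p.1 *: D (eval_monom v p.2).
  by rewrite uE; elim: (s) => [|p r IH]; rewrite ?big_nil // !big_cons DD IH.
under [RHS]eq_bigr do rewrite uE; rewrite exchange_big big_seq [RHS]big_seq.
apply: eq_bigr => p /sP mp; rewrite -scaler_sumr (eval_deriv _ dD); last first.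
  by rewrite (perm_uniq mp) iota_uniq.
by rewrite (perm_big _ mp) -[X in iota 0 X]subn0 -/(index_iota 0 n) big_mkord.
Qed.

Lemma evr_upd_linear v i c x y : (i < n)%N ->
  evr (upd v i (c *: x + y)) u = c *: evr (upd v i x) u + evr (upd v i y) u.
Proof.
move=> ltin; case: multilinearE => s /allP sP uE.
rewrite !uE scaler_sumr -big_split big_seq [RHS]big_seq; apply: eq_bigr => p /sP mp.
rewrite eval_upd_linear ?(perm_uniq mp) ?iota_uniq ?(perm_mem mp) ?mem_iota //.
by rewrite scalerDr scalerA mulrC -scalerA.
Qed.

Lemma evr_upd_D v i x y : (i < n)%N -> evr (upd v i (x + y)) u = evr (upd v i x) u + evr (upd v i
  y) u.
Proof. by move=> ltin; have := evr_upd_linear v 1 x y ltin; rewrite !scale1r. Qed.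
Lemma evr_upd_0 v i : (i < n)%N -> evr (upd v i 0) u = 0.
Proof. by move=> ltin; have := evr_upd_linear v (-1) 0 0 ltin;
  rewrite scaler0 addr0 scaleN1r addNr. Qed.
Lemma evr_upd_Z v i c x : (i < n)%N -> evr (upd v i (c *: x)) u = c *: evr (upd v i x) u.
Proof. by move=> ltin; have := evr_upd_linear v c x 0 ltin; rewrite evr_upd_0 // !addr0. Qed.

End Multilinear.

Lemma eval_heis v w : (1 < size (navars w))%N -> exists c, (eval_monom v w).1 = c *: delta_mx 0 2.
Proof. by case: w => //= w1 w2 _; eexists. Qed.

Lemma eval_heis0 v w : (2 < size (navars w))%N -> (eval_monom v w).1 = 0.
Proof.
case: w => //= w1 w2; rewrite size_cat => sz.
have nz (w : namonom) : (0 < size (navars w))%N by elim: w => //= a IHa b _;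
  rewrite size_cat addn_gt0 IHa.
have : (1 < size (navars w1))%N || (1 < size (navars w2))%N by have := nz w1; have := nz w2; lia.
rewrite /namul /= /Htilde_mul /= /heis_mul.
by case/orP => /(eval_heis v)[c ->]; rewrite !mxE /= !mulr0 ?(mul0r, mulr0) subrr scale0r.
Qed.

Lemma navars_size1 w : size (navars w) = 1%N -> exists i, w = NAVar i.
Proof.
case: w => [i|w1 w2] /=; first by exists i.
have nz (w : namonom) : (0 < size (navars w))%N by elim: w => //= a IHa b _;
  rewrite size_cat addn_gt0 IHa.
by rewrite size_cat; have := nz w1; have := nz w2; lia.
Qed.

End Evaluation.

(** * Derivations of Htilde and relations between values at words *)

Section Detect.
Variables (F : fieldType) (char0 : [pchar F] =i pred0).
Local Notation V := (V3tilde F).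
Local Notation L := (Htilde F).

Definition letter k (p : {poly F}) : L :=
  nth (0, p) [:: (delta_mx 0 1, 0); (delta_mx 0 0, 0); (delta_mx 0 2, 0)] k.

Definition lv w p i : L := letter (nth 2%N w i) p.

(* Derivations of Htilde: [dT] is the projection to T, [d0] the grading with   *)
(* b, a and t of degrees 1, -1 and 1, and [dac], [dbc], [dba] extend a |-> c,  *)
(* b |-> c and b |-> 2a (coordinate 0 of H is a and coordinate 1 is b).        *)
Definition dT (x : L) : L := (0, x.2).
Definition d0 (x : L) : L := (x.1 0 1 *: delta_mx 0 1 - x.1 0 0 *: delta_mx 0 0, 'X * x.2^`()).
Definition dac (x : L) : L := (x.1 0 0 *: delta_mx 0 2, - ('X * x.2)).
Definition dbc (x : L) : L := (x.1 0 1 *: delta_mx 0 2, x.2^`()).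
Definition dba (x : L) : L := ((x.1 0 1 *+ 2) *: delta_mx 0 0, x.2^`()^`()).

Lemma heisP (x y : heis F) : x 0 0 = y 0 0 -> x 0 1 = y 0 1 -> x 0 2 = y 0 2 -> x = y.
Proof.
move=> e0 e1 e2; apply/rowP=> -[[|[|[|i]]] // lti].
- by rewrite (_ : Ordinal lti = 0) //; apply: val_inj.
- by rewrite (_ : Ordinal lti = 1) //; apply: val_inj.
- by rewrite (_ : Ordinal lti = 2) //; apply: val_inj.
Qed.


Lemma derivationI (d : heis F -> heis F) (E : {poly F} -> {poly F}) (D : L -> L) :
  (forall x, D x = (d x.1, E x.2)) ->
  (forall c x y, d (c *: x + y) = c *: d x + d y) ->
  (forall c f g, E (c *: f + g) = c *: E f + E g) ->
  (forall x y, d (heis_mul x y) = heis_mul (d x) y + heis_mul x (d y)) ->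
  (forall f y, E (heis_act f y) = heis_act (E f) y + heis_act f (d y)) ->
  derivation D.
Proof.
move=> DE dP EP dM EM; split=> [c|] [x f] [y g]; rewrite !DE /=.
  by rewrite dP EP.
by rewrite dM EM.
Qed.

Lemma snd_sum (I : Type) (r : seq I) (P : pred I) (f : I -> L) :
  (\sum_(i <- r | P i) f i).2 = \sum_(i <- r | P i) (f i).2.
Proof. by elim/big_rec2: _ => // i y x _ <-. Qed.

Ltac heis_tac := move=> *; apply: heisP; rewrite /heis_mul ?mxE /= ?(mulr0n, mulr1n); ring.
Ltac poly_tac := move=> *; rewrite /heis_act ?mxE /= ?(derivD, derivZ, derivM, derivX, derivC,
  derivN, derivMn);
    rewrite -?mul_polyC ?(polyCD, polyCM, polyCB, polyCN, polyC0, polyC1, polyCMn, mulr0n,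
      mulr1n); ring.

Lemma dT_deriv : derivation dT.
Proof. by apply: (derivationI (d := fun=> 0) (E := id)) => //; [heis_tac|heis_tac|poly_tac]. Qed.
Lemma d0_deriv : derivation d0.
Proof.
apply: (derivationI (d := fun x => x 0 1 *: delta_mx 0 1 - x 0 0 *: delta_mx 0 0) (E := fun f =>
  'X * f^`())) => //.
- heis_tac.
- poly_tac.
- heis_tac.
- poly_tac.
Qed.
Lemma dac_deriv : derivation dac.
Proof.
apply: (derivationI (d := fun x => x 0 0 *: delta_mx 0 2) (E := fun f => - ('X * f))) => //.
- heis_tac.
- poly_tac.
- heis_tac.
- poly_tac.
Qed.
Lemma dbc_deriv : derivation dbc.
Proof.
apply: (derivationI (d := fun x => x 0 1 *: delta_mx 0 2) (E := fun f => f^`())) => //.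
- heis_tac.
- poly_tac.
- heis_tac.
- poly_tac.
Qed.
Lemma dba_deriv : derivation dba.
Proof.
apply: (derivationI (d := fun x => (x 0 1 *+ 2) *: delta_mx 0 0) (E := fun f => f^`()^`())) => //.
- heis_tac.
- poly_tac.
- heis_tac.
- poly_tac.
Qed.

Lemma set_nthE (w : seq nat) i k (p : {poly F}) j : (j < size w)%N -> (i < size w)%N ->
  lv (set_nth 2%N w i k) p j = upd (lv w p) i (letter k p) j.
Proof. by move=> jw iw; rewrite /lv nth_set_nth /= /upd; case: eqP. Qed.

Section Words.
Variables (n : nat) (u : relfree V) (Pu : multilinear_part V n u).
Implicit Types (w : seq nat) (p : {poly F}).

Definition one_T_word w := [&& size w == n, all (gtn 4) w & count_mem 3 w == 1]%N.

Lemma tword_index w : one_T_word w -> exists2 i0 : 'I_n, nth 2%N w i0 = 3%N &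
  forall i : 'I_n, nth 2%N w i = 3%N -> i = i0.
Proof.
case/and3P=> /eqP sz _ c1.
have w3 : (3 \in w)%N by rewrite -has_pred1 has_count (eqP c1).
have ltw : (index 3 w < n)%N by rewrite -sz index_mem.
exists (Ordinal ltw) => /=; first by rewrite nth_index.
move=> i wi; apply: val_inj => /=; have szi : (i < size w)%N by rewrite sz.
move: c1; rewrite -[in count _ _](cat_take_drop i w) count_cat (drop_nth 2%N szi) /= wi eqxx.
move=> c1; have : (3 \notin take i w)%N.
  by rewrite -has_pred1 has_count -eqn0Ngt; move: c1; case: (count _ (take i w)) => //= m;
    rewrite addSn addnS.
move=> ni; rewrite -[in index _ _](cat_take_drop i w) index_cat (negPf ni) (drop_nth 2%N szi) /=
  wi eqxx.
by rewrite addn0 size_take szi.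
Qed.

Lemma nth_lt4 w i : one_T_word w -> (nth 2 w i < 4)%N.
Proof.
case/and3P=> _ /allP w4 _; case: (ltnP i (size w)) => [iw|/(nth_default _) -> //].
by have := w4 _ (mem_nth 2%N iw).
Qed.

(** For a derivation sending letters of H to multiples of letters: [s] and [t] record the factor and
    the new letter, [E] the action on T. The last term comes from the only letter in T. *)
Lemma evr_word_deriv (D : L -> L) (s : nat -> F) (t : nat -> nat) (E : {poly F} -> {poly F}) w p :
  derivation D -> (forall k, (k < 3)%N -> D (letter k p) = s k *: letter (t k) p) ->
  D (0, p) = (0, E p) -> one_T_word w ->
  D (evr (lv w p) u) =
  \sum_(i < n | nth 2%N w i != 3%N) s (nth 2%N w i) *: evr (lv (set_nth 2%N w i (t (nth 2%N w
    i))) p) u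
  + evr (lv w (E p)) u.
Proof.
move=> dD Dl DE tw; have [i0 wi0 i0P] := tword_index tw; have /and3P[/eqP sz _ _] := tw.
rewrite (evr_deriv Pu _ dD) (bigD1 i0) //= addrC; congr (_ + _).
  apply: eq_big => [i|i ii0].
    by apply/idP/idP; apply: contraNN => /eqP; [move=> /i0P ->|move=> ->; apply/eqP].
  have w3 : (nth 2 w i < 3)%N.
    rewrite ltn_neqAle -ltnS nth_lt4 // andbT; apply: contra ii0 => /eqP /i0P ->; exact: eqxx.
  rewrite [lv w p i]/(letter _ p) Dl // (evr_upd_Z Pu) //; congr (_ *: _);
    apply: (evr_ext Pu) => j jn.
  by rewrite set_nthE ?sz.
apply: (evr_ext Pu) => j jn; rewrite /upd /lv wi0 /letter /= DE; case: eqP => [->|ne].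
  by rewrite wi0.
have w3 : (nth 2 w j < 3)%N.
  by rewrite ltn_neqAle -ltnS nth_lt4 // andbT; apply/eqP => /(i0P (Ordinal jn)) e; case: ne;
    rewrite -e.
by case: (nth 2%N w j) w3 => [|[|[|k]]].
Qed.

Definition word_value w := (evr (lv w 1) u).2.

Lemma evr_lv0 w : one_T_word w -> evr (lv w 0) u = 0.
Proof.
move=> tw; have [i0 wi0 _] := tword_index tw; rewrite -[RHS](evr_upd_0 Pu (lv w 0) (ltn_ord i0)).
by apply: (evr_ext Pu) => j jn; rewrite /upd; case: eqP => // ->; rewrite /lv wi0.
Qed.

Lemma G_sum_only (s : nat -> F) (t : nat -> nat) k0 w :
  (forall k, (k < 3)%N -> k != k0 -> s k = 0) -> k0 != 3%N -> one_T_word w ->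
  (\sum_(i < n | nth 2%N w i != 3%N) s (nth 2%N w i) *: evr (lv (set_nth 2%N w i (t (nth 2%N w
    i))) 1) u).2
  = s k0 *: \sum_(i < size w | nth 2%N w i == k0) word_value (set_nth 2%N w i (t k0)).
Proof.
move=> s0 k03 tw; have /and3P[/eqP sz _ _] := tw; rewrite sz scaler_sumr.
rewrite snd_sum.
rewrite big_mkcond [RHS]big_mkcond /=; apply: eq_bigr => i _; have := nth_lt4 i tw.
case: (eqVneq (nth 2%N w i) k0) => [->|wk]; first by rewrite k03.
by case: (eqVneq (nth 2%N w i) 3%N) => // w3 lt4; rewrite s0 ?scale0r // ltn_neqAle w3 -ltnS.
Qed.

Lemma G_bc w : one_T_word w ->
  (word_value w)^`() = \sum_(i < size w | nth 2%N w i == 0%N) word_value (set_nth 2%N w i 2%N).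
Proof.
move=> tw; have e1 k : (k < 3)%N -> dbc (letter k 1) = (k == 0%N)%:R *: letter 2 1.
  by case: k => [|[|[|k]]] // _; rewrite /dbc /= !mxE /= ?scale1r ?scale0r ?deriv0.
have e2 : dbc (0, 1) = (0, (1 : {poly F})^`()) by rewrite /dbc /= mxE scale0r.
rewrite -[LHS]/(dbc (evr (lv w 1) u)).2 (evr_word_deriv dbc_deriv (t := fun=> 2%N) e1 (E := fun f
  => f^`()) e2 tw).
rewrite derivC evr_lv0 // addr0 (@G_sum_only (fun k => (k == 0%N)%:R) (fun=> 2%N) 0%N) ?scale1r //.
by move=> k _ /negPf ->.
Qed.

Lemma G_ba w : one_T_word w ->
  (word_value w)^`()^`() = (\sum_(i < size w | nth 2%N w i == 0%N) word_value (set_nth 2%N w i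
    1%N)) *+ 2.
Proof.
move=> tw; have e1 k : (k < 3)%N -> dba (letter k 1) = ((k == 0%N)%:R *+ 2) *: letter 1 1.
  by case: k => [|[|[|k]]] // _; rewrite /dba /= !mxE /= ?mul0rn ?scale0r ?deriv0 //; congr pair;
    rewrite scaler0.
have e2 : dba (0, 1) = (0, (1 : {poly F})^`()^`()) by rewrite /dba /= mxE mul0rn scale0r.
rewrite -[LHS]/(dba (evr (lv w 1) u)).2 (evr_word_deriv dba_deriv (t := fun=> 1%N) e1 (E := fun f
  => f^`()^`()) e2 tw).
rewrite derivC deriv0 evr_lv0 // addr0 (@G_sum_only (fun k => (k == 0%N)%:R *+ 2) (fun=> 1%N)
  0%N) ?scaler_nat //.
by move=> k _ /negPf ->; rewrite mul0rn.
Qed.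

(** The grading: the value is homogeneous in t, of degree the number of b minus the number of a. *)
Lemma G_weight w : one_T_word w ->
  'X * (word_value w)^`() = ((count_mem 0%N w)%:R - (count_mem 1%N w)%:R) *: word_value w.
Proof.
move=> tw; pose s k : F := if k == 0%N then 1 else if k == 1%N then - 1 else 0.
have e1 k : (k < 3)%N -> d0 (letter k 1) = s k *: letter k 1.
  case: k => [|[|[|k]]] // _; rewrite /d0 /= !mxE /s /= ?scale1r ?scale0r ?deriv0 ?mulr0 ?subr0
    ?sub0r ?scaleN1r //.
  by congr pair; rewrite oppr0.
have e2 : d0 (0, 1) = (0, 'X * (1 : {poly F})^`()) by rewrite /d0 /= !mxE !scale0r subr0.
rewrite -[LHS]/(d0 (evr (lv w 1) u)).2 (evr_word_deriv d0_deriv (t := id) e1 (E := fun f => 'X *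
  f^`()) e2 tw).
have /and3P[/eqP sz _ _] := tw.
rewrite derivC mulr0 evr_lv0 // addr0.
have -> : \sum_(i < n | nth 2%N w i != 3%N) s (nth 2%N w i) *: evr (lv (set_nth 2%N w i (id (nth
  2%N w i))) 1) u
    = (\sum_(i < n) s (nth 2%N w i)) *: evr (lv w 1) u.
  rewrite scaler_suml [RHS](bigID (fun i : 'I_n => nth 2%N w i != 3%N)) /= [X in _ + X]big1 ?addr0.
    apply: eq_bigr => i _; congr (_ *: _); apply: (evr_ext Pu) => j jn.
    by rewrite set_nthE ?sz // /upd; case: eqP => // ->.
  by move=> i /negPn/eqP ->; rewrite /s scale0r.
rewrite /word_value /=; congr (_ *: _).
have <- : \sum_(x <- w) s x = \sum_(i < n) s (nth 2%N w i) by rewrite (big_nth 2%N) sz big_mkord.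
elim: (w) => [|x r IH]; first by rewrite big_nil subrr.
rewrite big_cons IH /= !natrD /s eq_sym [(x == 1)%N]eq_sym.
by case: x => [|[|x]] /=; ring.
Qed.

End Words.
End Detect.

Lemma count_mem_set_nth (w : seq nat) i a k : (i < size w)%N ->
  (count_mem a (set_nth 2 w i k) + (nth 2 w i == a) = count_mem a w + (k == a))%N.
Proof.
elim: w i => [|x w IHw] [|i] //; first by move=> _;
  rewrite !count_mem_cons addnAC (addnC (nat_of_bool (k == a))) addnAC.
by rewrite [set_nth _ _ _ _]/= !count_mem_cons [nth _ _ _]/= => /IHw e; rewrite -!addnA e.
Qed.

Section Steps.
Local Open Scope nat_scope.
Lemma count_step1 (x1 y1 x0 y0 m : nat) : x1 + (0 == 1) = y1 + (1 == 1) ->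
  x0 + (0 == 0) = y0 + (1 == 0) -> y0 + y1 = m -> x0 + x1 = m.
Proof. by move=> /=; lia. Qed.
Lemma count_step1' (x1 y1 x0 y0 : nat) : x1 + (0 == 1) = y1 + (1 == 1) ->
  x0 + (0 == 0) = y0 + (1 == 0) -> y0 + y1 == x0 + x1.
Proof. by move=> /=; lia. Qed.
Lemma count_step2 (x1 y1 x0 y0 z1 z0 m0 m : nat) : z1 + (0 == 1) = y1 + (2 == 1) ->
  z0 + (0 == 0) = y0 + (2 == 0) -> y1 + (0 == 1) = x1 + (2 == 1) ->
  y0 + (0 == 0) = x0 + (2 == 0) -> x0 + x1 = m0 -> m0 <= m -> z0 + z1 < m.
Proof. by move=> /=; lia. Qed.
Lemma count_step3 (x0 y0 m : nat) : x0 + (0 == 0) = y0 + (2 == 0) -> y0 <= m -> x0 < m.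
Proof. by move=> /=; lia. Qed.
End Steps.

Section Detect.
Variables (F : fieldType) (char0 : [pchar F] =i pred0).
Local Notation V := (V3tilde F).
Local Notation L := (Htilde F).
Variables (n : nat) (u : relfree V) (Pu : multilinear_part V n u).
Implicit Types (w : seq nat) (p : {poly F}).
Local Notation G := (word_value u).
Local Notation tword := (one_T_word n).

Lemma size_tword w : tword w -> size w = n.
Proof. by case/and3P => /eqP. Qed.

Lemma tword_set w i k : tword w -> (i < size w)%N -> nth 2%N w i != 3%N -> (k < 3)%N ->
  tword (set_nth 2%N w i k).
Proof.
case/and3P=> sz w4 c3 iw wi k3; rewrite /one_T_word size_set_nth (maxn_idPr iw) sz.
have -> : count_mem 3%N (set_nth 2%N w i k) = count_mem 3%N w.
  by have := count_mem_set_nth 3 k iw; rewrite (negPf wi) (ltn_eqF k3) !addn0.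
rewrite c3 andbT /=; apply/(all_nthP 2%N) => j jw.
rewrite nth_set_nth /=; case: eqP => _; first exact: ltnW.
by move: jw; rewrite size_set_nth (maxn_idPr iw) => jw; apply: (allP w4); exact: mem_nth.
Qed.

Lemma G_bc2 w : tword w ->
  (G w)^`()^`() = \sum_(i < size w | nth 2%N w i == 0%N)
    \sum_(j < size w | nth 2%N (set_nth 2%N w i 2%N) j == 0%N)
       G (set_nth 2%N (set_nth 2%N w i 2%N) j 2%N).
Proof.
move=> tw; rewrite (G_bc Pu tw) linear_sum; apply: eq_bigr => i /eqP wi.
rewrite /= (G_bc Pu) ?tword_set ?wi //.
by rewrite size_set_nth (maxn_idPr (ltn_ord i)).
Qed.

Lemma natr_inj (i j : nat) : i%:R = j%:R :> F -> i = j.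
Proof.
wlog le_ij : i j / (i <= j)%N => [hw|/esym/eqP].
  by move=> e; case: (leqP i j) => [/hw->//|/ltnW/hw->].
by rewrite -subr_eq0 -natrB // (proj1 (pcharf0P F) char0) subn_eq0 => ji; apply/eqP;
  rewrite eqn_leq le_ij.
Qed.

Lemma G_coef0_weight w : tword w -> (G w)`_0 != 0 -> count_mem 0%N w = count_mem 1%N w.
Proof.
move=> tw nz; have := congr1 (fun p : {poly F} => p`_0) (G_weight Pu tw).
rewrite coefXM eqxx coefZ => /esym/eqP; rewrite mulf_eq0 (negPf nz) orbF subr_eq0.
by move=> /eqP/natr_inj.
Qed.

(** Induction on the number of letters a and b. Computing the second derivative by [G_ba] and by
    [G_bc] twice, the sum of the constant terms over all changes b -> a is half a sum over words
    with two b changed to c, which vanish by induction. So the constant terms are killed by [lower],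
    and [lower_ballot_eq0] leaves the Motzkin words. *)
Lemma G_coef0_eq0 : {in motzkin_words 1 n 0, forall w, (G w)`_0 = 0} ->
  forall w, tword w -> (G w)`_0 = 0.
Proof.
move=> G0 w; have [m] := ubnP (count_mem 0%N w + count_mem 1%N w).
elim: m w => // m IHm w; rewrite ltnS => wm tw.
pose m0 := (count_mem 0%N w + count_mem 1%N w)%N.
pose I v := if tword v && (count_mem 0 v + count_mem 1 v == m0)%N then (G v)`_0 else 0.
suff : I w = 0 by rewrite /I tw eqxx.
have sw := size_tword tw.
apply: (@lower_ballot_eq0 F char0 n 0 I _ _ _ w sw) => v sv.
- rewrite /lower; case: (boolP (tword v && (count_mem 0 v + count_mem 1 v == m0)%N)) => [/andP[tv
    /eqP cv]|nv].
    rewrite (eq_bigr (fun i : 'I_(size v) => (G (set_nth 2%N v i 1%N))`_0)); last first.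
      move=> i /eqP vi; rewrite /I tword_set ?vi //=.
      have := count_mem_set_nth 1 1 (ltn_ord i); have := count_mem_set_nth 0 1 (ltn_ord i).
      by rewrite vi => e1 e0; rewrite (count_step1 e0 e1 cv) eqxx.
    have := congr1 (fun p : {poly F} => p`_0) (G_ba Pu tv); rewrite G_bc2 // coefMn !coef_sum.
    rewrite big1 => [/esym/eqP|i /eqP vi].
      by rewrite -mulr_natr mulf_eq0 (negPf (natr_neq0 char0 1)) orbF => /eqP.
    rewrite coef_sum big1 // => j /eqP vj.
    have si : size (set_nth 2%N v i 2%N) = size v by rewrite size_set_nth (maxn_idPr (ltn_ord i)).
    apply: IHm.
      have jw : (j < size (set_nth 2%N v i 2%N))%N by rewrite si.
      have := count_mem_set_nth 0 2 (ltn_ord i); have := count_mem_set_nth 1 2 (ltn_ord i).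
      have := count_mem_set_nth 0 2 jw; have := count_mem_set_nth 1 2 jw.
      by rewrite vi vj => a b c d; exact: (count_step2 a b c d cv wm).
    by rewrite !tword_set ?vj ?vi ?si.
  rewrite big1 // => i /eqP vi; rewrite /I; case: ifP => // /andP[tv' /eqP cv'].
  (* Writing the letter 0 back shows that v was already a word of the class considered. *)
  case/negP: nv; apply/andP; split.
    have := @tword_set _ i 0 tv'; rewrite size_set_nth (maxn_idPr (ltn_ord i)) ltn_ord
      nth_set_nth /= eqxx.
    rewrite set_set_nth eqxx => /(_ isT isT isT).
    have -> // : set_nth 2%N v i 0%N = v.
    apply: (@eq_from_nth _ 2%N); rewrite size_set_nth (maxn_idPr (ltn_ord i)) // => j jv.
    by rewrite nth_set_nth /=; case: eqP => // ->.
  have := count_mem_set_nth 1 1 (ltn_ord i); have := count_mem_set_nth 0 1 (ltn_ord i).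
  by rewrite vi -cv' => e1 e0; rewrite (count_step1' e0 e1).
- rewrite addn0 /I; case: ifP => [/andP[tv _]|]; last by rewrite eqxx.
  by move/G_coef0_weight => /(_ tv).
- move=> bv; rewrite /I; case: ifP => // /andP[tv _].
  case: (eqVneq ((G v)`_0) 0) => // /G_coef0_weight -/(_ tv) e.
  by apply: G0; have /and3P[/eqP ? ? /eqP ?] := tv; apply: mem_motzkin_words; rewrite ?addn0.
Qed.

Lemma poly_deriv_eq0 p : p^`() = 0 -> p`_0 = 0 -> p = 0.
Proof.
move=> dp p0; apply/polyP => -[|i]; first by rewrite p0 coef0.
have := congr1 (fun q : {poly F} => q`_i) dp; rewrite coef_deriv coef0 => /eqP.
by rewrite -mulr_natr mulf_eq0 (negPf (natr_neq0 char0 i)) orbF coef0 => /eqP.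
Qed.

Hypothesis G0 : {in motzkin_words 1 n 0, forall w, (G w)`_0 = 0}.

(** By [G_bc] the derivative is a sum over words with fewer b, so only the constant term is left. *)
Lemma G_eq0 w : tword w -> G w = 0.
Proof.
have [m] := ubnP (count_mem 0%N w); elim: m w => // m IHm w; rewrite ltnS => wm tw.
apply: poly_deriv_eq0; last exact: G_coef0_eq0.
rewrite (G_bc Pu tw) big1 // => i /eqP wi; apply: IHm; last by rewrite tword_set ?wi.
by have := count_mem_set_nth 0 2 (ltn_ord i); rewrite wi => /count_step3; apply.
Qed.

(** The derivation a |-> c multiplies T by -t, hence expresses the value at t p through values at p;
    all polynomials are reached from 1. *)
Lemma evr_lv_eq0 w p : tword w -> (evr (lv w p) u).2 = 0.
Proof.
elim/poly_ind: p w => [|p c IHp] w tw; first by rewrite (evr_lv0 Pu tw).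
have [i0 wi0 i0P] := tword_index tw.
have upd0 q : evr (lv w q) u = evr (upd (lv w 1) i0 (0, q)) u.
  apply: (evr_ext Pu) => j jn; rewrite /upd /lv; case: eqP => [->|ne]; first by rewrite wi0.
  have := nth_lt4 j tw; case e : (nth 2%N w j) => [|[|[|[|k]]]] // _.
  by case: ne; rewrite -(i0P (Ordinal jn)).
have e1 k : (k < 3)%N -> dac (letter k p) = (k == 1%N)%:R *: letter 2 p :> L.
  by case: k => [|[|[|k]]] // _; rewrite /dac /= !mxE /= ?scale1r ?scale0r ?mulr0 ?oppr0.
have e2 : dac (0, p) = (0, - ('X * p)) by rewrite /dac /= mxE scale0r.
have := evr_word_deriv Pu (dac_deriv F) (t := fun=> 2%N) e1 (E := fun f => - ('X * f)) e2 tw.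
move/(congr1 snd) => /=; rewrite IHp // mulr0 oppr0 snd_sum big1 => [|i wi]; last first.
  case: eqP => [w1|_]; last by rewrite scale0r.
  by rewrite scale1r IHp // tword_set ?w1 ?(size_tword tw).
rewrite add0r => /esym XpN.
have Xp : (evr (lv w (p * 'X)) u).2 = 0.
  rewrite mulrC -['X * p]opprK upd0 -[- - _]scaleN1r.
  have -> : (0, -1 *: - ('X * p)) = -1 *: (0, - ('X * p)) :> L by congr pair; rewrite scaler0.
  by rewrite (evr_upd_Z Pu) // -upd0 /= XpN scaler0.
rewrite upd0; have -> : (0, p * 'X + c%:P) = (0, p * 'X) + c *: (0, 1) :> L.
  by congr pair; rewrite /= ?scaler0 ?addr0 // -mul_polyC mulr1.
rewrite (evr_upd_D Pu) // (evr_upd_Z Pu) // -!upd0 /= Xp add0r.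
by rewrite -/(word_value u w) G_eq0 ?scaler0.
Qed.

Definition basic (x : L) k := if (k < 3)%N then x = letter k 0 else k = 3%N /\ x.1 = 0.

(** The projection to T is a derivation, so the T-component of the value equals itself times the
    number of arguments in T; it vanishes unless that number is 1. *)
Lemma evr_basic (v : nat -> L) : (forall i : 'I_n, exists k, basic (v i) k) -> (evr v u).2 = 0.
Proof.
move=> /choice[k kP]; pose w := [seq k i | i <- enum 'I_n].
have sw : size w = n by rewrite size_map size_enum_ord.
have wE (i : 'I_n) : nth 2%N w i = k i by rewrite (nth_map i) ?size_enum_ord ?nth_ord_enum.
have k4 i : (k i < 4)%N by have := kP i; rewrite /basic; case: ltnP => [/ltnW|_ [->]].
have := evr_deriv Pu v (dT_deriv F).
have -> : \sum_(i < n) evr (upd v i (dT (v i))) u = \sum_(i < n) (k i == 3%N)%:R *: evr v u.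
  apply: eq_bigr => i _; have -> : dT (v i) = (k i == 3%N)%:R *: v i.
    have := kP i; rewrite /basic /dT; case: ltnP => [k3 ->|_ [-> v1]]; last first.
      by rewrite eqxx scale1r; case: (v i) v1 => ? ? /= ->.
    by rewrite (ltn_eqF k3) scale0r; case: (k i) k3 => [|[|[|?]]].
  rewrite (evr_upd_Z Pu) //; congr (_ *: _); apply: (evr_ext Pu) => j jn.
  by rewrite /upd; case: eqP => // ->.
rewrite -scaler_suml -natr_sum; move/(congr1 snd) => /=.
have -> : (\sum_(i < n) (k i == 3%N) = count_mem 3%N w)%N.
  rewrite -sum1_count big_map [RHS]big_mkcond [RHS]big_enum /=; apply: eq_bigr => i _.
  by rewrite /=; case: (k i == 3%N).
set t := count_mem 3%N w => /eqP; rewrite -subr_eq0 -{1}[snd _]scale1r -scalerBl scaler_eq0.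
case/orP => [|/eqP //]; rewrite subr_eq0 => /eqP/esym e.
have {e} t1 : t = 1%N by apply: natr_inj.
have tw : tword w.
  rewrite /one_T_word sw eqxx -/t t1 eqxx andbT /=; apply/allP => x /mapP[i _ ->]; exact: k4.
have [i0 wi0 i0P] := tword_index tw.
rewrite -(evr_lv_eq0 (v i0).2 tw); congr snd; apply: (evr_ext Pu) => j jn.
have := kP (Ordinal jn); rewrite /basic /lv -wE /=; case: ltnP => [k3 ->|_ [w3 v1]].
  by case: (nth 2%N w j) k3 => [|[|[|?]]].
by rewrite w3 -(i0P (Ordinal jn) w3) /=; case: (v j) v1 => ? ? /= ->.
Qed.

Lemma evr_snd_eq0 (v : nat -> L) : (evr v u).2 = 0.
Proof.
suff gen m (v' : nat -> L) : (m <= n)%N -> (forall i : 'I_n, (m <= i)%N -> exists k, basic (v' i)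
  k) -> (evr v' u).2 = 0.
  by apply: (gen n) => // i; rewrite leqNgt ltn_ord.
elim: m v' => [|m IHm] v' mn bv; first by apply: evr_basic => i; apply: bv.
have IH x k : basic x k -> (evr (upd v' m x) u).2 = 0.
  move=> bx; apply: IHm; first exact: ltnW.
  move=> i mi; rewrite /upd; case: eqP => [_|/eqP ne]; first by exists k.
  by apply: bv; rewrite ltn_neqAle eq_sym ne.
have -> : evr v' u = evr (upd v' m (v' m)) u.
  by apply: (evr_ext Pu) => i _; rewrite /upd; case: eqP => // ->.
have -> : v' m = (v' m).1 0 0 *: letter 1 0 + ((v' m).1 0 1 *: letter 0 0 + ((v' m).1 0 2 *:
  letter 2 0 + (0, (v' m).2))).
  case: (v' m) => x f; congr pair; last by rewrite /= !scaler0 !add0r.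
  by apply: heisP; rewrite !mxE /=; ring.
rewrite !(evr_upd_linear Pu) //= (IH _ 1%N) // (IH _ 0%N) // (IH _ 2%N) // (IH _ 3%N) //.
by rewrite !scaler0 !addr0.
Qed.

End Detect.

Section Injective.
Variables (F : fieldType) (char0 : [pchar F] =i pred0).
Local Notation V := (V3tilde F).
Local Notation L := (Htilde F).

Lemma navars_gt0 w : (0 < size (navars w))%N.
Proof. by elim: w => //= a IHa b _; rewrite size_cat addn_gt0 IHa. Qed.

Lemma multilinear_monom1 w : multilinear_monom 1 w -> w = NAVar 0.
Proof.
rewrite /multilinear_monom => pw; have := perm_size pw; have := perm_mem pw 0%N.
case: w {pw} => [i|w1 w2] /=; first by rewrite !inE eqxx => /eqP <-.
by move=> _; rewrite size_cat; have := navars_gt0 w1; have := navars_gt0 w2; lia.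
Qed.

Lemma multilinear_monom2 w : multilinear_monom 2 w ->
  w = NAMul (NAVar 0) (NAVar 1) \/ w = NAMul (NAVar 1) (NAVar 0).
Proof.
rewrite /multilinear_monom => pw; have := perm_size pw; move: pw.
have leaf x : size (navars x) = 1%N -> exists i, x = NAVar i by apply: navars_size1.
case: w => [i|w1 w2] //= pw sz; move: pw; rewrite size_cat in sz.
have [i ->] : exists i, w1 = NAVar i.
  by apply: leaf; have := navars_gt0 w1; have := navars_gt0 w2; lia.
have [j ->] : exists i, w2 = NAVar i.
  by apply: leaf; have := navars_gt0 w1; have := navars_gt0 w2; lia.
move=> /= pw; have := perm_mem pw 0%N; have := perm_mem pw 1%N; rewrite !inE /=.
by case: i j {pw} => [|[|i]] [|[|j]] //= _ _; [left|right].
Qed.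

(** Products of three or more factors have no component in H. For n = 1 and n = 2 the coefficients
    of u can be read off in T, at the arguments 1 and c. *)
Lemma evr_fst_eq0 n (u : relfree V) : multilinear_part V n u ->
  (0 < n)%N -> (forall v, (evr v u).2 = 0) -> forall v, (evr v u).1 = 0.
Proof.
move=> Pu n0 u2 v; have [s /allP sP uE] := multilinearE Pu.
have fst_sum (r : seq (F * namonom)) : (\sum_(p <- r) p.1 *: eval_monom v p.2).1 =
    \sum_(p <- r) p.1 *: (eval_monom v p.2).1.
  by elim/big_rec2: _ => // p y x _ <-.
case: n n0 Pu sP => [|[|[|n]]] // _ Pu sP.
- have {}uE v' : evr v' u = (\sum_(p <- s) p.1) *: v' 0%N.
    rewrite uE scaler_suml big_seq [RHS]big_seq; apply: eq_bigr => p /sP.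
    by move/multilinear_monom1 => ->.
  have := u2 (fun=> (0, 1)); rewrite uE /= alg_polyC => /eqP; rewrite polyC_eq0 => /eqP c0.
  by rewrite uE c0 scale0r.
- have [a [b {}uE]] : exists a b, forall v', evr v' u = a *: (v' 0%N ** v' 1%N) + b *: (v' 1%N **
    v' 0%N).
    exists (\sum_(p <- s) (p.2 == NAMul (NAVar 0) (NAVar 1))%:R * p.1).
    exists (\sum_(p <- s) (p.2 == NAMul (NAVar 1) (NAVar 0))%:R * p.1) => v'.
    rewrite uE !scaler_suml -big_split big_seq [RHS]big_seq; apply: eq_bigr => p /sP.
    have ne : (NAMul (NAVar 0) (NAVar 1) == NAMul (NAVar 1) (NAVar 0)) = false by apply/eqP.
    by move/multilinear_monom2 => [] ->;
      rewrite eqxx ?(eq_sym _ (NAMul (NAVar 0) _)) ne !(mul1r, mul0r) scale0r /= ?addr0 ?add0r.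
  pose f : L := (0, 1); pose c : L := (delta_mx 0 2, 0).
  have fc : (f ** c).2 = 1.
    by rewrite /namul /= /heis_act !mxE /= !scale0r scale1r !add0r.
  have cf : (c ** f).2 = 0 by rewrite /namul /= /heis_act !mxE !scale0r !add0r.
  have := u2 (fun i => if i == 0%N then f else c);
    rewrite uE eqxx [_ == _]/= -[LHS]/(a *: (f ** c).2 + b *: (c ** f).2) fc cf scaler0 addr0
      alg_polyC.
  move=> /eqP; rewrite polyC_eq0 => /eqP a0.
  have := u2 (fun i => if i == 0%N then c else f);
    rewrite uE eqxx [_ == _]/= -[LHS]/(a *: (c ** f).2 + b *: (f ** c).2) fc cf scaler0 add0r
      alg_polyC.
  by move=> /eqP; rewrite polyC_eq0 => /eqP b0; rewrite uE a0 b0 !scale0r addr0.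
- rewrite uE fst_sum big_seq big1 // => p /sP mp.
  by rewrite eval_heis0 ?scaler0 // (perm_size mp) size_iota.
Qed.

Lemma motzkin_detect n (u : relfree V) : multilinear_part V n u -> (0 < n)%N ->
  {in motzkin_words 1 n 0, forall w, (word_value u w)`_0 = 0} -> u = 0.
Proof.
move=> Pu n0 G0; have u2 v : (evr v u).2 = 0 by exact: (evr_snd_eq0 char0 Pu G0).
have u1 v : (evr v u).1 = 0 by exact: evr_fst_eq0 Pu n0 u2 v.
by apply: evr_eq0 => v; rewrite [LHS]surjective_pairing u1 u2.
Qed.

End Injective.

(** * Highest weight vectors *)

Section Columns.
Variables (F : fieldType) (A : naAlgType F).
Implicit Types (v : nat -> A) (X : A) (ps : seq nat).

(* Right multiplication by the standard polynomial of a column of variables    *)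
(* (up to a factor): on T it is the action of a letter, a scalar commutator or *)
(* a scalar 3 x 3 determinant. In [col_start] the variable acted upon belongs  *)
(* to the column too.                                                          *)
Definition col_mul v ps X : A :=
  match ps with
  | [:: p] => X ** v p
  | [:: p; q] => X ** (v p ** v q)
  | [:: p; q; r] => X ** (v p ** v q) ** v r + X ** (v q ** v r) ** v p + X ** (v r ** v p) ** v q
  | _ => X
  end.

Definition col_start v ps : A :=
  match ps with
  | [:: p] => v p
  | [:: p; q] => v p ** v q - v q ** v p
  | [:: p; q; r] => v p ** (v q ** v r) - v q ** (v p ** v r) + v r ** (v p ** v q)
  | [:: p; q; r; s] => col_mul v [:: q; r; s] (v p) - col_mul v [:: p; r; s] (v q)
      + col_mul v [:: p; q; s] (v r) - col_mul v [:: p; q; r] (v s)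
  | _ => 0
  end.

Definition col_prod v ps0 pss := foldl (fun X ps => col_mul v ps X) (col_start v ps0) pss.
End Columns.

Section Morphism.
Variables (F : fieldType) (A B : naAlgType F) (f : A -> B).
Hypotheses (fB : {morph f : X Y / X - Y}) (fM : {morph f : X Y / X ** Y}).
Variable g : nat -> A.
Local Notation fg := (fun i => f (g i)).

Lemma morph0 : f 0 = 0.
Proof. by rewrite -[X in f X](subrr (0 : A)) fB subrr. Qed.

Lemma morphD X Y : f (X + Y) = f X + f Y.
Proof.
have -> : X + Y = X - (0 - Y) by rewrite sub0r opprK.
by rewrite !fB morph0 sub0r opprK.
Qed.

Lemma col_mul_morph ps X : f (col_mul g ps X) = col_mul fg ps (f X).
Proof. by case: ps => [|p [|q [|r [|s ps]]]] //; rewrite /col_mul ?morphD !fM. Qed.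

Lemma col_start_morph ps : f (col_start g ps) = col_start fg ps.
Proof.
by case: ps => [|p [|q [|r [|s [|k ps]]]]];
  rewrite /col_start ?(fB, morphD) ?fM ?col_mul_morph ?morph0.
Qed.

Lemma col_prod_morph ps0 pss : f (col_prod g ps0 pss) = col_prod fg ps0 pss.
Proof.
rewrite /col_prod -col_start_morph; elim: pss (col_start g ps0) => //= ps pss IH X.
by rewrite IH col_mul_morph.
Qed.
End Morphism.

Section Eval.
Variable (F : fieldType).
Local Notation V := (V3tilde F).
Local Notation L := (Htilde F).
Local Notation gen := (relfree_gen V).
Implicit Types (v : nat -> L) (ps : seq nat).

Lemma evr_col_prod v ps0 pss : evr v (col_prod gen ps0 pss) = col_prod v ps0 pss.
Proof.
have e : (fun i => evr v (gen i)) = v by apply: funext => i; exact: evr_gen.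
rewrite -[in RHS]e; apply: col_prod_morph; last exact: evrM.
exact: linearB.
Qed.

(** Multilinearity in an arbitrary list of variables, so that products can be built column by
    column. *)
Definition mlin (s : seq nat) (u : relfree V) := exists2 t : seq (F * namonom),
  all (fun p => perm_eq (navars p.2) s) t &
  u = \sum_(p <- t) p.1 *: eval_monom gen p.2.

Lemma mlin_perm s s' u : perm_eq s s' -> mlin s u -> mlin s' u.
Proof.
move=> ss [t /allP tP ->]; exists t => //; apply/allP => p /tP ps; exact: perm_trans ss.
Qed.

Lemma mlin_gen i : mlin [:: i] (gen i).
Proof. by exists [:: (1, NAVar i)]; rewrite /= ?perm_refl // big_seq1 scale1r. Qed.

Lemma mlinD s u u' : mlin s u -> mlin s u' -> mlin s (u + u').
Proof.
by move=> [t tP ->] [t' tP' ->]; exists (t ++ t'); rewrite ?all_cat ?tP ?big_cat.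
Qed.

Lemma mlinZ s c u : mlin s u -> mlin s (c *: u).
Proof.
move=> [t tP ->]; exists [seq (c * p.1, p.2) | p <- t]; first by rewrite all_map.
by rewrite big_map scaler_sumr; apply: eq_bigr => p _; rewrite scalerA.
Qed.

Lemma mlinN s u : mlin s u -> mlin s (- u).
Proof. by rewrite -scaleN1r; exact: mlinZ. Qed.

Lemma mlin0 s : mlin s 0.
Proof. by exists [::]; rewrite ?big_nil. Qed.

Lemma mlinM s s' u u' : mlin s u -> mlin s' u' -> mlin (s ++ s') (u ** u').
Proof.
move=> [t /allP tP ->] [t' /allP tP' ->].
exists [seq (p.1 * p'.1, NAMul p.2 p'.2) | p <- t, p' <- t'].
  by apply/allP => _ /allpairsP[[p p'] /= [/tP pt /tP' pt' ->]] /=; exact: perm_cat.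
rewrite big_allpairs_dep /= namul_suml; apply: eq_bigr => p _; rewrite namul_sumr.
by apply: eq_bigr => p' _; rewrite namulZl namulZr scalerA.
Qed.

Lemma mlin_col_mul s ps X : (0 < size ps <= 3)%N -> mlin s X -> mlin (s ++ ps) (col_mul gen ps X).
Proof.
move=> szps sX; have G := mlin_gen; have G2 a b := mlinM (G a) (G b).
have G3 a b c := mlinM (mlinM sX (G2 a b)) (G c).
case: ps szps => [|p [|q [|r [|k ps]]]] //= _.
- exact: mlinM sX (G p).
- exact: mlinM sX (G2 p q).
- apply: mlinD; first apply: mlinD; [apply: mlin_perm (G3 p q r)|apply: mlin_perm (G3 q r p)|
    apply: mlin_perm (G3 r p q)]; rewrite -catA perm_cat2l //; apply/seq.permP => a /=; lia.
Qed.

Lemma mlin_col_start ps : (0 < size ps <= 4)%N -> mlin ps (col_start gen ps).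
Proof.
move=> szps; have G := mlin_gen.
case: ps szps => [|p [|q [|r [|k [|m ps]]]]] // _.
- apply: mlinD; first exact: (mlinM (G p) (G q)).
  by apply: mlinN; apply: mlin_perm (mlinM (G q) (G p)); rewrite (perm_catC [:: q] [:: p]).
- apply: mlinD; [apply: mlinD; last apply: mlinN|].
  + exact: (mlinM (G p) (mlinM (G q) (G r))).
  + by apply: mlin_perm (mlinM (G q) (mlinM (G p) (G r))); apply/seq.permP => a /=; lia.
  + by apply: mlin_perm (mlinM (G r) (mlinM (G p) (G q))); apply/seq.permP => a /=; lia.
- apply: mlinD; [apply: mlinD; [apply: mlinD; last apply: mlinN|]|apply: mlinN].
  + exact: (@mlin_col_mul [:: p] [:: q; r; k]).
  + by apply: mlin_perm (@mlin_col_mul [:: q] [:: p; r; k] _ _ (G q)) => //;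
      apply/seq.permP => a /=; lia.
  + by apply: mlin_perm (@mlin_col_mul [:: r] [:: p; q; k] _ _ (G r)) => //;
      apply/seq.permP => a /=; lia.
  + by apply: mlin_perm (@mlin_col_mul [:: k] [:: p; q; r] _ _ (G k)) => //;
      apply/seq.permP => a /=; lia.
Qed.

Lemma mlin_col_prod ps0 pss : (0 < size ps0 <= 4)%N ->
  all (fun ps => 0 < size ps <= 3)%N pss ->
  mlin (ps0 ++ flatten pss) (col_prod gen ps0 pss).
Proof.
move=> sz0; rewrite /col_prod; move/mlin_col_start: sz0.
elim: pss ps0 (col_start gen ps0) => [|ps pss IH] s X sX /=; first by rewrite cats0.
by move=> /andP[szps szs]; rewrite catA; apply: IH => //; exact: mlin_col_mul.
Qed.

Lemma mlin_multilinear n u : mlin (iota 0 n) u -> multilinear_part V n u.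
Proof. by []. Qed.

Implicit Types (x : nat -> heis F) (f : {poly F}).

(** The coefficient of c in the product of h and k; [det3] is the determinant of the coordinates
    with respect to b, a, c. *)
Definition omega (h k : heis F) : F := h 0 1 * k 0 0 - h 0 0 * k 0 1.
Definition det3 (h k m : heis F) : F := omega h k * m 0 2 + omega k m * h 0 2 + omega m h * k 0 2.

Definition colT x ps f : {poly F} :=
  match ps with
  | [:: p] => heis_act f (x p)
  | [:: p; q] => omega (x p) (x q) *: f
  | [:: p; q; r] => det3 (x p) (x q) (x r) *: f
  | _ => f
  end.

Definition startT v ps : {poly F} :=
  let x := fun p => (v p).1 in let f := fun p => (v p).2 in
  match ps with
  | [:: p] => f p
  | [:: p; q] => heis_act (f p) (x q) - heis_act (f q) (x p)
  | [:: p; q; r] => omega (x q) (x r) *: f p - omega (x p) (x r) *: f q + omega (x p) (x q) *: f r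
  | [:: p; q; r; s] => det3 (x q) (x r) (x s) *: f p - det3 (x p) (x r) (x s) *: f q
      + det3 (x p) (x q) (x s) *: f r - det3 (x p) (x q) (x r) *: f s
  | _ => 0
  end.

Lemma heis_act_mul f h k : heis_act f (heis_mul h k) = omega h k *: f.
Proof. by rewrite /heis_act /heis_mul !mxE /= !mulr0 !scale0r !add0r mulr1. Qed.

(** For three variables the coefficients of f' and t f in the cyclic sum are determinants with a
    repeated column, so only the c-coordinates survive. *)
Lemma snd_col_mul v ps (X : L) : (col_mul v ps X).2 = colT (fun p => (v p).1) ps X.2.
Proof.
case: ps => [|p [|q [|r [|s ps]]]] //=; first by rewrite /namul /= heis_act_mul.
rewrite /namul /= !heis_act_mul /heis_act /det3 /omega.
move: (v p).1 (v q).1 (v r).1 => a b c; rewrite !derivZ -!mul_polyC !(polyCD, polyCM, polyCB); ring.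
Qed.

Lemma snd_col_start v ps : (col_start v ps).2 = startT v ps.
Proof.
case: ps => [|p [|q [|r [|s [|k ps]]]]] //; first by rewrite /= /namul /= !heis_act_mul.
rewrite -[LHS]/((col_mul v [:: q; r; s] (v p)).2 - (col_mul v [:: p; r; s] (v q)).2
      + (col_mul v [:: p; q; s] (v r)).2 - (col_mul v [:: p; q; r] (v s)).2).
by rewrite !snd_col_mul.
Qed.

Lemma snd_col_prod v ps0 pss :
  (col_prod v ps0 pss).2 = foldl (fun f ps => colT (fun p => (v p).1) ps f) (startT v ps0) pss.
Proof.
rewrite /col_prod -snd_col_start; elim: pss (col_start v ps0) => //= ps pss IH X.
by rewrite IH snd_col_mul.
Qed.

Definition swap (p q i : nat) := if i == p then q else if i == q then p else i.

Lemma colTN x ps f : colT x ps (- f) = - colT x ps f.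
Proof.
case: ps => [|p [|q [|r [|s ps]]]] //=; rewrite ?scalerN //.
by rewrite /heis_act derivN -!mul_polyC; ring.
Qed.

Lemma swapC p q i : swap p q i = swap q p i.
Proof. by rewrite /swap; case: eqP => [->|]; case: eqP. Qed.

Lemma colT_swap x ps f p q : uniq ps -> (size ps <= 3)%N -> p \in ps -> q \in ps -> p != q ->
  colT (x \o swap p q) ps f = - colT x ps f.
Proof.
have s1 a b : swap a b a = b by rewrite /swap eqxx.
have s2 a b : swap a b b = a by rewrite swapC s1.
have s3 a b c : c != a -> c != b -> swap a b c = c by rewrite /swap => /negPf -> /negPf ->.
case: ps => [|a [|b [|c [|d ps]]]] //=; rewrite ?inE.
- by move=> _ _ /eqP -> /eqP ->; rewrite eqxx.
- rewrite andbT => ab _ /orP[]/eqP-> /orP[]/eqP->; rewrite ?eqxx // => _.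
    by rewrite s1 s2 /omega -scaleNr; congr (_ *: _); ring.
  by rewrite s1 s2 /omega -scaleNr; congr (_ *: _); ring.
- rewrite andbT negb_or => /andP[/andP[ab ac] bc] _.
  have sy (i j : nat) : i != j -> j != i by rewrite eq_sym.
  have [ba ca cb] := And3 (sy _ _ ab) (sy _ _ ac) (sy _ _ bc).
  move=> /or3P[]/eqP-> /or3P[]/eqP->; rewrite ?eqxx // => _;
  by rewrite s1 s2 s3 // /det3 /omega -scaleNr; congr (_ *: _); ring.
Qed.

Lemma startT_swap v ps p q : uniq ps -> (size ps <= 4)%N -> p \in ps -> q \in ps -> p != q ->
  startT (v \o swap p q) ps = - startT v ps.
Proof.
have s1 a b : swap a b a = b by rewrite /swap eqxx.
have s2 a b : swap a b b = a by rewrite swapC s1.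
have s3 a b c : c != a -> c != b -> swap a b c = c by rewrite /swap => /negPf -> /negPf ->.
case: ps => [|a [|b [|c [|d [|e ps]]]]] //=; rewrite ?inE.
- by move=> _ _ /eqP -> /eqP ->; rewrite eqxx.
- rewrite andbT => ab _ /orP[]/eqP-> /orP[]/eqP->; rewrite ?eqxx // => _.
    by rewrite s1 s2 opprB.
  by rewrite s1 s2 opprB.
- rewrite andbT negb_or => /andP[/andP[ab ac] bc] _.
  have sy (i j : nat) : i != j -> j != i by rewrite eq_sym.
  have [ba ca cb] := And3 (sy _ _ ab) (sy _ _ ac) (sy _ _ bc).
  move=> /or3P[]/eqP-> /or3P[]/eqP->; rewrite ?eqxx // => _;
  by rewrite s1 s2 s3 // /omega -!mul_polyC !(polyCB, polyCM); ring.
- rewrite andbT !negb_or => /and3P[/and3P[ab ac ad] /andP[bc bd] cd] _.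
  have sy (i j : nat) : i != j -> j != i by rewrite eq_sym.
  have [[ba ca da] [cb db dc]] := (And3 (sy _ _ ab) (sy _ _ ac) (sy _ _ ad), And3 (sy _ _ bc) (sy
    _ _ bd) (sy _ _ cd)).
  move=> /or4P[]/eqP-> /or4P[]/eqP->; rewrite ?eqxx // => _;
  by rewrite s1 s2 !s3 // /det3 /omega -!mul_polyC !(polyCD, polyCB, polyCM); ring.
Qed.

End Eval.

Local Close Scope na_scope.
Local Close Scope ring_scope.

(** * Columns of a diagram and removable boxes *)

Section Shape.
Variables (n : nat) (l : intpart n).

Definition column j : seq nat := [seq flatten_index l r j | r <- iota 0 4 & j < nth 0 l r].

Lemma columnP j p : p \in column j -> exists2 i : 'I_n, p = i & cold l i = j.
Proof.
case/mapP => r; rewrite mem_filter => /andP[jr _] ->.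
by exists (box jr); rewrite ?col_box.
Qed.

Lemma mem_column (i : 'I_n) j : nth 0 l 4 = 0 -> ((i : nat) \in column j) = (cold l i == j).
Proof.
move=> l4; apply/idP/eqP => [/columnP[k /val_inj <-] //|<-].
apply/mapP; exists (rowd l i); last by rewrite /rowd /cold reshape_indexK.
rewrite mem_filter cold_lt mem_iota /=; rewrite ltnNge; apply/negP => r4.
by have := leq_trans (cold_lt l i) (nth_parts_le l r4); rewrite l4.
Qed.

Lemma uniq_column j : uniq (column j).
Proof.
rewrite map_inj_in_uniq ?filter_uniq ?iota_uniq // => r r'; rewrite !mem_filter.
move=> /andP[jr _] /andP[jr' _] e.
by rewrite -(flatten_indexKl jr) e flatten_indexKl.
Qed.


Lemma sum_ltn m k : k <= m -> \sum_(j < m) (j < k) = k.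
Proof.
elim: m k => [|m IHm] k km; first by rewrite big_ord0; lia.
rewrite big_ord_recr /=; case: (ltnP m k) => [mk|mk]; last by rewrite IHm //= addn0.
have -> : k = m.+1 by lia.
rewrite /= (eq_bigr (fun=> 1)) => [|j _]; first by rewrite sum1_card card_ord addn1.
by rewrite ltnS ltnW.
Qed.

Lemma perm_columns : nth 0 l 4 = 0 ->
  perm_eq (flatten [seq column j | j <- iota 0 (nth 0 l 0)]) (iota 0 n).
Proof.
move=> l4; set fl := flatten _.
have sub : {subset iota 0 n <= fl}.
  move=> i; rewrite mem_iota add0n => /andP[_ lt_in]; apply/flattenP.
  pose k := Ordinal lt_in; exists (column (cold l k)).
    apply: map_f; rewrite mem_iota add0n; apply: leq_trans (cold_lt l k) _.
    exact: nth_parts_le.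
  by rewrite -[i]/(nat_of_ord k) mem_column.
have szl : size l <= 4.
  rewrite leqNgt; apply/negP => gt4; have := mem_nth 0 gt4; rewrite l4.
  by apply/negP; exact: parts_gt0.
have n4 : n = \sum_(r < 4) nth 0 l r.
  rewrite -[LHS](sumn_parts l) sumnE (big_nth 0) big_mkord.
  rewrite (big_ord_widen 4 (fun r => nth 0 l r) szl) big_mkcond; apply: eq_bigr => r _.
  by case: ltnP => // /(nth_default 0) ->.
have sz : size fl = n.
  rewrite size_flatten /shape -map_comp sumnE big_map -{1}[nth 0 l 0]subn0 -/(index_iota 0 (nth 0
    l 0)) big_mkord.
  have -> : \sum_(j < nth 0 l 0) size (column j) = \sum_(j < nth 0 l 0) \sum_(r < 4) (j < nth 0 l
    r).
    apply: eq_bigr => j _ /=; rewrite size_map size_filter -sum1_count big_mkcond /=.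
    by rewrite !big_ord_recl big_ord0 /= !big_cons big_nil.
  rewrite exchange_big [RHS]n4; apply: eq_bigr => r _.
  exact: sum_ltn (nth_parts_le l (leq0n (nat_of_ord r))).
rewrite perm_sym; apply: uniq_perm; rewrite ?iota_uniq //.
  by apply: leq_size_uniq sub _; rewrite ?iota_uniq ?size_iota ?sz.
by apply: (uniq_min_size (iota_uniq 0 n) sub _).2; rewrite size_iota sz.
Qed.

(** The column ending in the corner of row h; columns are numbered from 0. *)
Definition main_column h := column (nth 0 l h).-1.
Definition other_columns h := [seq column j | j <- rem (nth 0 l h).-1 (iota 0 (nth 0 l 0))].

Section Corner.
Variables (h : nat) (h4 : h < 4) (hP : corner l h).

Lemma corner_nth4 : nth 0 l 4 = 0.
Proof. by case/and3P: hP => _ _ /eqP. Qed.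

Lemma corner_gt0 : 0 < nth 0 l h.
Proof. by case/and3P: hP => lt _ _; exact: leq_ltn_trans lt. Qed.

Lemma main_columnE : main_column h = [seq flatten_index l r (nth 0 l h).-1 | r <- iota 0 h.+1].
Proof.
rewrite /main_column /column; congr map.
have -> : iota 0 4 = iota 0 h.+1 ++ iota h.+1 (4 - h.+1) by rewrite -iotaD subnKC.
rewrite filter_cat; have -> : [seq r <- iota 0 h.+1 | (nth 0 l h).-1 < nth 0 l r] = iota 0 h.+1.
  apply/all_filterP/allP => r; rewrite mem_iota add0n ltnS => /andP[_ rh].
  by rewrite prednK ?corner_gt0 // nth_parts_le.
rewrite -[RHS]cats0; congr cat; apply/eqP; rewrite -size_eq0 size_filter eqn0Ngt -has_count.
apply/hasPn => r; rewrite mem_iota => /andP[hr _]; rewrite -leqNgt -ltnS prednK ?corner_gt0 //.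
by case/and3P: hP => lt _ _; apply: leq_ltn_trans lt; exact: nth_parts_le.
Qed.

(** A column with four boxes exists only for h = 3; as the fourth row then has length 1, it is
    column 0, which is the main one. *)
Lemma other_columnsP ps : ps \in other_columns h -> exists2 j, ps = column j &
  (j != (nth 0 l h).-1) && (0 < size ps <= 3).
Proof.
case/mapP => j; rewrite mem_rem_uniq ?iota_uniq // inE mem_iota add0n => /and3P[jh _ jl ->].
exists j => //; rewrite jh /= size_map size_filter; apply/andP; split.
  by rewrite -has_count; apply/hasP; exists 0; rewrite ?mem_iota.
rewrite -ltnS ltn_neqAle -{2}(size_iota 0 4) count_size andbT; apply/negP => /eqP e.
have : all (fun r => j < nth 0 l r) (iota 0 4) by rewrite all_count e size_iota.
rewrite /= andbT => /and4P[_ _ _ j3]; case/and3P: hP => _ /eqP l3 _.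
rewrite l3 in j3; case: (eqVneq h 3) jh j3 l3 => [->|_] jh j3 l3; last by rewrite ltn0 in j3.
by move: jh; rewrite l3 /=; move: j3; case: (j).
Qed.

Lemma perm_corner_columns : perm_eq (main_column h ++ flatten (other_columns h)) (iota 0 n).
Proof.
apply: perm_trans (perm_columns corner_nth4).
rewrite -[main_column h ++ _]/(flatten (column (nth 0 l h).-1 :: other_columns h)).
rewrite -[_ :: _]/[seq column j | j <- (nth 0 l h).-1 :: rem (nth 0 l h).-1 (iota 0 (nth 0 l 0))].
apply: perm_flatten; apply: perm_map; rewrite perm_sym; apply: perm_to_rem.
rewrite mem_iota add0n; apply: leq_trans (nth_parts_le l (leq0n h)).
by rewrite prednK ?corner_gt0.
Qed.

End Corner.
End Shape.

Local Open Scope ring_scope.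
Local Open Scope na_scope.

Lemma perm_var_ord n (q : 'S_n) (i : 'I_n) : perm_var q i = q i.
Proof. by rewrite /perm_var insubT ?ltn_ord // => ltin; congr (nat_of_ord (q _));
  apply: val_inj. Qed.

Lemma perm_varM n (q q' : 'S_n) : perm_var (q * q')%g = perm_var q' \o perm_var q.
Proof.
apply: funext => i /=; case: (ltnP i n) => [ltin|leni].
  by rewrite -[i]/(nat_of_ord (Ordinal ltin)) !perm_var_ord permM.
by rewrite {1 3}/perm_var insubF ?ltnNge ?leni //= /perm_var insubF ?ltnNge ?leni.
Qed.

Lemma perm_var_tperm n (i j : 'I_n) : perm_var (tperm i j) = swap i j.
Proof.
apply: funext => k; rewrite /swap; case: (ltnP k n) => [ltkn|lenk].
  rewrite -[k]/(nat_of_ord (Ordinal ltkn)) perm_var_ord.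
  case: tpermP => [->|->|/eqP ki /eqP kj]; rewrite ?eqxx //.
    by case: eqP => // ->.
  by rewrite -!val_eqE /= in ki kj; rewrite (negPf ki) (negPf kj).
rewrite /perm_var insubF ?ltnNge ?lenk //.
by rewrite !gtn_eqF //; apply: leq_trans lenk.
Qed.

(** * Independence of the vectors attached to one diagram *)

Section HighestWeight.
Variables (F : fieldType) (char0 : [pchar F] =i pred0).
Local Notation V := (V3tilde F).
Local Notation L := (Htilde F).
Local Notation gen := (relfree_gen V).
Variables (n : nat) (l : intpart n).

Definition hw h : relfree V := col_prod gen (main_column l h) (other_columns l h).

Lemma colT_ext (x y : nat -> heis F) ps f : {in ps, x =1 y} -> colT x ps f = colT y ps f.
Proof.
case: ps => [|p [|q [|r [|s ps]]]] xy //=; rewrite !xy // !inE ?eqxx ?orbT //.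
Qed.

Lemma startT_ext (v v' : nat -> L) ps : {in ps, v =1 v'} -> startT v ps = startT v' ps.
Proof.
case: ps => [|p [|q [|r [|s [|k ps]]]]] vv //=; rewrite !vv // !inE ?eqxx ?orbT //.
Qed.

Lemma startT_map (v : nat -> L) (g : nat -> nat) ps : startT v (map g ps) = startT (v \o g) ps.
Proof. by case: ps => [|p [|q [|r [|s [|k ps]]]]]. Qed.
Lemma colT_map (x : nat -> heis F) (g : nat -> nat) ps f : colT x (map g ps) f = colT (x \o g) ps f.
Proof. by case: ps => [|p [|q [|r [|s ps]]]]. Qed.

Section Corner.
Variables (h : nat) (h4 : (h < 4)%N) (hP : corner l h).

Lemma size_main_column : size (main_column l h) = h.+1.
Proof. by rewrite main_columnE // size_map size_iota. Qed.

Lemma hw_multilinear : multilinear_part V n (hw h).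
Proof.
apply: mlin_multilinear; apply: mlin_perm (perm_corner_columns hP) _.
apply: mlin_col_prod; first by rewrite size_main_column.
by apply/allP => ps /(other_columnsP hP)[j _ /andP[]].
Qed.

Definition hwT (v : nat -> L) : {poly F} :=
  foldl (fun f ps => colT (fun p => (v p).1) ps f) (startT v (main_column l h)) (other_columns l h).

Lemma hwTE v : (evr v (hw h)).2 = hwT v.
Proof. by rewrite evr_col_prod snd_col_prod. Qed.

Lemma foldl_colT0 (x : nat -> heis F) pss : foldl (fun f ps => colT x ps f) 0 pss = 0.
Proof.
elim: pss => //= ps pss IH; rewrite (_ : colT x ps 0 = 0) //.
case: ps => [|p [|q [|r [|s ps]]]] //=; rewrite ?scaler0 //.
by rewrite /heis_act deriv0 mulr0 !scaler0 !addr0.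
Qed.

Lemma foldl_colTN (x : nat -> heis F) pss f :
  foldl (fun f ps => colT x ps f) (- f) pss = - foldl (fun f ps => colT x ps f) f pss.
Proof. by elim: pss f => //= ps pss IH f; rewrite colTN IH. Qed.

Lemma swap_other (i j : 'I_n) c p : cold l i = cold l j -> p \in column l c -> cold l i != c ->
  swap i j p = p.
Proof.
move=> cij /columnP[k -> ck] ci; rewrite /swap.
have -> : ((k : nat) == i) = false by apply/negP => /eqP/val_inj e; case/eqP: ci; rewrite -e.
have -> // : ((k : nat) == j) = false by apply/negP => /eqP/val_inj e; case/eqP: ci; rewrite cij -e.
Qed.

Lemma foldl_swap (i j : 'I_n) (x : nat -> heis F) js f : nth 0%N l 4 = 0%N -> i != j ->
  cold l i = cold l j -> uniq js -> {in js, forall c, (size (column l c) <= 3)%N} ->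
  foldl (fun f ps => colT (x \o swap i j) ps f) f [seq column l c | c <- js] =
  (-1) ^+ (cold l i \in js) *: foldl (fun f ps => colT x ps f) f [seq column l c | c <- js].
Proof.
move=> l4 ij cij; elim: js f => [|c js IH] f /=; first by rewrite scale1r.
move=> /andP[cjs ujs] szs; have {}szs : {in js, forall c', (size (column l c') <= 3)%N} /\ (size
  (column l c) <= 3)%N.
  by split=> [c' c'js|]; apply: szs; rewrite inE ?eqxx ?c'js ?orbT.
rewrite inE; case: (eqVneq (cold l i) c) => [ic|ic] /=.
  rewrite (@colT_swap F x (column l c) f i j) ?uniq_column ?szs.2 //.
  - have /negPf njs : cold l i \notin js by rewrite ic.
    by rewrite foldl_colTN (IH _ ujs szs.1) njs scale1r expr1 scaleN1r.
  - by rewrite mem_column ?ic.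
  - by rewrite mem_column -?cij ?ic.
rewrite (colT_ext (y := x)); first exact: IH ujs szs.1.
by move=> p pc /=; rewrite (swap_other cij pc ic).
Qed.

(** Exactly one factor involves the column of i and j, and that factor is alternating. *)
Lemma hwT_swap (i j : 'I_n) v : i != j -> cold l i = cold l j ->
  hwT (v \o swap i j) = - hwT v.
Proof.
move=> ij cij; have l4 := corner_nth4 hP; pose c0 := (nth 0%N l h).-1.
have szs : {in rem c0 (iota 0 (nth 0%N l 0)), forall c, (size (column l c) <= 3)%N}.
  move=> c cr; have : column l c \in other_columns l h by apply: map_f.
  by move=> /(other_columnsP hP)[_ _ /andP[_ /andP[]]].
rewrite /hwT /other_columns (foldl_swap (fun p => (v p).1)) ?rem_uniq ?iota_uniq //.
have cl : (cold l i < nth 0%N l 0)%N by apply: leq_trans (cold_lt l i) (nth_parts_le l (leq0n _)).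
rewrite mem_rem_uniq ?iota_uniq // inE mem_iota add0n leq0n cl andbT /=.
case: (eqVneq (cold l i) c0) => [ic|ic] /=.
  rewrite scale1r (@startT_swap F v (main_column l h) i j) ?foldl_colTN //.
  - exact: uniq_column.
  - by rewrite size_main_column.
  - by rewrite mem_column // ic.
  - by rewrite mem_column // -cij ic.
rewrite (startT_ext (v' := v)) ?expr1 ?scaleN1r // => p pc /=.
by rewrite (swap_other cij pc ic).
Qed.

Lemma hwT_col_stab (t : 'S_n) v : t \in col_stab n l -> hwT (v \o perm_var t) = (-1) ^+ t *: hwT v.
Proof.
have [m] := ubnP #|[set i | t i != i]|; elim: m t v => // m IHm t v; rewrite ltnS => tm tC.
case: (pickP (fun i => t i != i)) => [i ti|t1]; last first.
  have -> : t = 1%g by apply/permP=> i; rewrite perm1; apply/eqP; have := t1 i; case: eqP.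
  rewrite odd_perm1 scale1r; congr hwT; apply: funext => k /=; congr v.
  case: (ltnP k n) => [ltkn|lenk]; last by rewrite /perm_var insubF // ltnNge lenk.
  by rewrite -[k]/(nat_of_ord (Ordinal ltkn)) perm_var_ord perm1.
pose t' := (t * tperm i (t i))%g.
have et : t = (t' * tperm i (t i))%g by rewrite /t' -mulgA tperm2 mulg1.
have ct : cold l i = cold l (t i) by move/col_stabP: (tC) => ->.
have t'C : t' \in col_stab n l by rewrite /t' col_stabMr ?col_stab_tperm.
have lt_t' : (#|[set i | t' i != i]| < m)%N.
  apply: leq_trans tm; apply: proper_card; apply/properP; split.
    apply/subsetP => k; rewrite !inE; apply: contraNN => /eqP tk.
    have ki : i != k by apply: contraNneq ti => ->; rewrite tk.
    have kti : t i != k by apply: contraNneq ti => e; apply/eqP/(@perm_inj _ t); rewrite e.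
    by rewrite permM tk tpermD.
  by exists i; rewrite !inE // permM tpermR eqxx.
have -> : v \o perm_var t = (v \o perm_var (tperm i (t i))) \o perm_var t'.
  by rewrite {1}et perm_varM.
rewrite (IHm _ _ lt_t' t'C) perm_var_tperm hwT_swap // 1?eq_sym // [in RHS]et odd_permM odd_tperm.
by rewrite eq_sym ti signr_addb expr1 mulrN1 scaleNr scalerN.
Qed.

End Corner.

(** The Young symmetrizer of l applied to [hw h]. *)
Definition hwy h : relfree V := \sum_(s in row_stab n l) \sum_(t in col_stab n l)
  (-1) ^+ t *: perm_vars V (t * s)%g (hw h).

(* Rows 0, 1, 2 of the diagram are evaluated at b, a, c, and row [k] also at 1 *)
(* in T: then b and a have commutator 1, the determinant of b, a, c is 1, and  *)
(* only the corners in rows >= k survive.                                      *)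
Definition zrow k r : L := (nth 0 [:: delta_mx 0 1; delta_mx 0 0; delta_mx 0 2] r, (r == k)%:R).
Definition zval k := zrow k \o reshape_index l.

(** [zval k] is constant on rows, so s has no effect, and the sign of t cancels against
    [hwT_col_stab]: all terms are equal. *)
Lemma hwy_zval h k : (h < 4)%N -> corner l h ->
  (evr (zval k) (hwy h)).2 = (#|row_stab n l| * #|col_stab n l|)%:R *: hwT h (zval k).
Proof.
move=> h4 hP; rewrite natrM.
have -> : #|row_stab n l|%:R * #|col_stab n l|%:R *: hwT h (zval k) =
  \sum_(s in row_stab n l) \sum_(t in col_stab n l) hwT h (zval k).
  by rewrite sumr_const sumr_const -!scaler_nat scalerA.
rewrite [evr _ _](linear_sum (evr (zval k))) snd_sum /=; apply: eq_bigr => s sR.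
rewrite [evr _ _](linear_sum (evr (zval k))) snd_sum /=; apply: eq_bigr => t tC.
rewrite [evr _ _](linearZ_LR (evr (zval k))) /= evr_perm.
have -> : evr (zval k \o perm_var (t * s)%g) (hw h) = evr (zval k \o perm_var t) (hw h).
  apply: (evr_ext (hw_multilinear h4 hP)) => i ltin /=.
  rewrite -[i]/(nat_of_ord (Ordinal ltin)) !perm_var_ord permM /zval /=; congr zrow.
  by move/row_stabP: sR => /(_ (t (Ordinal ltin))).
by rewrite hwTE // hwT_col_stab // scalerA -signr_addb addbb scale1r.
Qed.

Lemma startT_zval h k : (h < 4)%N -> corner l h ->
  startT (zval k) (main_column l h) = startT (zrow k) (iota 0 h.+1).
Proof.
move=> h4 hP; rewrite main_columnE // startT_map; apply: startT_ext => r.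
rewrite mem_iota add0n ltnS /zval /= => rh; rewrite flatten_indexKl //.
apply: leq_trans (nth_parts_le l rh); have := corner_gt0 hP; by case: nth => //= m; rewrite ltnS.
Qed.

(** The main column stops at row h, so none of its variables has a component in T. *)
Lemma hwT_zval0 h k : (h < k)%N -> (h < 4)%N -> corner l h -> hwT h (zval k) = 0.
Proof.
move=> hk h4 hP; rewrite /hwT startT_zval //.
have z0 r : (r <= h)%N -> (zrow k r).2 = 0 by move=> rh;
  rewrite /zrow /= ltn_eqF // (leq_ltn_trans rh).
have -> : startT (zrow k) (iota 0 h.+1) = 0; last exact: foldl_colT0.
move: (zrow k) z0 => z; case: h h4 {hP hk} => [|[|[|[|h]]]] // _ z0 /=;
  rewrite !z0 //= /heis_act ?deriv0 ?mulr0 !scaler0 ?addr0 ?subr0 //.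
Qed.

(** A column of one box multiplies by t; one of two or three boxes multiplies by 1. *)
Lemma colT_zval_neq0 k c f : (0 < size (column l c) <= 3)%N -> f != 0 ->
  colT (fun p => (zval k p).1) (column l c) f != 0.
Proof.
move=> szc f0; rewrite /column colT_map.
have -> : colT ((fun p => (zval k p).1) \o flatten_index l ^~ c) [seq r <- iota 0 4 | (c < nth 0
  l r)%N] f =
  colT (fun r => (zrow k r).1) [seq r <- iota 0 4 | (c < nth 0 l r)%N] f.
  apply: colT_ext => r; rewrite mem_filter => /andP[cr _] /=.
  by rewrite /zval /= flatten_indexKl.
move: szc; rewrite /column size_map /=.
have := nth_parts_le l (leqnSn 0); have := nth_parts_le l (leqnSn 1);
  have := nth_parts_le l (leqnSn 2).
case: (ltnP c (nth 0%N l 0)) => c0; case: (ltnP c (nth 0%N l 1)) => c1;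
  case: (ltnP c (nth 0%N l 2)) => c2; case: (ltnP c (nth 0%N l 3)) => c3 l32 l21 l10 //= _; try lia.
- rewrite /det3 /omega !mxE /= ?(mulr0, mulr1, mul0r, mul1r, addr0, add0r, subr0, sub0r) scale1r //.
- rewrite /omega !mxE /= ?(mulr0, mulr1, mul0r, mul1r, addr0, add0r, subr0, sub0r) scale1r //.
- rewrite /heis_act !mxE /= !scale0r scale1r add0r addr0 mulf_neq0 ?polyX_eq0 //.
Qed.

Lemma hwT_zval_neq0 h : (h < 4)%N -> corner l h -> hwT h (zval h) != 0.
Proof.
move=> h4 hP; rewrite /hwT startT_zval //.
have : startT (zrow h) (iota 0 h.+1) != 0.
  clear hP; case: h h4 => [|[|[|[|h]]]] // _; rewrite /= /zrow /=.
  - exact: oner_neq0.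
  - rewrite /heis_act !mxE /= deriv0 !mulr0 !scaler0 !scale0r !add0r scale1r !addr0 mulr1 oppr_eq0.
    by rewrite polyX_eq0.
  - rewrite !scaler0 subr0 add0r /omega !mxE /= mulr1 mulr0 subr0 scale1r; exact: oner_neq0.
  - rewrite !scaler0 subr0 !add0r oppr_eq0 /det3 /omega !mxE /=.
    rewrite ?(mulr0, mulr1, mul0r, mul1r, addr0, add0r, subr0, sub0r) scale1r; exact: oner_neq0.
have : {in other_columns l h, forall ps, exists2 c, ps = column l c & (0 < size ps <= 3)%N}.
  by move=> ps /(other_columnsP hP)[c -> /andP[_ szc]]; exists c.
elim: (other_columns l h) (startT _ _) => //= ps pss IH f ex f0; apply: IH.
  by move=> ps' ps'i; apply: ex; rewrite inE ps'i orbT.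
by have [|c -> szc] := ex ps; rewrite ?inE ?eqxx //; exact: colT_zval_neq0.
Qed.

Lemma hwy_free (c : 'I_4 -> F) : \sum_(h < 4 | corner l h) c h *: hwy h = 0 ->
  forall h : 'I_4, corner l h -> c h = 0.
Proof.
move=> sum0 h0 h0P; apply/eqP; apply: contraT => ch0.
have : corner l h0 && (c h0 != 0) by rewrite h0P.
(* With k the largest corner of nonzero coefficient, evaluation at [zval k] kills the smaller
   corners and isolates c k. *)
move=> /(@arg_maxnP _ h0 (fun h : 'I_4 => corner l h && (c h != 0)) (fun h => h : nat))[k
  /andP[kP ck] kmax].
have := congr1 (fun u => (evr (zval k) u).2) sum0;
  rewrite [evr _ 0](linear0 (evr (zval k))) [evr _ _](linear_sum (evr (zval k))) snd_sum (bigD1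
    k) //= big1.
  rewrite addr0 [evr _ _](linearZ_LR (evr (zval k))) /= hwy_zval // => /eqP;
    rewrite !scaler_eq0 (negPf ck) (negPf (hwT_zval_neq0 _ _)) //.
  rewrite orbF /= (proj1 (pcharf0P F) char0) muln_eq0 !cards_eq0.
  by case/orP => /eqP/setP/(_ 1%g); rewrite ?row_stab1 ?col_stab1 inE.
move=> h /andP[hP hk]; rewrite [evr _ _](linearZ_LR (evr (zval k))) /=;
  case: (ltngtP h k) => [lt|gt|/val_inj e].
- by rewrite hwy_zval // hwT_zval0 // !scaler0.
- case: (eqVneq (c h) 0) => [->|ch]; first by rewrite scale0r.
  by have := kmax h; rewrite hP ch => /(_ isT); rewrite /= leqNgt gt.
- by rewrite e eqxx in hk.
Qed.

End HighestWeight.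

Local Close Scope na_scope.

(** * The character *)

Lemma size_mem_motzkin_words k n j w : w \in motzkin_words k n j -> size w = n /\ all (gtn 4) w.
Proof.
elim: n k j w => [|n IHn] k j w /=; first by case: ifP => // _; rewrite inE => /eqP ->.
rewrite !mem_cat => /or4P[].
- by case: j => // j /mapP[u /IHn[<- ?] ->].
- by move=> /mapP[u /IHn[<- ?] ->].
- by move=> /mapP[u /IHn[<- ?] ->].
- by case: k => // k /mapP[u /IHn[<- ?] ->].
Qed.

Section Multilinear.
Variables (F : fieldType) (n : nat).
Local Notation V := (V3tilde F).
Local Notation P := (multilinear_part V n).

Lemma multilinearD u u' : P u -> P u' -> P (u + u').
Proof. exact: mlinD. Qed.
Lemma multilinearZ c u : P u -> P (c *: u).
Proof. exact: mlinZ. Qed.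
Lemma multilinear0 : P 0.
Proof. exact: mlin0. Qed.
Lemma multilinear_sum (I : Type) (r : seq I) (Q : pred I) (f : I -> relfree V) :
  (forall i, Q i -> P (f i)) -> P (\sum_(i <- r | Q i) f i).
Proof.
move=> Pf; elim/big_rec: _ => [|i u Qi Pu]; first exact: multilinear0.
by apply: multilinearD => //; exact: Pf.
Qed.

Lemma perm_varsE (q : 'S_n) w : exists2 w', perm_vars V q (eval_monom (relfree_gen V) w) =
  eval_monom (relfree_gen V) w' & navars w' = map (perm_var q) (navars w).
Proof.
rewrite perm_vars_monom; elim: w => [i|w1 [w1' e1 v1] w2 [w2' e2 v2]].
  by exists (NAVar (perm_var q i)).
by exists (NAMul w1' w2'); rewrite /= ?e1 ?e2 // v1 v2 map_cat.
Qed.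

Lemma map_perm_var (q : 'S_n) : perm_eq (map (perm_var q) (iota 0 n)) (iota 0 n).
Proof.
have e : perm_var q \o val =1 val \o q by move=> i; exact: perm_var_ord.
rewrite -val_enum_ord -map_comp (eq_map e) map_comp.
apply: perm_map; apply: uniq_perm; rewrite ?(map_inj_uniq (@perm_inj _ q)) ?enum_uniq //.
move=> i; rewrite mem_enum; apply/mapP; exists ((q^-1)%g i); rewrite ?mem_enum //.
by rewrite permKV.
Qed.

Lemma perm_vars_linear (q : 'S_n) : linear (perm_vars V q).
Proof.
have E f : perm_vars V q (relfree_pi V f) = eval_poly (fun i => relfree_gen V (perm_var q i)) f.
  by apply: relfree_liftE => g; exact: relfree_identity.
move=> c u u'; rewrite -[u]relfree_piK -[u']relfree_piK -[c *: _]relfree_piZ -raddfD /= !E.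
by rewrite linearP.
Qed.

Lemma multilinear_perm (q : 'S_n) u : P u -> P (perm_vars V q u).
Proof.
move=> [s /allP sP ->].
have -> : perm_vars V q (\sum_(p <- s) p.1 *: eval_monom (relfree_gen V) p.2) =
  \sum_(p <- s) p.1 *: perm_vars V q (eval_monom (relfree_gen V) p.2).
  have L := perm_vars_linear q; elim: (s) => [|p r IH]; last by rewrite !big_cons L IH.
  by rewrite !big_nil; have := L (-1) 0 0; rewrite scaler0 addr0 => ->; rewrite scaleN1r addNr.
rewrite big_seq; apply: multilinear_sum => p /sP; rewrite /multilinear_monom => mp.
apply: multilinearZ; have [w' -> w'E] := perm_varsE q p.2.
exists [:: (1, w')]; last by rewrite big_seq1 scale1r.
rewrite /= andbT /multilinear_monom w'E.
by apply: perm_trans (map_perm_var q); exact: perm_map.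
Qed.

Definition word (w : n.-tuple 'I_4) : seq nat := map val w.
Definition wact (w : n.-tuple 'I_4) (q : 'S_n) : n.-tuple 'I_4 := [tuple tnth w (q i) | i < n].

Local Notation D := #|{: n.-tuple 'I_4}|.
Local Notation tup := (fun j : 'I_D => enum_val j : n.-tuple 'I_4).

(** The coordinates run over all words, not just Motzkin words, so that S_n acts by permuting
    positions. *)
Definition theta (u : relfree V) : 'rV[F]_D := \row_j (word_value u (word (tup j)))`_0.

Lemma theta_linear : linear theta.
Proof.
move=> c u u'; apply/rowP=> j; rewrite !mxE /word_value evrP /= coefD coefZ //.
Qed.
HB.instance Definition _ := GRing.isLinear.Build F (relfree V) 'rV[F]_D *:%R theta theta_linear.

Definition perm_word_mx (q : 'S_n) : 'M[F]_D := \matrix_(i, j) (tup i == wact (tup j) q)%:R.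

Lemma mul_perm_word_mx (x : 'rV[F]_D) q j :
  (x *m perm_word_mx q) 0 j = x 0 (enum_rank (wact (tup j) q)).
Proof.
rewrite mxE (bigD1 (enum_rank (wact (tup j) q))) //= mxE enum_rankK eqxx mulr1 big1 ?addr0 // =>
  i ij.
rewrite mxE; case: eqP => [e|]; last by rewrite mulr0.
by case/eqP: ij; rewrite -e enum_valK.
Qed.

Lemma perm_word_mx_repr : mx_repr [set: 'S_n] perm_word_mx.
Proof.
split=> [|q q' _ _]; apply/row_matrixP => i; apply/rowP => j; rewrite !rowE.
  rewrite mul_perm_word_mx mulmx1; congr (delta_mx _ _ _ _); rewrite -[RHS]enum_valK;
    congr enum_rank.
  by apply: eq_from_tnth => k; rewrite tnth_mktuple perm1.
rewrite mulmxA !mul_perm_word_mx; congr (delta_mx _ _ _ (enum_rank _)); rewrite enum_rankK.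
by apply: eq_from_tnth => k; rewrite !tnth_mktuple permM.
Qed.
Definition word_repr := MxRepresentation perm_word_mx_repr.
Local Notation pG := word_repr.

Lemma theta_perm q u : P u -> theta (perm_vars V q u) = theta u *m pG q.
Proof.
move=> Pu; apply/rowP => j; rewrite mul_perm_word_mx !mxE enum_rankK /word_value evr_perm.
suff -> : evr (lv (word (tup j)) 1 \o perm_var q) u = evr (lv (word (wact (tup j) q)) 1) u by [].
apply: (evr_ext Pu) => i ltin /=; rewrite -[i]/(nat_of_ord (Ordinal ltin)) perm_var_ord.
rewrite /lv; congr letter; rewrite /word !(nth_map 0) ?size_tuple //.
by rewrite -!tnth_nth tnth_mktuple.
Qed.

Hypotheses (char0 : [pchar F] =i pred0) (n_gt0 : (0 < n)%N).

Lemma motzkin_tuple w : w \in motzkin_words 1 n 0 -> exists j : 'I_D, word (tup j) = w.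
Proof.
case/size_mem_motzkin_words => sz w4.
have szt : size [seq inord i : 'I_4 | i <- w] == n by rewrite size_map sz.
exists (enum_rank (Tuple szt));
  rewrite enum_rankK /word /= -map_comp map_id_in // => i /(allP w4) i4 /=.
by rewrite inordK.
Qed.

Lemma theta_inj u : P u -> theta u = 0 -> u = 0.
Proof.
move=> Pu t0; apply: (motzkin_detect char0 Pu n_gt0) => w /motzkin_tuple[j <-].
by have := congr1 (fun x : 'rV_D => x 0 j) t0; rewrite !mxE.
Qed.

Definition in_theta (x : 'rV[F]_D) := exists2 u, P u & theta u = x.

Lemma in_thetaD x y : in_theta x -> in_theta y -> in_theta (x + y).
Proof. by move=> [u Pu <-] [v Pv <-]; exists (u + v); [exact: multilinearD|rewrite linearD]. Qed.
Lemma in_thetaZ c x : in_theta x -> in_theta (c *: x).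
Proof. by move=> [u Pu <-]; exists (c *: u); [exact: multilinearZ|rewrite linearZ]. Qed.
Lemma in_theta0 : in_theta 0.
Proof. by exists 0; [exact: multilinear0|rewrite linear0]. Qed.
Lemma in_theta_perm x q : in_theta x -> in_theta (x *m pG q).
Proof. by move=> [u Pu <-]; exists (perm_vars V q u);
  [exact: multilinear_perm|exact: theta_perm]. Qed.

Lemma in_theta_sub m (M : 'M[F]_(m, D)) : (forall i, in_theta (row i M)) ->
  forall x, (x <= M)%MS -> in_theta x.
Proof.
move=> rM x /submxP[c ->]; rewrite mulmx_sum_row.
by elim/big_rec: _ => [|i y _ ty]; [exact: in_theta0|apply: in_thetaD => //; exact: in_thetaZ].
Qed.

(** [Q] selects the coordinates at Motzkin words; by [motzkin_detect] it is injective on the image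
    of [theta]. *)
Lemma dim_upper m (M : 'M[F]_(m, D)) : (forall i, in_theta (row i M)) ->
  (\rank M <= n * motzkin n.-1 0)%N.
Proof.
move=> rM; pose k := size (motzkin_words 1 n 0).
pose Q : 'M[F]_(D, k) := \matrix_(i, j) (word (tup i) == nth [::] (motzkin_words 1 n 0) j)%:R.
rewrite -size_motzkin_words1 -(mxrank_mul_ker M Q).
suff -> : (M :&: kermx Q)%MS = 0 by rewrite mxrank0 addn0 rank_leq_col.
apply/eqP/rowV0P => x; rewrite sub_capmx => /andP[/(in_theta_sub rM)[u Pu <-] /sub_kermxP xQ].
suff -> : u = 0 by rewrite linear0.
apply: (motzkin_detect char0 Pu n_gt0) => w wm; have [j jw] := motzkin_tuple wm.
have wk : (index w (motzkin_words 1 n 0) < k)%N by rewrite index_mem.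
have := congr1 (fun y : 'rV_k => y 0 (Ordinal wk)) xQ; rewrite !mxE (bigD1 j) //= big1 => [|i ij].
  by rewrite !mxE nth_index // jw eqxx mulr1 addr0.
rewrite !mxE nth_index // -jw; case: eqP => [e|]; last by rewrite mulr0.
case/eqP: ij; apply: enum_val_inj; apply: val_inj; exact: (inj_map val_inj) e.
Qed.

Local Notation aG := (regular_repr F [set: 'S_n]).
Local Notation N := #|[set: 'S_n]|.
Local Notation ideal := (young_ideal F).
Local Notation I := (intpart n * 'I_4)%type.
Implicit Types p : I.
Local Notation cornered p := (corner p.1 p.2).

(** The module homomorphism from the regular representation that sends 1 to [theta] of the column
    product. *)
Definition psi p : 'M[F]_(N, D) := lin1_mx (mulmx (theta (hw F p.1 p.2)) \o gring_mx pG).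

Lemma mul_psi p x : x *m psi p = theta (hw F p.1 p.2) *m gring_mx pG x.
Proof. by rewrite mul_rV_lin1. Qed.

Lemma psiJ p m (x : 'M[F]_(m, N)) g : x *m aG g *m psi p = x *m psi p *m pG g.
Proof.
apply/row_matrixP => i; rewrite !row_mul !mul_psi gring_mxJ ?inE // mulmxA //.
Qed.

Lemma psiY p m (x : 'M[F]_(m, N)) l : x *m opY aG l *m psi p = x *m psi p *m opY pG l.
Proof.
rewrite !opYE !mulmx_sumr mulmx_suml; apply: eq_bigr => s _.
rewrite !mulmx_sumr mulmx_suml; apply: eq_bigr => t _.
by rewrite -!scalemxAr -scalemxAl psiJ.
Qed.

Lemma psi1 p : gring_row (1%:M : 'M[F]_N) *m psi p = theta (hw F p.1 p.2).
Proof. by rewrite mul_psi -[gring_mx _ _]/(gring_op pG 1%:M) gring_op1 mulmx1. Qed.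

Lemma psi_young p : cornered p -> young_symmetrizer F n p.1 *m psi p = theta (hwy F p.1 p.2).
Proof.
move=> cp; rewrite young_symE -[opY aG _]mul1mx gring_row_mul psiY psi1.
rewrite opYE mulmx_sumr [RHS](linear_sum theta); apply: eq_bigr => s _.
rewrite mulmx_sumr [RHS](linear_sum theta); apply: eq_bigr => t _.
by rewrite [RHS](linearZ_LR theta) -scalemxAr /= theta_perm //; apply: hw_multilinear.
Qed.

Lemma hwy_multilinear p : cornered p -> P (hwy F p.1 p.2).
Proof.
move=> cp; apply: multilinear_sum => s _; apply: multilinear_sum => t _.
by apply: multilinearZ; apply: multilinear_perm; apply: hw_multilinear.
Qed.

(** By [young_ideal_nondeg] it suffices that g Y_l kills x at (l, h0) for all g. Applied to the
    relation, g Y_l kills the ideals of other diagrams and turns the components at l into multiples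
    of the symmetrizer. What remains is a relation between the [hwy] of l, trivial by [theta_inj]
    and [hwy_free]. *)
Lemma psi_free (x : I -> 'rV[F]_N) : (forall p : I, cornered p -> (x p <= ideal p.1)%MS) ->
  \sum_(p : I | cornered p) x p *m psi p = 0 -> forall p : I, cornered p -> x p = 0.
Proof.
move=> xi sum0 [l h0] ch0; apply: (young_ideal_nondeg char0 (xi _ ch0)) => g /=.
have xgi p : cornered p -> (x p *m aG g <= ideal p.1)%MS.
  by move=> cp; apply: mxmodule_trans; rewrite ?inE ?xi //; exact: cyclic_mx_module.
have [c cP] : exists c : 'I_4 -> F, forall h : 'I_4, cornered (l, h) ->
    x (l, h) *m aG g *m opY aG l = c h *: young_symmetrizer F n l.
  have ex (h : 'I_4) : exists c, cornered (l, h) -> x (l, h) *m aG g *m opY aG l = c *: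
    young_symmetrizer F n l.
    case: (boolP (cornered (l, h))) => [ch|_]; last by exists 0.
    by have [c cP] := ideal_mul_eq char0 (xgi _ ch); exists c.
  by have [c cP] := choice ex; exists c.
rewrite (cP _ ch0); suff -> : c h0 = 0 by rewrite scale0r.
apply: (@hwy_free F char0 n l c) => //.
apply: theta_inj; first by apply: multilinear_sum => h ch; apply: multilinearZ;
  exact: (@hwy_multilinear (l, h)).
have := congr1 (fun y => y *m pG g *m opY pG l) sum0; rewrite !mul0mx !mulmx_suml => <-.
rewrite (linear_sum theta).
rewrite [RHS](eq_big (fun p : I => predT p.1 && corner p.1 p.2)
  (fun p : I => x (p.1, p.2) *m psi (p.1, p.2) *m pG g *m opY pG l)) //; last by case.
rewrite -(pair_big_dep predT (fun (l' : intpart n) (h : 'I_4) => corner l' h)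
   (fun l' h => x (l', h) *m psi (l', h) *m pG g *m opY pG l)) /= [RHS](bigD1 l) //= [X in _ = _
     + X]big1.
  rewrite addr0; apply: eq_bigr => h ch; rewrite -psiJ -psiY cP // -scalemxAl linearZ /=.
  by rewrite (psi_young (p := (l, h))).
move=> l' l'l; rewrite big1 // => h ch;
  rewrite -psiJ -psiY (ideal_mul_neq char0 _ (xgi (l', h) ch)) ?mul0mx //.
exact/eqP.
Qed.

(** For a corner p this is a single copy of the irreducible module, not the whole isotypic
    component. *)
Definition isotypic p : 'M[F]_D := <<ideal p.1 *m psi p>>%MS.

Lemma isotypicP p (y : 'rV[F]_D) : (y <= isotypic p)%MS -> exists2 x, (x <= ideal p.1)%MS & y = x
  *m psi p.
Proof.
rewrite genmxE => /submxP[a ->]; exists (a *m ideal p.1); rewrite ?submxMl //.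
by rewrite mulmxA.
Qed.

Lemma isotypic_module p : mxmodule pG (isotypic p).
Proof.
apply/mxmoduleP => g _; rewrite (eqmxMr _ (genmxE _)) genmxE -psiJ submxMr //.
by apply: mxmodule_trans; rewrite ?inE //; exact: cyclic_mx_module.
Qed.

Lemma psi_injective p (x : 'rV[F]_N) : cornered p -> (x <= ideal p.1)%MS -> x *m psi p = 0 -> x = 0.
Proof.
move=> cp xi x0; pose X (q : I) := if q == p then x else 0.
have : X p = 0.
  apply: (psi_free (x := X)) => // [q _|]; first by rewrite /X; case: eqP => [->|_];
    rewrite ?sub0mx.
  rewrite (bigD1 p) //= {1}/X eqxx x0 add0r big1 // => q /andP[_ /negPf qp].
  by rewrite /X qp mul0mx.
by rewrite /X eqxx.
Qed.

Lemma rank_ideal_psi p : cornered p -> \rank (ideal p.1 *m psi p) = \rank (ideal p.1).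
Proof.
move=> cp; rewrite -[RHS](mxrank_mul_ker _ (psi p)).
suff -> : (ideal p.1 :&: kermx (psi p))%MS = 0 by rewrite mxrank0 addn0.
apply/eqP/rowV0P => x; rewrite sub_capmx => /andP[xi /sub_kermxP].
exact: psi_injective.
Qed.

Lemma isotypic_rsim p : cornered p ->
  mx_rsim (submod_repr (isotypic_module p)) (Defs.irr_repr F n p.1).
Proof.
move=> cp; apply: mx_rsim_sym.
pose B := in_submod (isotypic p) (val_submod (1%:M : 'M_(\rank (ideal p.1))) *m psi p).
have sub : (val_submod (1%:M : 'M_(\rank (ideal p.1))) *m psi p <= isotypic p)%MS.
  by rewrite genmxE submxMr // val_submod1.
have er : \rank (ideal p.1) = \rank (isotypic p) by rewrite [RHS]mxrank_gen rank_ideal_psi.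
apply: (MxReprSim (B := B)) => //.
  rewrite /row_free; apply/eqP; rewrite -[RHS](rank_ideal_psi cp) -(mxrankMfree B (row_base_free
    _)).
  rewrite -[B *m _]/(val_submod B) in_submodK //.
  by rewrite (eqmxMr _ (val_submod1 _)).
move=> g Gg; apply: (@val_submod_inj _ _ (isotypic p)).
rewrite val_submodJ // in_submodK // -psiJ -(val_submodJ (cyclic_mx_module _ _)) ?inE // mul1mx.
by rewrite val_submodE -mulmxA -val_submodE in_submodK // mulmxA -val_submodE.
Qed.

Definition multilinear_mx := (\sum_(p : I | cornered p) isotypic p)%MS.

Lemma image_direct : mxdirect (\sum_(p : I | cornered p) isotypic p)%MS.
Proof.
apply/mxdirect_sumsP => p cp; apply/eqP/rowV0P => y; rewrite sub_capmx => /andP[].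
move=> /isotypicP[x xi ->] /sub_sumsmxP[u uE].
have ex (q : I) : exists z : 'rV[F]_N, [/\ cornered q -> (z <= ideal q.1)%MS & u q *m isotypic q
  = z *m psi q].
  case: (isotypicP (submxMl (u q) (isotypic q))) => z zi ->; by exists z.
have [z zP] := choice ex; pose X (q : I) := if q == p then - x else z q.
have Xp : X p = 0.
  apply: (psi_free (x := X)) => // [q cq|]; rewrite /X.
    by case: eqP => [->|_]; [rewrite eqmx_opp|apply: (zP q).1].
  rewrite (bigD1 p) //= eqxx mulNmx uE addrC; apply/eqP; rewrite subr_eq0; apply/eqP.
  by apply: eq_bigr => q /andP[_ /negPf qp]; rewrite qp (zP q).2.
by move: Xp; rewrite /X eqxx => /eqP; rewrite oppr_eq0 => /eqP ->; rewrite mul0mx.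
Qed.

Lemma image_module : mxmodule pG multilinear_mx.
Proof. by apply: sumsmx_module => p _; exact: isotypic_module. Qed.

Lemma rank_image : \rank multilinear_mx = \sum_(p : I | cornered p) \rank (ideal p.1).
Proof.
rewrite (mxdirectP image_direct) /=; apply: eq_bigr => p cp.
by rewrite [LHS]mxrank_gen rank_ideal_psi.
Qed.

Lemma in_theta_image (x : 'rV[F]_D) : (x <= multilinear_mx)%MS -> in_theta x.
Proof.
move=> /sub_sumsmxP[u ->]; elim/big_rec: _ => [|p y cp ty]; first exact: in_theta0.
apply: in_thetaD => //; have [z _ ->] := isotypicP (submxMl (u p) (isotypic p)).
rewrite mul_psi /gring_mx /= [z *m _]mulmx_sum_row linear_sum mulmx_sumr.
elim/big_rec: _ => [|i w _ tw]; first exact: in_theta0.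
apply: in_thetaD => //; rewrite linearZ /= -scalemxAr; apply: in_thetaZ.
rewrite rowK mxvecK; apply: in_theta_perm; exists (hw F p.1 p.2) => //.
exact: hw_multilinear.
Qed.

(** Adjoining [theta u] cannot raise the rank: [dim_upper] bounds it by n M_(n-1), a value already
    reached by [dim_lower]. *)
Lemma theta_image u : P u -> (theta u <= multilinear_mx)%MS.
Proof.
move=> Pu; have le_dim : (\rank (col_mx multilinear_mx (theta u)) <= \rank multilinear_mx)%N.
  apply: leq_trans (_ : n * motzkin n.-1 0 <= _)%N; last first.
    by rewrite rank_image; exact: dim_lower.
  apply: dim_upper => i; case: (split_ordP i) => j ->; rewrite ?rowKu ?rowKd.
    by apply: in_theta_image; exact: row_sub.
  by exists u => //; rewrite (ord1 j) row_id.
have sub : (multilinear_mx <= col_mx multilinear_mx (theta u))%MS by rewrite -addsmxE addsmxSl.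
have /eqmxP e : (multilinear_mx == col_mx multilinear_mx (theta u))%MS by rewrite
  -mxrank_leqif_eq // eqn_leq le_dim mxrankS.
by rewrite e -addsmxE addsmxSr.
Qed.

Lemma tr_image q : \tr (submod_repr image_module q) =
  \sum_(l : intpart n) (\sum_(h < 4) corner l h)%:R * irr_char F l q.
Proof.
rewrite -(mxtrace_dsum_mod isotypic_module image_module (eqmx_refl _) image_direct) ?inE //.
rewrite (eq_bigr (fun p : I => irr_char F p.1 q)); last first.
  by move=> p cp; rewrite (mxtrace_rsim (isotypic_rsim cp)) ?inE.
rewrite (eq_bigl (fun p : I => predT p.1 && corner p.1 p.2)) //.
rewrite -(pair_big_dep predT (fun (l : intpart n) (h : 'I_4) => corner l h) (fun l _ => irr_char
  F l q)) /=.
apply: eq_bigr => l _; rewrite big_mkcond natr_sum mulr_suml; apply: eq_bigr => h _.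
by case: corner; rewrite ?mul1r ?mul0r.
Qed.

End Multilinear.

(** * The table of multiplicities *)

Ltac no_shape := let H := fresh in intro H; decompose [ex ex2 and and3 and4 or3 or4] H; clear H;
  repeat match goal with
  | E : _ :: _ = _ :: _ |- _ => injection E; clear E; intros
  | E : _ :: _ = [::] |- _ => discriminate E
  | E : [::] = _ :: _ |- _ => discriminate E
  end; lia.

(** With at most three rows the corners are the strict descents; a fourth row must have length 1 and
    leaves only its own corner. *)
Lemma multiplicity_corner n (l : intpart n) : (1 <= n)%N ->
  (if `[< [\/ parts l = [:: n],
              exists2 p, (1 <= p)%N & parts l = [:: p; p],
              exists2 p, (1 <= p)%N & parts l = [:: p; p; p] |
              exists p q r : nat, parts l =
                [:: p + q + r + 1; p + q + 1; p + 1; 1]%N] >]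
   then 1
   else if `[< exists p q : nat, [/\ (1 <= p)%N, (1 <= q)%N &
              [\/ parts l = [:: p + q; p]%N,
                  parts l = [:: p + q; p; p]%N |
                  parts l = [:: p + q; p + q; p]%N]] >]
   then 2
   else if `[< exists p q r : nat,
              [/\ (1 <= p)%N, (1 <= q)%N, (1 <= r)%N &
                  parts l = [:: p + q + r; p + q; p]%N] >]
   then 3
   else 0) = (\sum_(h < 4) corner l h)%:Z :> int.
Proof.
move=> n_gt0; have sn := sumn_parts l; have := sorted_parts l; have := parts_gt0 l.
rewrite !big_ord_recr big_ord0 /= add0n.
case: (parts l) sn => [|a [|b [|c [|d [|e s]]]]] /= sn.
- by rewrite -sn in n_gt0.
- rewrite inE eq_sym -lt0n => a0 _; rewrite asboolT; last by constructor 1; rewrite -sn addn0.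
  by rewrite /corner /= a0.
- rewrite !inE !negb_or ![(0 == _)%N]eq_sym -!lt0n => /andP[a0 b0] /andP[ba _].
  rewrite /corner /= b0; case: (ltngtP b a) ba => // ba _.
    rewrite asboolF; last by no_shape.
    rewrite asboolT //; exists b, (a - b)%N; split; [exact: b0|by rewrite subn_gt0|].
    by constructor 1; rewrite subnKC ?(ltnW ba).
  by rewrite asboolT //; constructor 2; exists b => //; rewrite ba.
- rewrite !inE !negb_or ![(0 == _)%N]eq_sym -!lt0n => /and3P[a0 b0 c0] /and3P[ba cb _].
  rewrite /corner /= c0; case: (ltngtP b a) ba => // ba _; case: (ltngtP c b) cb => // cb _.
  + rewrite asboolF; last by no_shape.
    rewrite asboolF; last by no_shape.
    rewrite asboolT //; exists c, (b - c)%N, (a - b)%N; split; rewrite ?subn_gt0 //.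
    by rewrite (subnKC (ltnW cb)) (subnKC (ltnW ba)).
  + rewrite asboolF; last by no_shape.
    rewrite asboolT //; exists c, (a - b)%N; split; rewrite ?subn_gt0 //.
    by constructor 2; rewrite cb subnKC ?(ltnW ba).
  + rewrite asboolF; last by no_shape.
    rewrite asboolT //; exists c, (b - c)%N; split; rewrite ?subn_gt0 //.
    by constructor 3; rewrite subnKC ?(ltnW cb) // ba.
  + by rewrite asboolT //; constructor 3; exists c => //; rewrite -ba -cb.
- rewrite !inE !negb_or ![(0 == _)%N]eq_sym -!lt0n => /and4P[a0 b0 c0 d0] /and4P[ba cb dc _].
  case: (eqVneq d 1%N) => [d1|d1].
    rewrite asboolT; last first.
      constructor 4; exists c.-1, (b - c)%N, (a - b)%N; rewrite d1; congr [:: _; _; _; _]; lia.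
    by rewrite /corner d1 /= !andbF.
  rewrite asboolF; last by no_shape.
  rewrite asboolF; last by no_shape.
  rewrite asboolF; last by no_shape.
  rewrite /corner /= !(gtn_eqF d0) (negPf d1) !andbF //.
- rewrite !inE !negb_or ![(0 == _)%N]eq_sym -!lt0n => /and5P[a0 b0 c0 d0 /andP[e0 _]] _.
  rewrite asboolF; last by no_shape.
  rewrite asboolF; last by no_shape.
  rewrite asboolF; last by no_shape.
  by rewrite /corner /= (gtn_eqF e0) !andbF.
Qed.

Lemma intr_inj_pchar0 (F : fieldType) : [pchar F] =i pred0 -> injective (fun z : int => z%:~R : F).
Proof.
move=> char0 x y /eqP; rewrite -subr_eq0 -mulrzBr -[x]/(x) => /eqP e; apply/eqP; rewrite -subr_eq0.
case: (x - y) e => [k|k] /eqP; first by rewrite -pmulrn (proj1 (pcharf0P F) char0).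
by rewrite NegzE mulrNz oppr_eq0 -pmulrn (proj1 (pcharf0P F) char0).
Qed.

(** * From the image of [theta] to the character of P_n *)

Section Character.
Variables (F : fieldType) (char0 : [pchar F] =i pred0) (n : nat) (n_gt0 : (0 < n)%N).
Local Notation V := (V3tilde F).
Local Notation P := (multilinear_part V n).
Local Notation multilinear_mx := (multilinear_mx F n).
Local Notation pG := (word_repr F n).
Local Notation theta := (@theta F n).

Lemma theta_inj2 u u' : P u -> P u' -> theta u = theta u' -> u = u'.
Proof.
move=> Pu Pu' e; apply/eqP; rewrite -subr_eq0; apply/eqP; apply: (theta_inj char0 n_gt0).
  by rewrite -scaleN1r; apply: multilinearD => //; exact: multilinearZ.
by rewrite linearB /= e subrr.
Qed.

Lemma module_character_image :
  module_character P (perm_vars V) (fun q => \tr (submod_repr (image_module F n) q)).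
Proof.
pose M := row_base multilinear_mx.
have ex i : exists u, P u /\ theta u = row i M.
  have [|u Pu uE] := in_theta_image (x := row i M); last by exists u.
  by rewrite (submx_trans (row_sub _ _)) // eq_row_base.
have [e eP] := choice ex.
have Psum c : P (\sum_i c i *: e i).
  by apply: multilinear_sum => i _; apply: multilinearZ; exact: (eP i).1.
have theta_sum (c : 'rV[F]_(\rank multilinear_mx)) : theta (\sum_i c 0 i *: e i) = c *m M.
  rewrite linear_sum mulmx_sum_row; apply: eq_bigr => i _.
  by rewrite linearZ /= (eP i).2.
exists (\rank multilinear_mx), e, (submod_repr (image_module F n)); split=> //.
- move=> u; split=> [Pu|[c ->]]; last exact: Psum.
  have /submxP[c cE] : (theta u <= M)%MS by rewrite eq_row_base; exact: theta_image.
  by exists c; apply: theta_inj2 => //; rewrite theta_sum.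
- move=> c c0; have := theta_sum c; rewrite c0 linear0 => /esym/eqP.
  by rewrite mulmx_free_eq0 ?row_base_free // => /eqP.
- move=> q i; apply: theta_inj2; [apply: multilinear_perm; exact: (eP i).1|exact: Psum|].
  rewrite (theta_perm q (eP i).1) (eP i).2 -row_mul.
  have := val_submodJ (image_module F n) 1%:M (in_setT q); rewrite mul1mx /= => E.
  have -> : M *m pG q = submod_repr (image_module F n) q *m M.
    have -> : M = val_submod (1%:M : 'M_(\rank multilinear_mx)) by rewrite /val_submod /= mul1mx.
    by rewrite -E [LHS]val_submodE.
  rewrite row_mul -theta_sum; congr theta; apply: eq_bigr => j _; by rewrite mxE.
Qed.

(** [theta] carries any basis of P_n to a basis of the image, and its coordinate matrix intertwines
    the two representations. *)
Lemma module_character_uniq chi : module_character P (perm_vars V) chi ->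
  forall q, chi q = \tr (submod_repr (image_module F n) q).
Proof.
move=> [d [e [rG [eP e_free eJ chiE]]]] q; rewrite chiE.
pose E : 'M_(d, _) := \matrix_i theta (e i).
have theta_sum (c : 'rV[F]_d) : theta (\sum_i c 0 i *: e i) = c *m E.
  by rewrite linear_sum mulmx_sum_row; apply: eq_bigr => i _; rewrite linearZ /= rowK.
have Pe i : P (e i).
  apply/eP; exists (delta_mx 0 i); rewrite (bigD1 i) //= mxE !eqxx scale1r big1 ?addr0 // => j ji.
  by rewrite mxE (negPf ji) andbF scale0r.
have Eimage : (E :=: multilinear_mx)%MS.
  apply/eqmxP/andP; split.
    by apply/row_subP => i; rewrite rowK; exact: theta_image.
  apply/rV_subP => x /(in_theta_image)[u /eP[c ->] <-].
  by rewrite theta_sum submxMl.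
have E_free : row_free E.
  rewrite -kermx_eq0; apply/rowV0P => c /sub_kermxP; rewrite -theta_sum => c0.
  apply: e_free; apply: (theta_inj char0 n_gt0) => //.
  by apply/eP; exists c.
have Esub : (E <= multilinear_mx)%MS by rewrite Eimage.
have er : d = \rank multilinear_mx by rewrite -Eimage; apply/esym/eqP.
apply: mxtrace_rsim; rewrite ?inE //.
apply: (MxReprSim (B := in_submod multilinear_mx E)) => //.
  rewrite /row_free -(mxrankMfree _ (row_base_free multilinear_mx)).
  by rewrite -[_ *m row_base _]/(val_submod _) in_submodK.
move=> g _; apply: (@val_submod_inj _ _ multilinear_mx).
rewrite val_submodJ ?inE // in_submodK // val_submodE -mulmxA -val_submodE in_submodK //.
apply/row_matrixP => i; rewrite !row_mul !rowK -(theta_perm g (Pe i)) eJ -theta_sum.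
by congr theta; apply: eq_bigr => j _; rewrite mxE.
Qed.

End Character.

Theorem theorem1 (Phi : fieldType) (char0 : [pchar Phi] =i pred0)
  (n : nat) (n_gt0 : (1 <= n)%N) (m : intpart n -> int) :
  module_character (multilinear_part (V3tilde Phi) n) (perm_vars (V3tilde Phi))
    (fun q : 'S_n => \sum_(l : intpart n) (m l)%:~R * irr_char Phi l q)
  <->
  forall l : intpart n,
    m l =
      if `[< [\/ parts l = [:: n],
                 exists2 p, (1 <= p)%N & parts l = [:: p; p],
                 exists2 p, (1 <= p)%N & parts l = [:: p; p; p] |
                 exists p q r : nat, parts l =
                   [:: p + q + r + 1; p + q + 1; p + 1; 1]%N] >]
      then 1
      else if `[< exists p q : nat, [/\ (1 <= p)%N, (1 <= q)%N &
                 [\/ parts l = [:: p + q; p]%N,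
                     parts l = [:: p + q; p; p]%N |
                     parts l = [:: p + q; p + q; p]%N]] >]
      then 2
      else if `[< exists p q r : nat,
                 [/\ (1 <= p)%N, (1 <= q)%N, (1 <= r)%N &
                     parts l = [:: p + q + r; p + q; p]%N] >]
      then 3
      else 0.
Proof.
split=> [mP l|mE].
  (* In characteristic 0 the integers embed in [Phi], so independence of the characters over [Phi]
     determines m. *)
  rewrite (multiplicity_corner l n_gt0); apply: (intr_inj_pchar0 char0); rewrite -pmulrn.
  apply/eqP; rewrite -subr_eq0; apply/eqP; move: l.
  apply: (irr_char_indep char0) => q; under eq_bigr do rewrite mulrBl.
  by rewrite sumrB -(tr_image char0 n_gt0) (module_character_uniq char0 n_gt0 mP) subrr.
have [d [e [rG [eP e_free eJ chiE]]]] := module_character_image char0 n_gt0.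
exists d, e, rG; split=> // q; rewrite -chiE /= (tr_image char0 n_gt0); apply: eq_bigr => l _.
by rewrite mE (multiplicity_corner l n_gt0) -pmulrn.
Qed.
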